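(* Let $G\in\mathcal L(Y)$ (in particular $G=I$), $\alpha>0$, and for $n\in\mathbb Z^+$ let $G_n=G\,n(nI-A)^{-1}$. For $s\in[0,T)$ and $y_0\in Y$ let $y(t)=e^{(t-s)A}y_0+\int_s^te^{(t-r)A}Bg(r)\,dr$ and $$J_s(g)=\alpha\int_s^T\|g(t)\|_U^2dt+\|Gy(T)\|_Y^2,\qquad J_{s,n}(g)=\alpha\int_s^T\|g(t)\|_U^2dt+\|G_ny(T)\|_Y^2,$$ to be minimized over $g\in L^2(s,T;U)$. Let $\hat g(\cdot,s,y_0),\hat y(\cdot,s,y_0)$ and $\hat g_n(\cdot,s,y_0),\hat y_n(\cdot,s,y_0)$ be the respective unique optimal controls and states, and let $P(t)x=e^{(T-t)A^*}G^*G\,\hat y(T,t,x)$, $P_n(t)x=e^{(T-t)A^*}G_n^*G_n\,\hat y_n(T,t,x)$ be the respective optimal cost operators ($t\in[0,T]$, $x\in Y$; for $t=T$, $\hat y(T,T,x)=\hat y_n(T,T,x)=x$). Then, as $n\to+\infty$, for each $y_0\in Y$: (a) $\|\hat g_n(\cdot,s,y_0)-\hat g(\cdot,s,y_0)\|_{L^2(s,T;U)}\to0$, uniformly in $s$; (b) $\|\hat y_n(\cdot,s,y_0)-\hat y(\cdot,s,y_0)\|_{C([s,T],Y)}\to0$, uniformly in $s$; (c) $J_{s,n}(\hat g_n(\cdot,s,y_0))-J_s(\hat g(\cdot,s,y_0))\to0$ in $\mathbb R$, uniformly in $s$; (d) $P_n(\cdot)z\to P(\cdot)z$ in $C([0,T],Y)$,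 for all $z\in Y$.
   Context: Setting. $T>0$; $\Omega\subset\mathbb R^3$ is a bounded, open, connected set with $C^{1,1}$ boundary $\Gamma$ and exterior unit normal $\nu$. $\varepsilon,\mu$ are $3\times3$ real-symmetric, uniformly positive definite matrix functions with entries in $W^{1,\infty}(\Omega)$; $\sigma$ is a real-symmetric, non-negative definite matrix function with entries in $L^\infty(\Omega)$. Spaces. $Y=L^2(\Omega,\mathbb C^6)$ with inner product $(y,z)_Y=(y_1,\varepsilon z_1)_{L^2(\Omega)}+(y_2,\mu z_2)_{L^2(\Omega)}$. $U=H^{1/2}_{\mathrm{tan}}(\Gamma)$ (tangential $\mathbb C^3$-valued fields in $H^{1/2}(\Gamma)$) with inner product $(f,g)_U=(\sqrt{-\Delta_\Gamma}f,g)_{L^2(\Gamma)}$, where $-\Delta_\Gamma$ is the Laplace–Beltrami operator on $\Gamma$, taken to be positive, self-adjoint and invertible. $H(\mathrm{curl},\Omega)=\{u\in L^2(\Omega,\mathbb C^3):\nabla\times u\in L^2(\Omega,\mathbb C^3)\}$, $H_0(\mathrm{curl},\Omega)=\{u\in H(\mathrm{curl},\Omega):\nu\times u=0\text{ on }\Gamma\}$. Operators. $\mathcal D(A)=H(\mathrm{curl},\Omega)\times H_0(\mathrm{curl},\Omega)$, $Ay=(\varepsilon^{-1}\nabla\times y_2-\varepsilon^{-1}\sigma y_1,\,-\mu^{-1}\nabla\times y_1)$. $A$ generates a strongly continuous contraction semigroup $e^{tA}$ on $Y$ (so $(nI-A)^{-1}\in\mathcal L(Y)$ for $n\ge1$);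 $\mathcal D(A^* )=\mathcal D(A)$ and $A^*z=(-\varepsilon^{-1}\nabla\times z_2-\varepsilon^{-1}\sigma z_1,\ \mu^{-1}\nabla\times z_1)$. $A$ extends to a bounded operator $Y\to[\mathcal D(A^* )]'$ by $(Ay,z)=(y,A^*z)_Y$, $z\in\mathcal D(A^* )$ (duality with pivot $Y$), and $e^{tA}$ extends to $[\mathcal D(A^* )]'$. The Green map $\mathcal G\colon U\to H(\mathrm{curl},\Omega)^2$ sends $g$ to the solution $y=(y_1,y_2)$ of $\varepsilon y_1-\nabla\times y_2+\sigma y_1=0$, $\mu y_2+\nabla\times y_1=0$ in $\Omega$, $\nu\times y_2=g$ on $\Gamma$. The control operator is $B=(I-A)\mathcal G\colon U\to[\mathcal D(A^* )]'$. The system $y'=Ay+Bg$ is the abstract form of Maxwell's equations $\varepsilon e_t-\nabla\times h+\sigma e=0$, $\mu h_t+\nabla\times e=0$ with $\nu\times h=g$ on $\Gamma$, $y=(e,h)$. Known well-posedness fact: $g\mapsto\int_s^{\cdot}e^{(\cdot-r)A}Bg(r)\,dr$ is bounded from $L^2(s,T;U)$ to $C([s,T],Y)$. ''Uniformly in $s$'' means uniformly for $s\in[0,T)$. *)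

(* Defs.v *)
From HB Require Import structures.
From mathcomp Require Import all_boot all_order all_algebra.
From mathcomp Require Import complex.
From mathcomp Require Import all_classical all_reals all_analysis.
Set Implicit Arguments.
Unset Strict Implicit.
Unset Printing Implicit Defensive.
Import Order.TTheory GRing.Theory Num.Theory.
Import numFieldNormedType.Exports.
Local Open Scope classical_set_scope.
Local Open Scope complex_scope.
Local Open Scope ring_scope.

(** * Complex inner-product spaces given by representatives

   An [L^2]-type space is a set of functions in which two functions that agree
   almost everywhere are the same element.  No quotient is taken: a space is a
   set of representatives with an inner product (linear in its first, antilinear
   in its second argument), and equality of elements is [heq], i.e. the
   difference has norm zero. *)

Section InnerProductSpaces.
Variable R : realType.

Record hspace (V : lmodType R[i]) := HSpace {
  hdom : set V ;
  hip : V -> V -> R[i] }.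

Section OneSpace.
Variables (V : lmodType R[i]) (X : hspace V).

Definition hnorm (x : V) : R := Num.sqrt (complex.Re (hip X x x)).
Definition heq (x y : V) : Prop := hnorm (x - y) = 0.

Definition hcauchy (u : nat -> V) : Prop :=
  forall e : R, 0 < e -> exists N : nat,
    forall m n : nat, (N <= m)%N -> (N <= n)%N -> hnorm (u m - u n) < e.

Definition is_hilbert : Prop :=
  [/\ hdom X 0 /\
      (forall (a : R[i]) x y, hdom X x -> hdom X y -> hdom X (a *: x + y)),
      (forall (a : R[i]) x y z, hdom X x -> hdom X y -> hdom X z ->
         hip X (a *: x + y) z = a * hip X x z + hip X y z),
      (forall x y, hdom X x -> hdom X y -> hip X y x = conjc (hip X x y)),
      (forall x, hdom X x -> 0 <= hip X x x) &
      (forall u : nat -> V, (forall n, hdom X (u n)) -> hcauchy u ->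
         exists2 x, hdom X x & hnorm (u n - x) @[n --> \oo] --> (0 : R))].

Definition hdense (D : set V) : Prop :=
  forall x, hdom X x -> forall e : R, 0 < e ->
    exists2 y, D y & hnorm (x - y) < e.

(* An unbounded operator is given by its graph, [L x y] reading "x is in the
   domain of L and L x = y"; graphs are closed under [heq] in both arguments. *)
Definition gdom (L : V -> V -> Prop) : set V := [set x | exists y, L x y].

(* Some representative of [L x], for [x] in the domain of [L]. *)
Definition gval (L : V -> V -> Prop) (x : V) : V := xget 0 [set y | L x y].

Definition is_adjoint_graph (L Ls : V -> V -> Prop) : Prop :=
  hdense (gdom L) /\
  forall z w, Ls z w <->
    [/\ hdom X z, hdom X w & forall x y, L x y -> hip X y z = hip X x w].

Definition selfadjoint (L : V -> V -> Prop) : Prop :=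
  (forall x y, L x y -> hdom X x /\ hdom X y) /\ is_adjoint_graph L L.

Definition positive_graph (L : V -> V -> Prop) : Prop :=
  forall x y, L x y -> 0 <= hip X y x.

Definition invertible_graph (L : V -> V -> Prop) : Prop :=
  (exists2 c : R, 0 < c & forall x y, L x y -> c * hnorm x <= hnorm y) /\
  (forall y, hdom X y -> exists x, L x y).

Definition is_sqrt_graph (L M : V -> V -> Prop) : Prop :=
  [/\ selfadjoint M, positive_graph M &
      forall x z, L x z <-> exists2 y, M x y & M y z].

(* Bounded operators with everywhere defined adjoints. *)
Definition is_adjoint (F Fs : V -> V) : Prop :=
  (forall y, hdom X y -> hdom X (Fs y)) /\
  (forall x y, hdom X x -> hdom X y -> hip X (F x) y = hip X x (Fs y)).

(* [S], restricted to times [t >= 0], is a strongly continuous contraction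
   semigroup whose infinitesimal generator is [A]. *)
Definition generates_contraction_semigroup
    (A : V -> V -> Prop) (S : R -> V -> V) : Prop :=
  [/\ (forall t, 0 <= t ->
         [/\ forall x, hdom X x -> hdom X (S t x),
             forall (a : R[i]) x y, hdom X x -> hdom X y ->
               heq (S t (a *: x + y)) (a *: S t x + S t y) &
             forall x, hdom X x -> hnorm (S t x) <= hnorm x]),
      (forall x, hdom X x -> heq (S 0 x) x),
      (forall t r x, 0 <= t -> 0 <= r -> hdom X x ->
         heq (S (t + r) x) (S t (S r x))),
      (forall x, hdom X x -> hnorm (S h x - x) @[h --> 0^'+] --> (0 : R)) &
      (forall x z, A x z <->
         [/\ hdom X x, hdom X z &
             hnorm ((h^-1)%:C *: (S h x - x) - z) @[h --> 0^'+] --> (0 : R)])].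

(** ** Functions of time with values in [X] *)

(* [y] restricted to [s, t] is an element of C([s, t], X). *)
Definition continuous_in_time (s t : R) (y : R -> V) : Prop :=
  forall r, s <= r <= t -> hdom X (y r) /\
    forall e : R, 0 < e -> exists2 d : R, 0 < d &
      forall q, s <= q <= t -> `|q - r| < d -> hnorm (y q - y r) < e.

Definition simple_in_time (D : set R) (f : R -> V) : Prop :=
  exists (m : nat) (E : 'I_m -> set (measurableTypeR R)) (u : 'I_m -> V),
    [/\ forall i, measurable (E i), forall i, hdom X (u i) &
        forall t, D t -> f t = \sum_(i < m) (\1_(E i) t : R)%:C *: u i].

Definition strongly_measurable (D : set R) (f : R -> V) : Prop :=
  (forall t, D t -> hdom X (f t)) /\
  exists F : nat -> R -> V,
    (forall k, simple_in_time D (F k)) /\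
    (forall t, D t -> hnorm (F k t - f t) @[k --> \oo] --> (0 : R)).

(* The Bochner space L^2(s, t; X); every class has a representative that is
   strongly measurable at each time, not just at almost every time. *)
Definition L2_in_time (s t : R) (f : R -> V) : Prop :=
  strongly_measurable `]s, t[ f /\
  (\int[lebesgue_measure]_(r in `]s, t[) (hnorm (f r) ^+ 2)%:E < +oo)%E.

Definition sqnorm_in_time (s t : R) (f : R -> V) : R :=
  \int[lebesgue_measure]_(r in `]s, t[) (hnorm (f r) ^+ 2).

Definition L2norm_in_time (s t : R) (f : R -> V) : R :=
  Num.sqrt (sqnorm_in_time s t f).

End OneSpace.

Definition bounded_op (V W : lmodType R[i]) (X : hspace V) (Y : hspace W)
    (F : V -> W) : Prop :=
  [/\ forall x, hdom X x -> hdom Y (F x),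
      forall (a : R[i]) x y, hdom X x -> hdom X y ->
        heq Y (F (a *: x + y)) (a *: F x + F y) &
      exists C : R, forall x, hdom X x -> hnorm Y (F x) <= C * hnorm X x].

(* [Rl = (lam I - A)^-1], bounded. *)
Definition is_resolvent (V : lmodType R[i]) (X : hspace V)
    (A : V -> V -> Prop) (lam : R[i]) (Rl : V -> V) : Prop :=
  [/\ bounded_op X X Rl,
      (forall x, hdom X x -> exists2 w, A (Rl x) w & heq X (lam *: Rl x - w) x) &
      (forall x w, A x w -> heq X (Rl (lam *: x - w)) x)].

End InnerProductSpaces.

(** * Square-integrable complex matrix-valued fields *)

Section Fields.
Variable R : realType.

Section L2.
Variables (d : measure_display) (M : measurableType d).
Variables (mu : {measure set M -> \bar R}) (D : set M).

Definition cint (f : M -> R[i]) : R[i] :=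
  (\int[mu]_(x in D) complex.Re (f x)) +i* (\int[mu]_(x in D) complex.Im (f x)).

Variables m n : nat.

Definition cdot (v w : 'M[R[i]]_(m, n)) : R[i] :=
  \sum_i \sum_j v i j * conjc (w i j).

Definition csqnorm (v : 'M[R[i]]_(m, n)) : R := complex.Re (cdot v v).

Definition L2_field : set (M -> 'M[R[i]]_(m, n)) := [set u : M -> 'M[R[i]]_(m, n) |
  (forall i j, measurable_fun D (fun x => complex.Re (u x i j)) /\
               measurable_fun D (fun x => complex.Im (u x i j))) /\
  (\int[mu]_(x in D) (csqnorm (u x))%:E < +oo)%E].

Definition L2_space : hspace (M -> 'M[R[i]]_(m, n)) :=
  HSpace L2_field (fun u v => cint (fun x => cdot (u x) (v x))).

End L2.
End Fields.

(** * Geometry and calculus in R^3 *)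

Section Euclid.
Variable R : realType.
Local Notation mR := (measurableTypeR R).
Local Notation pt := (R * R * R)%type.

Definition vec3 (x : pt) : 'rV[R]_3 := \row_j nth 0 [:: x.1.1; x.1.2; x.2] j.

Definition axis (j : 'I_3) : pt :=
  ((j == 0%N :> nat)%:R, (j == 1%N :> nat)%:R, (j == 2%N :> nat)%:R).

Definition dot3 (u v : 'rV[R]_3) : R := \sum_j u 0 j * v 0 j.

(* The norm of the library on [R * R * R] is the sup norm. *)
Definition edist (x y : pt) : R :=
  Num.sqrt (dot3 (vec3 x - vec3 y) (vec3 x - vec3 y)).

Definition partial (j : 'I_3) (f : pt -> R) (x : pt) : R := 'D_(axis j) f x.

Fixpoint of_class_C (k : nat) (f : pt -> R) : Prop :=
  continuous f /\
  if k is k'.+1 then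
    forall j, (forall x, derivable f x (axis j)) /\ of_class_C k' (partial j f)
  else True.

Definition smooth (f : pt -> R) : Prop := forall k, of_class_C k f.

(* C_c^oo(Om) *)
Definition test_function (Om : set pt) (f : pt -> R) : Prop :=
  smooth f /\
  exists K : set pt, [/\ compact K, K `<=` Om & forall x, ~ K x -> f x = 0].

(* The indices live in Z/3Z. *)
Definition curl (phi : 'I_3 -> pt -> R) (j : 'I_3) (x : pt) : R :=
  partial (j + 1) (phi (j + 1 + 1)) x - partial (j + 1 + 1) (phi (j + 1)) x.

Definition volume : set (mR * mR * mR) -> \bar R :=
  ((@lebesgue_measure R \x @lebesgue_measure R) \x @lebesgue_measure R)%E.
HB.instance Definition _ := Measure.on volume.

(** ** Two-dimensional Hausdorff measure *)

(* pi/4 * (diam E)^2 for sets of diameter at most [delta] *)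
Definition hausdorff_weight (delta : R) (E : set (mR * mR * mR)) : \bar R :=
  if `[< E = set0 >] then 0%E else
  let diam := ereal_sup [set (edist z.1 z.2)%:E | z in E `*` E] in
  if (diam <= delta%:E)%E then ((pi / 4)%:E * (diam * diam))%E else +oo%E.

Lemma hausdorff_weight0 delta : hausdorff_weight delta set0 = 0%E.
Proof. by rewrite /hausdorff_weight; case: asboolP. Qed.

Lemma hausdorff_weight_ge0 delta E : (0 <= hausdorff_weight delta E)%E.
Proof.
rewrite /hausdorff_weight; case: asboolP => // /eqP/set0P[x Ex].
case: ifPn => // _; apply: mule_ge0.
  by rewrite lee_fin divr_ge0// pi_ge0.
suff h : (0 <= ereal_sup [set (edist z.1 z.2)%:E | z in E `*` E])%E.
  exact: mule_ge0.
apply: (@le_trans _ _ (edist x x)%:E); first by rewrite lee_fin sqrtr_ge0.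
by apply: ereal_sup_ubound; exists (x, x).
Qed.

(* [mu_ext] takes infima over countable covers by Borel sets; closures being
   Borel and having the same diameter, arbitrary covers give the same value. *)
Definition hausdorff2 (X : set (mR * mR * mR)) : \bar R :=
  ereal_sup [set mu_ext (hausdorff_weight delta) X | delta in [set r | 0 < r]].

Lemma hausdorff2_ge0 X : (0 <= hausdorff2 X)%E.
Proof.
apply: (@le_trans _ _ (mu_ext (hausdorff_weight 1) X)).
  by apply: mu_ext_ge0 => ?; exact: hausdorff_weight_ge0.
by apply: ereal_sup_ubound; exists 1 => //=.
Qed.

Lemma hausdorff20 : hausdorff2 set0 = 0%E.
Proof.
apply/eqP; rewrite eq_le hausdorff2_ge0 andbT.
apply: ge_ereal_sup => _ [delta _ <-].
by rewrite mu_ext0// => *; [exact: hausdorff_weight0|exact: hausdorff_weight_ge0].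
Qed.

Lemma le_hausdorff2 : {homo hausdorff2 : A B / A `<=` B >-> (A <= B)%E}.
Proof.
move=> A B AB; apply: ge_ereal_sup => _ [delta d0 <-].
apply: (@le_trans _ _ (mu_ext (hausdorff_weight delta) B)).
  exact: le_mu_ext.
by apply: ereal_sup_ubound; exists delta.
Qed.

Lemma hausdorff2_sigma_subadditive : sigma_subadditive hausdorff2.
Proof.
move=> F; apply: ge_ereal_sup => _ [delta d0 <-].
apply: (@le_trans _ _ (\sum_(i <oo) mu_ext (hausdorff_weight delta) (F i))%E).
  apply: mu_ext_sigma_subadditive => *; exact: hausdorff_weight_ge0.
apply: lee_nneseries => [i _ _|i _].
  by apply: mu_ext_ge0 => ?; exact: hausdorff_weight_ge0.
by apply: ereal_sup_ubound; exists delta.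
Qed.

HB.instance Definition _ := isOuterMeasure.Build R _ hausdorff2
  hausdorff20 hausdorff2_ge0 le_hausdorff2 hausdorff2_sigma_subadditive.

Definition hausdorff2_outer : {outer_measure set (mR * mR * mR) -> \bar R} :=
  hausdorff2.

(* H^2 on the sigma-algebra of its Caratheodory measurable sets, which contains
   the Borel sets. *)
Definition area : {measure set (caratheodory_type hausdorff2_outer) -> \bar R} :=
  hausdorff2_outer.

(** ** Domains of class C^{1,1} *)

Definition bdry (Om : set pt) : set pt := closure Om `\` interior Om.

Definition C11_graph (psi : R * R -> R) : Prop :=
  continuous psi /\
  forall v, v = (1, 0) \/ v = (0, 1) ->
    (forall z, derivable psi z v) /\
    exists L : R, forall z w, `|'D_v psi z - 'D_v psi w| <= L * `|z - w|.

Definition C11_domain (Om : set pt) : Prop :=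
  forall p, bdry Om p ->
    exists (r : R) (O : 'M[R]_3) (psi : R * R -> R),
      [/\ 0 < r, O *m O^T = 1%:M, C11_graph psi &
        forall x, edist x p < r ->
          let z := vec3 x *m O in
          Om x <-> psi (z 0 0, z 0 1) < z 0 2%:R].

(* Near [p], the set [Om] lies between two complementary cones around the
   half-space {x | n.(x - p) < 0} of arbitrarily wide opening. *)
Definition exterior_normal (Om : set pt) (p : pt) (n : 'rV[R]_3) : Prop :=
  dot3 n n = 1 /\
  forall e : R, 0 < e -> exists2 d : R, 0 < d &
    forall x, edist x p < d ->
      (dot3 n (vec3 x - vec3 p) < - (e * edist x p) -> Om x) /\
      (e * edist x p < dot3 n (vec3 x - vec3 p) -> ~ Om x).

Definition nu (Om : set pt) (p : pt) : 'rV[R]_3 :=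
  xget 0 [set n | exterior_normal Om p n].

End Euclid.
Arguments volume R : clear implicits.

(** * Spaces on the boundary *)

Section Boundary.
Variable R : realType.
Local Notation pt := (R * R * R)%type.
Local Notation field := (pt -> 'rV[R[i]]_3).
Variable Om : set pt.

Definition L2_bdry m n : hspace (pt -> 'M[R[i]]_(m, n)) :=
  L2_space (area R) (bdry Om) m n.

Definition tangential (f : field) : Prop :=
  {ae area R, forall x, bdry Om x -> \sum_j f x 0 j * (nu Om x 0 j)%:C = 0}.

Definition L2_tan : hspace field :=
  HSpace [set f : field | hdom (L2_bdry 1 3) f /\ tangential f]
         (hip (L2_bdry 1 3)).

Definition tangential_partial (j : 'I_3) (f : pt -> R) (x : pt) : R :=
  partial j f x - (\sum_k partial k f x * nu Om x 0 k) * nu Om x 0 j.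

(* [v] is the tangential gradient (Jacobian) of the field [f] in H^1(Gamma)^3:
   closure of the classical tangential gradient, defined on the restrictions to
   Gamma of the smooth complex fields [a + i b]. *)
Definition surface_gradient (f : field) (v : pt -> 'M[R[i]]_3) : Prop :=
  [/\ hdom (L2_bdry 1 3) f, hdom (L2_bdry 3 3) v &
   exists a b : nat -> 'I_3 -> pt -> R,
   [/\ forall k i, smooth (a k i) /\ smooth (b k i),
     hnorm (L2_bdry 1 3)
       (fun x => f x - \row_i (a k i x +i* b k i x)) @[k --> \oo] --> (0 : R) &
     hnorm (L2_bdry 3 3)
       (fun x => v x - \matrix_(i, j) (tangential_partial j (a k i) x +i*
                                       tangential_partial j (b k i) x))
         @[k --> \oo] --> (0 : R)]].

(* Minus the Laplace-Beltrami operator, acting componentwise, on tangential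
   fields: the operator in [L2_tan] of the form
   (f, g) |-> (grad_Gamma f, grad_Gamma g) with domain H^1_tan(Gamma). *)
Definition laplace_beltrami (f w : field) : Prop :=
  [/\ hdom L2_tan f, hdom L2_tan w &
   exists2 v, surface_gradient f v &
     forall g u, hdom L2_tan g -> surface_gradient g u ->
       hip (L2_bdry 3 3) v u = hip L2_tan w g].

(* H^{1/2}(Gamma)^3, by the Gagliardo seminorm: the kernel is
   |x - y|^-(dim + 2 * (1/2)) with dim = 2. *)
Definition H12 (f : field) : Prop :=
  hdom (L2_bdry 1 3) f /\
  (\int[area R]_(x in bdry Om) \int[area R]_(y in bdry Om)
     (csqnorm (f x - f y) / edist x y ^+ 3)%:E < +oo)%E.

Definition U_space (ipU : field -> field -> R[i]) : hspace field :=
  HSpace [set f : field | H12 f /\ tangential f] ipU.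

(* [ipU] is the Hilbert inner product (f, g) |-> (Lam f, g)_{L^2(Gamma)} of
   H^{1/2}_tan(Gamma), where [Lam = sqrt(- Delta_Gamma)].  The formula makes sense
   for f in the domain H^1_tan of [Lam], which is dense in H^{1/2}_tan. *)
Definition is_U_inner_product (Lam : field -> field -> Prop)
    (ipU : field -> field -> R[i]) : Prop :=
  [/\ is_hilbert (U_space ipU),
      gdom Lam `<=` hdom (U_space ipU),
      hdense (U_space ipU) (gdom Lam) &
      forall f w g, Lam f w -> hdom (U_space ipU) g ->
        ipU f g = hip L2_tan w g].

End Boundary.

(** * Maxwell's equations *)

Section Maxwell.
Variable R : realType.
Local Notation mR := (measurableTypeR R).
Local Notation pt := (R * R * R)%type.
Local Notation field := (pt -> 'rV[R[i]]_3).
Variable Om : set pt.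

Definition ae_in (P : pt -> Prop) : Prop :=
  {ae volume R, forall x, Om x -> P x}.

Definition L_infty (f : pt -> R) : Prop :=
  measurable_fun (Om : set (mR * mR * mR)) (f : mR * mR * mR -> mR) /\
  exists C : R, ae_in (fun x => `|f x| <= C).

Definition W1_infty (f : pt -> R) : Prop :=
  L_infty f /\
  forall k, exists2 g, L_infty g &
    forall phi, test_function Om phi ->
      \int[volume R]_(x in Om) (f x * partial k phi x) =
      - \int[volume R]_(x in Om) (g x * phi x).

Definition symmetric_coeff (M : pt -> 'M[R]_3) : Prop :=
  ae_in (fun x => (M x)^T = M x).

Definition uniformly_posdef (M : pt -> 'M[R]_3) : Prop :=
  exists2 c : R, 0 < c &
    ae_in (fun x => forall v : 'rV[R]_3, c * dot3 v v <= (v *m M x *m v^T) 0 0).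

Definition nonneg_def (M : pt -> 'M[R]_3) : Prop :=
  ae_in (fun x => forall v : 'rV[R]_3, 0 <= (v *m M x *m v^T) 0 0).

(* The matrix acts on the complex vector, both written as rows. *)
Definition mact (M : 'M[R]_3) (v : 'rV[R[i]]_3) : 'rV[R[i]]_3 :=
  v *m (map_mx (real_complex R) M)^T.

Definition L2_dom : hspace (mR * mR * mR -> 'rV[R[i]]_3) :=
  L2_space (volume R) Om 1 3.

Definition pairing (u : 'rV[R[i]]_3) (phi : 'I_3 -> R) : R[i] :=
  \sum_j u 0 j * (phi j)%:C.

(* [u] is in H(curl, Om), with curl [c] in the sense of distributions. *)
Definition weak_curl (u c : field) : Prop :=
  [/\ hdom L2_dom u, hdom L2_dom c &
   forall phi : 'I_3 -> pt -> R, (forall j, test_function Om (phi j)) ->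
     cint (volume R) Om (fun x => pairing (u x) (fun j => curl phi j x)) =
     cint (volume R) Om (fun x => pairing (c x) (fun j => phi j x))].

(* [u] is in H(curl, Om) and nu x u = g on the boundary, by Green's formula
   int_Om (curl u . phi - u . curl phi) = int_Gamma (nu x u) . phi. *)
Definition tangential_trace (u g : field) : Prop :=
  exists2 c, weak_curl u c &
  forall phi : 'I_3 -> pt -> R, (forall j, smooth (phi j)) ->
    cint (volume R) Om (fun x => pairing (c x) (fun j => phi j x) -
                                 pairing (u x) (fun j => curl phi j x)) =
    cint (area R) (bdry Om) (fun x => pairing (g x) (fun j => phi j x)).

Variables eps mu sigma : pt -> 'M[R]_3.

Definition Y_space : hspace (field * field)%type :=
  HSpace [set y : field * field | hdom L2_dom y.1 /\ hdom L2_dom y.2]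
    (fun y z => hip L2_dom y.1 (fun x => mact (eps x) (z.1 x)) +
                hip L2_dom y.2 (fun x => mact (mu x) (z.2 x))).

(* Graphs of A and of its adjoint, on H(curl, Om) x H_0(curl, Om). *)
Definition maxwell_op (y z : field * field) : Prop :=
  hdom Y_space z /\
  exists c1 c2, [/\ weak_curl y.1 c1, weak_curl y.2 c2,
    tangential_trace y.2 0,
    ae_in (fun x => z.1 x = mact (invmx (eps x)) (c2 x) -
                            mact (invmx (eps x)) (mact (sigma x) (y.1 x))) &
    ae_in (fun x => z.2 x = - mact (invmx (mu x)) (c1 x))].

Definition maxwell_adjoint (y z : field * field) : Prop :=
  hdom Y_space z /\
  exists c1 c2, [/\ weak_curl y.1 c1, weak_curl y.2 c2,
    tangential_trace y.2 0,
    ae_in (fun x => z.1 x = - mact (invmx (eps x)) (c2 x) -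
                            mact (invmx (eps x)) (mact (sigma x) (y.1 x))) &
    ae_in (fun x => z.2 x = mact (invmx (mu x)) (c1 x))].

Definition green_problem (g : field) (y : field * field) : Prop :=
  exists c1 c2, [/\ weak_curl y.1 c1, weak_curl y.2 c2,
    ae_in (fun x => mact (eps x) (y.1 x) - c2 x + mact (sigma x) (y.1 x) = 0),
    ae_in (fun x => mact (mu x) (y.2 x) + c1 x = 0) &
    tangential_trace y.2 g].

(* The equations bound the curls by the fields, so boundedness into Y is
   boundedness into H(curl, Om)^2. *)
Definition is_green_map (U : hspace field) (Gr : field -> field * field) : Prop :=
  bounded_op U Y_space Gr /\ forall g, hdom U g -> green_problem g (Gr g).

End Maxwell.

(** * The boundary control system y' = A y + B g and the quadratic cost *)

Section Control.
Variable R : realType.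
Variables (V W : lmodType R[i]) (Y : hspace V) (U : hspace W).

(* An element of the dual of the domain of the adjoint of A is represented by its
   (antilinear) values there. *)
Local Notation dual := (V -> R[i]).

Section Dual.
Variables (As : V -> V -> Prop) (Ss : R -> V -> V) (Gr : W -> V).

Definition pivot (y : V) : dual := fun z => hip Y y z.
Definition A_ext (y : V) : dual := fun z => hip Y y (gval As z).
Definition S_ext (t : R) (F : dual) : dual := fun z => F (Ss t z).

(* B = (I - A) Gr *)
Definition B_ctl (g : W) : dual := fun z => pivot (Gr g) z - A_ext (Gr g) z.

(* int_s^t e^{(t-r)A} B g(r) dr, in the dual of the domain of the adjoint of A *)
Definition input_integral (s t : R) (g : R -> W) : dual := fun z =>
  cint (@lebesgue_measure R) `]s, t[ (fun r => S_ext (t - r) (B_ctl (g r)) z).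

End Dual.

Variables (As : V -> V -> Prop) (S Ss : R -> V -> V) (Gr : W -> V).

(* y in C([s, Tf], Y) and
   y(t) = e^{(t-s)A} y0 + int_s^t e^{(t-r)A} B g(r) dr,
   in the dual of the domain of the adjoint of A. *)
Definition is_state (s Tf : R) (y0 : V) (g : R -> W) (y : R -> V) : Prop :=
  continuous_in_time Y s Tf y /\
  forall t, s <= t <= Tf -> forall z, gdom As z ->
    pivot (y t) z =
    pivot (S (t - s) y0) z + input_integral As Ss Gr s t g z.

(* g |-> int_s^. e^{(.-r)A} B g(r) dr is bounded from L^2(s, Tf; U) to
   C([s, Tf], Y). *)
Definition well_posed (Tf : R) : Prop :=
  forall s, 0 <= s < Tf -> exists C : R, forall g, L2_in_time U s Tf g ->
    exists2 y, is_state s Tf 0 g y &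
      forall t, s <= t <= Tf -> hnorm Y (y t) <= C * L2norm_in_time U s Tf g.

Definition cost (alpha : R) (G : V -> V) (s Tf : R)
    (g : R -> W) (y : R -> V) : R :=
  alpha * sqnorm_in_time U s Tf g + hnorm Y (G (y Tf)) ^+ 2.

(* [g] is optimal from [y0] at time [s], and [y] is its state. *)
Definition is_optimal (alpha : R) (G : V -> V) (s Tf : R) (y0 : V)
    (g : R -> W) (y : R -> V) : Prop :=
  [/\ L2_in_time U s Tf g, is_state s Tf y0 g y &
   forall h w, L2_in_time U s Tf h -> is_state s Tf y0 h w ->
     cost alpha G s Tf g y <= cost alpha G s Tf h w].

(* [yhat t x] is the optimal state from [x] at time [t]; at [t = Tf] it is [x]. *)
Definition cost_operator (G Gs : V -> V) (Tf : R) (yhat : R -> V -> R -> V)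
    (t : R) (x : V) : V :=
  Ss (Tf - t) (Gs (G (if t < Tf then yhat t x Tf else x))).

End Control.

(* Main.v *)
(** Extend the optimal controls from s by zero to (0, T), and let L be the map from
    controls to final states, bounded by a constant independent of s.  The optimal
    control g_s from x and its final state y_s satisfy Euler's equation
    [alpha (g_s, h) + (G y_s, G L h) = 0] for all h supported in (s, T).  Subtracting
    the equations for G and for G_n = G J_n, with J_n = n (nI - A)^-1, gives

      [alpha |g_n - g| <= C (M |(G_n - G) y_s| + |(G_n^* - G^* ) G y_s|)].

    For fixed s the right-hand side tends to 0 because J_n and J_n^* are contractions
    converging strongly to the identity; this is uniform in s because s |-> y_s is
    continuous on the compact interval [0, T], with y_T = x.  Continuity of s |-> y_s
    again follows by comparing Euler equations, those at s < t; what remains is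
    [(L h, q)] for h supported in (s, t), which is o(|h|) as t - s -> 0: for q in the
    domain of A* the integrand is bounded by a multiple of |h(r)|, and that domain is
    dense.  All other claims are consequences of these two facts. *)

Require Import Defs.
From mathcomp Require Import all_boot all_order all_algebra.
From mathcomp Require Import complex ring lra.
From mathcomp Require Import all_classical all_reals all_analysis.
From mathcomp Require Import measurable_realfun.
Set Implicit Arguments.
Unset Strict Implicit.
Unset Printing Implicit Defensive.
Import Order.TTheory GRing.Theory Num.Theory.
Import numFieldNormedType.Exports.
Local Open Scope classical_set_scope.
Local Open Scope complex_scope.
Local Open Scope ring_scope.

(** * Spaces of representatives *)

(** The delicate point is continuity of s |-> y_s. The width on which (L h, q) is at most e |h|
    depends on q, and comparing Euler's equations at s < t produces q = G* G y_t. At a point r = t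
    this q is fixed and the estimate applies. At r = s it moves with t, and L h itself need not be
    small in norm. In that case Euler's equation at s, tested with the part k of g_t - g_s that
    lives on (s, t], gives alpha |k|^2 = Re (L k, G* G y_s): the fixed q = G* G y_r appears, so |k|
    is small, and then L k is small in norm.

    Values of operators and states are only determined up to null vectors. Operators are therefore
    linear only up to [heq], and identities between vectors are proved after pairing with an
    arbitrary vector, where they become identities between real numbers. *)

Section PreHilbert.
Variables (R : realType) (V : lmodType R[i]).
Implicit Types (X : hspace V) (x y z : V).

(** The algebraic clauses of [is_hilbert], isolated so that they can be verified directly for the
    spaces constructed below: L^2 in time, weighted L^2 fields, and [Y_space]. *)
Definition pre_hilbert X : Prop :=
  [/\ hdom X 0 /\
      (forall (a : R[i]) x y, hdom X x -> hdom X y -> hdom X (a *: x + y)),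
      (forall (a : R[i]) x y z, hdom X x -> hdom X y -> hdom X z ->
         hip X (a *: x + y) z = a * hip X x z + hip X y z),
      (forall x y, hdom X x -> hdom X y -> hip X y x = conjc (hip X x y)) &
      (forall x, hdom X x -> 0 <= hip X x x)].

(** A real inner product with the same norm. Varying a control along real multiples of h gives
    Euler's equation for the real part, so the Hilbert-space arguments use real scalars; [Im_hip]
    recovers imaginary parts by rotating through -i. *)
Definition rip X x y : R := complex.Re (hip X x y).

Lemma hdom0 X : pre_hilbert X -> hdom X 0.
Proof. by case=> -[]. Qed.

Lemma hdomD X x y : pre_hilbert X -> hdom X x -> hdom X y -> hdom X (x + y).
Proof. by case=> -[_ h] _ _ _ dx dy; rewrite -[x]scale1r; exact: h. Qed.

Lemma hdomZ X (a : R[i]) x : pre_hilbert X -> hdom X x -> hdom X (a *: x).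
Proof. by case=> -[h0 h] _ _ _ dx; rewrite -[_ *: _]addr0; exact: h. Qed.

Lemma hdomN X x : pre_hilbert X -> hdom X x -> hdom X (- x).
Proof. by rewrite -scaleN1r; exact: hdomZ. Qed.

Lemma hipDl X x y z : pre_hilbert X -> hdom X x -> hdom X y -> hdom X z ->
  hip X (x + y) z = hip X x z + hip X y z.
Proof.
by case=> _ h _ _ dx dy dz; rewrite -{1}[x]scale1r h// mul1r.
Qed.

Lemma hip0l X z : pre_hilbert X -> hdom X z -> hip X 0 z = 0.
Proof.
move=> hX dz; have := hipDl hX (hdom0 hX) (hdom0 hX) dz.
by rewrite addr0 => /eqP; rewrite addrC -subr_eq subrr => /eqP.
Qed.

Lemma hipZl X (a : R[i]) x z : pre_hilbert X -> hdom X x -> hdom X z ->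
  hip X (a *: x) z = a * hip X x z.
Proof.
move=> hX dx dz; have [_ h _ _] := hX.
by rewrite -[_ *: _]addr0 h ?hip0l ?addr0//; exact: hdom0.
Qed.

Lemma hip_conj X x y : pre_hilbert X -> hdom X x -> hdom X y ->
  hip X y x = conjc (hip X x y).
Proof. by case=> _ _ h _; exact: h. Qed.

Lemma ripC X x y : pre_hilbert X -> hdom X x -> hdom X y ->
  rip X x y = rip X y x.
Proof. by move=> hX dx dy; rewrite /rip (hip_conj hX dy dx); case: hip. Qed.

Lemma ripDl X x y z : pre_hilbert X -> hdom X x -> hdom X y -> hdom X z ->
  rip X (x + y) z = rip X x z + rip X y z.
Proof. by move=> hX dx dy dz; rewrite /rip hipDl//; do 2 case: hip => ? ?. Qed.

Lemma ripZl X (a : R) x z : pre_hilbert X -> hdom X x -> hdom X z ->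
  rip X (a%:C *: x) z = a * rip X x z.
Proof.
move=> hX dx dz; rewrite /rip hipZl//; case: hip => ? ? /=.
by rewrite mul0r subr0.
Qed.

Lemma ripNl X x z : pre_hilbert X -> hdom X x -> hdom X z ->
  rip X (- x) z = - rip X x z.
Proof.
move=> hX dx dz; have -> : - x = (-1)%:C *: x by rewrite rmorphN scaleN1r.
by rewrite ripZl// mulN1r.
Qed.

Lemma ripDr X x y z : pre_hilbert X -> hdom X x -> hdom X y -> hdom X z ->
  rip X z (x + y) = rip X z x + rip X z y.
Proof.
move=> hX dx dy dz; rewrite ripC ?ripDl//; last exact: hdomD.
by rewrite (ripC hX dx) ?(ripC hX dy).
Qed.

Lemma ripZr X (a : R) x z : pre_hilbert X -> hdom X x -> hdom X z ->
  rip X z (a%:C *: x) = a * rip X z x.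
Proof.
move=> hX dx dz; rewrite ripC ?ripZl//; last exact: hdomZ.
by rewrite (ripC hX dx).
Qed.

Lemma ripNr X x z : pre_hilbert X -> hdom X x -> hdom X z ->
  rip X z (- x) = - rip X z x.
Proof.
move=> hX dx dz; rewrite ripC ?ripNl//; last exact: hdomN.
by rewrite (ripC hX dx).
Qed.

Lemma Im_hip X x y : pre_hilbert X -> hdom X x -> hdom X y ->
  complex.Im (hip X x y) = rip X (- 'i%C *: x) y.
Proof.
by move=> hX dx dy; rewrite /rip hipZl//; case: hip => a b /=; ring.
Qed.

Lemma rip_ge0 X x : pre_hilbert X -> hdom X x -> 0 <= rip X x x.
Proof. by case=> _ _ _ h /h; rewrite lecE => /andP[]. Qed.

Lemma hnorm_ge0 X x : 0 <= hnorm X x.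
Proof. exact: sqrtr_ge0. Qed.

Lemma sqr_hnorm X x : pre_hilbert X -> hdom X x -> hnorm X x ^+ 2 = rip X x x.
Proof. by move=> hX dx; rewrite sqr_sqrtr// rip_ge0. Qed.

Lemma hnorm_real X x : hnorm X x = Num.sqrt (rip X x x).
Proof. by []. Qed.

End PreHilbert.

(** Inner-product identities hold only on [hdom], so every rewriting leaves membership goals; these
    tactics close them. *)
Ltac hilb := repeat match goal with
  | |- hdom _ (_ + _) => apply: hdomD
  | |- hdom _ (- _) => apply: hdomN
  | |- hdom _ (_ *: _) => apply: hdomZ
  | |- hdom _ 0 => apply: hdom0
  | |- hdom _ _ => assumption
  | |- pre_hilbert _ => assumption
  end.
Tactic Notation "rip" :=
  rewrite ?(ripDl, ripDr, ripNl, ripNr, ripZl, ripZr); hilb.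

Section PreHilbertNorm.
Variables (R : realType) (V : lmodType R[i]) (X : hspace V).
Hypothesis hX : pre_hilbert X.
Implicit Types (x y z : V).

(** Evaluate at the minimizer -b/c. If c = 0 the polynomial is affine and equals -1 at the chosen
    point unless b vanishes. Besides Cauchy-Schwarz, the case a = 0 turns minimality into Euler's
    equation. *)
Lemma discr_le (a b c : R) : 0 <= c ->
  (forall t : R, 0 <= a + 2 * t * b + t ^+ 2 * c) -> b ^+ 2 <= a * c.
Proof.
rewrite le_eqVlt => /predU1P[<- h|c0 h].
  have [->|b0] := eqVneq b 0; first by have := h 0; lra.
  have := h (- (a + 1) / (2 * b)).
  suff -> : a + 2 * (- (a + 1) / (2 * b)) * b +
    (- (a + 1) / (2 * b)) ^+ 2 * 0 = -1 by lra.
  by field.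
have := h (- b / c); rewrite -(pmulr_rge0 _ c0).
suff -> : c * (a + 2 * (- b / c) * b + (- b / c) ^+ 2 * c) = a * c - b ^+ 2 by lra.
by field; rewrite gt_eqF.
Qed.

Lemma rip_sqr_le x y : hdom X x -> hdom X y ->
  rip X x y ^+ 2 <= rip X x x * rip X y y.
Proof.
move=> dx dy; apply: discr_le; first exact: rip_ge0.
move=> t; have h : 0 <= rip X (x + t%:C *: y) (x + t%:C *: y) by apply: rip_ge0; hilb.
by move: h; rip; rewrite (ripC hX dy dx); lra.
Qed.

Lemma cauchy_schwarz x y : hdom X x -> hdom X y ->
  `|rip X x y| <= hnorm X x * hnorm X y.
Proof.
move=> dx dy; rewrite -(@ler_pXn2r _ 2)// ?nnegrE ?mulr_ge0 ?hnorm_ge0//.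
by rewrite exprMn !sqr_hnorm// real_normK ?num_real// rip_sqr_le.
Qed.

Lemma rip_le x y : hdom X x -> hdom X y -> rip X x y <= hnorm X x * hnorm X y.
Proof.
by move=> dx dy; apply: le_trans (cauchy_schwarz dx dy); exact: ler_norm.
Qed.

Lemma hnormZ (a : R[i]) x : hdom X x ->
  hnorm X (a *: x) = Num.sqrt (complex.Re a ^+ 2 + complex.Im a ^+ 2) * hnorm X x.
Proof.
move=> dx; rewrite -sqrtrM ?addr_ge0 ?sqr_ge0//; congr Num.sqrt.
have dax : hdom X (a *: x) by hilb.
rewrite hipZl// (hip_conj hX dax dx) hipZl//.
case: a {dax} => a b /=; case: (hip X x x) (@hip_conj _ _ X x x hX dx dx) => c d /= [h].
have -> : d = 0 by lra.
by ring.
Qed.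

Lemma hnormZr (a : R) x : hdom X x -> hnorm X (a%:C *: x) = `|a| * hnorm X x.
Proof. by move=> dx; rewrite hnormZ//= expr0n/= addr0 sqrtr_sqr. Qed.

Lemma hnormN x : hdom X x -> hnorm X (- x) = hnorm X x.
Proof.
move=> dx; have -> : - x = (-1)%:C *: x by rewrite rmorphN scaleN1r.
by rewrite hnormZr// normrN1 mul1r.
Qed.

Lemma hnorm0 : hnorm X 0 = 0.
Proof. by rewrite /hnorm hip0l ?sqrtr0//; hilb. Qed.

Lemma ler_hnormD x y : hdom X x -> hdom X y ->
  hnorm X (x + y) <= hnorm X x + hnorm X y.
Proof.
move=> dx dy; rewrite -(@ler_pXn2r _ 2)// ?nnegrE ?addr_ge0 ?hnorm_ge0//.
rewrite sqrrD !sqr_hnorm//; last by hilb.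
rip; rewrite (ripC hX dy dx).
by have := rip_le dx dy; lra.
Qed.

Lemma ler_hnormB x y : hdom X x -> hdom X y ->
  hnorm X (x - y) <= hnorm X x + hnorm X y.
Proof.
by move=> dx dy; rewrite -(hnormN dy); apply: ler_hnormD => //; hilb.
Qed.

Lemma hnormB_sym x y : hdom X x -> hdom X y -> hnorm X (x - y) = hnorm X (y - x).
Proof. by move=> dx dy; rewrite -hnormN ?opprB//; hilb. Qed.

Lemma ler_hnorm_via z x y : hdom X x -> hdom X y -> hdom X z ->
  hnorm X (x - y) <= hnorm X (x - z) + hnorm X (z - y).
Proof.
move=> dx dy dz; have -> : x - y = (x - z) + (z - y) by rewrite addrA subrK.
by apply: ler_hnormD; hilb.
Qed.

Lemma ler_dist_hnorm x y : hdom X x -> hdom X y ->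
  `|hnorm X x - hnorm X y| <= hnorm X (x - y).
Proof.
move=> dx dy; have h1 : hnorm X (y + (x - y)) <= hnorm X y + hnorm X (x - y).
  by apply: ler_hnormD; hilb.
have h2 : hnorm X (x + (y - x)) <= hnorm X x + hnorm X (y - x).
  by apply: ler_hnormD; hilb.
move: h1 h2; rewrite !subrKC (hnormB_sym dy dx) ler_norml => h1 h2.
by apply/andP; split; lra.
Qed.

Lemma rip_null x y : hdom X x -> hdom X y -> hnorm X x = 0 -> rip X x y = 0.
Proof.
move=> dx dy x0; apply/eqP; rewrite -normr_le0.
by apply: le_trans (cauchy_schwarz dx dy) _; rewrite x0 mul0r.
Qed.

Lemma hip_null x y : hdom X x -> hdom X y -> hnorm X x = 0 -> hip X x y = 0.
Proof.
move=> dx dy x0; apply/eqP; rewrite eq_complex (Im_hip hX dx dy).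
have -> : complex.Re (hip X x y) = rip X x y by [].
rewrite !rip_null ?eqxx//; first by hilb.
by rewrite hnormZ// x0 mulr0.
Qed.

Lemma heq_sym x y : hdom X x -> hdom X y -> heq X x y -> heq X y x.
Proof. by rewrite /heq => dx dy; rewrite hnormB_sym. Qed.

Lemma heq_trans z x y : hdom X x -> hdom X y -> hdom X z ->
  heq X x z -> heq X z y -> heq X x y.
Proof.
rewrite /heq => dx dy dz h1 h2; apply/eqP; rewrite eq_le hnorm_ge0 andbT.
by have := ler_hnorm_via dx dy dz; rewrite h1 h2 addr0.
Qed.

Lemma heq_hip x y z : hdom X x -> hdom X y -> hdom X z -> heq X x y ->
  hip X x z = hip X y z.
Proof.
move=> dx dy dz h; have -> : x = (x - y) + y by rewrite subrK.
by rewrite hipDl ?(hip_null _ dz h) ?add0r//; hilb.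
Qed.

Lemma heq_hipr x y z : hdom X x -> hdom X y -> hdom X z -> heq X x y ->
  hip X z x = hip X z y.
Proof.
move=> dx dy dz h; rewrite (hip_conj hX dx)// (hip_conj hX dy)//.
by rewrite (heq_hip dx dy dz h).
Qed.

Lemma heq_rip x y z : hdom X x -> hdom X y -> hdom X z -> heq X x y ->
  rip X x z = rip X y z.
Proof. by move=> dx dy dz h; rewrite /rip (heq_hip dx dy). Qed.

Lemma heq_hnorm x y : hdom X x -> hdom X y -> heq X x y -> hnorm X x = hnorm X y.
Proof.
move=> dx dy h; have := ler_dist_hnorm dx dy; rewrite h normr_le0 subr_eq0.
by move/eqP.
Qed.

(** Extensionality through pairings: it reduces vector identities modulo null vectors to [ring] and
    [lra]. *)
Lemma heqP x y : hdom X x -> hdom X y ->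
  (forall z, hdom X z -> rip X x z = rip X y z) -> heq X x y.
Proof.
move=> dx dy h; rewrite /heq hnorm_real.
rewrite ripDl ?ripNl ?h ?subrr ?sqrtr0//; hilb.
Qed.

(** For y in D one has |x|^2 = Re (x, x - y), and y can be chosen close to x. In this way identities
    tested on the domain of [As] become equalities in Y. *)
Lemma rip_dense_null (D : set V) x : D `<=` hdom X -> hdense X D ->
  hdom X x -> (forall z, D z -> rip X x z = 0) -> hnorm X x = 0.
Proof.
move=> DX dD dx h; apply/eqP; rewrite eq_le hnorm_ge0 andbT.
apply/ler_addgt0Pl => e e0; rewrite addr0.
have [y Dy xy] := dD _ dx _ e0.
have dy := DX _ Dy.
have hh : hnorm X x ^+ 2 <= hnorm X x * hnorm X (x - y).
  rewrite sqr_hnorm//; have -> : rip X x x = rip X x (x - y).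
    by rip; rewrite (h y Dy) subr0.
  by apply: rip_le; hilb.
have [->|x0] := eqVneq (hnorm X x) 0; first exact: ltW.
move: hh; rewrite expr2 ler_pM2l => [|]; last by rewrite lt_neqAle eq_sym x0 hnorm_ge0.
by move=> /le_lt_trans /(_ xy)/ltW.
Qed.

End PreHilbertNorm.

Section BoundedOp.
Variables (R : realType) (V W : lmodType R[i]) (X : hspace V) (Y : hspace W).
Hypotheses (hX : pre_hilbert X) (hY : pre_hilbert Y).
Variable F : V -> W.
Hypothesis hF : bounded_op X Y F.

Lemma bop_dom x : hdom X x -> hdom Y (F x).
Proof. by case: hF => h _ _; exact: h. Qed.

Lemma bop_lin (a : R[i]) x y : hdom X x -> hdom X y ->
  heq Y (F (a *: x + y)) (a *: F x + F y).
Proof. by case: hF => _ h _; exact: h. Qed.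

Lemma bop_bound : exists2 C : R, 0 <= C &
  forall x, hdom X x -> hnorm Y (F x) <= C * hnorm X x.
Proof.
case: hF => _ _ [C hC]; exists `|C| => // x /hC /le_trans; apply.
by rewrite ler_wpM2r ?hnorm_ge0 ?ler_norm.
Qed.

Lemma bop_null x : hdom X x -> hnorm X x = 0 -> hnorm Y (F x) = 0.
Proof.
move=> dx x0; have [C _ hC] := bop_bound; apply/eqP.
by rewrite eq_le hnorm_ge0 andbT; have := hC _ dx; rewrite x0 mulr0.
Qed.

Lemma bop_ripl (a : R) x y z : hdom X x -> hdom X y -> hdom Y z ->
  rip Y (F (a%:C *: x + y)) z = a * rip Y (F x) z + rip Y (F y) z.
Proof.
move=> dx dy dz; have dFx := bop_dom dx; have dFy := bop_dom dy.
rewrite (heq_rip hY _ _ dz (bop_lin a%:C dx dy)); [|by apply: bop_dom; hilb|by hilb].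
by rip.
Qed.

Lemma bop_hipl (a : R[i]) x y z : hdom X x -> hdom X y -> hdom Y z ->
  hip Y (F (a *: x + y)) z = a * hip Y (F x) z + hip Y (F y) z.
Proof.
move=> dx dy dz; have dFx := bop_dom dx; have dFy := bop_dom dy.
rewrite (heq_hip hY _ _ dz (bop_lin a dx dy)); [|by apply: bop_dom; hilb|by hilb].
by rewrite hipDl ?hipZl//; hilb.
Qed.

Lemma bop_sub x y : hdom X x -> hdom X y -> heq Y (F (x - y)) (F x - F y).
Proof.
move=> dx dy; have := bop_lin (-1) dy dx.
by rewrite !scaleN1r ![- _ + _]addrC.
Qed.

Lemma bop_heq x y : hdom X x -> hdom X y -> heq X x y -> heq Y (F x) (F y).
Proof.
move=> dx dy h; have dFx := bop_dom dx; have dFy := bop_dom dy.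
rewrite /heq -(heq_hnorm hY _ _ (bop_sub dx dy)); first by apply: bop_null; hilb.
  by apply: bop_dom; hilb.
by hilb.
Qed.

Lemma bop_dist (C : R) x y :
  (forall x, hdom X x -> hnorm Y (F x) <= C * hnorm X x) ->
  hdom X x -> hdom X y -> hnorm Y (F x - F y) <= C * hnorm X (x - y).
Proof.
move=> hC dx dy; have dFx := bop_dom dx; have dFy := bop_dom dy.
rewrite -(heq_hnorm hY _ _ (bop_sub dx dy)); first by apply: hC; hilb.
  by apply: bop_dom; hilb.
by hilb.
Qed.

End BoundedOp.

Lemma bop_comp (R : realType) (V V' V'' : lmodType R[i]) (X : hspace V)
    (Y : hspace V') (Z : hspace V'') (F : V -> V') (K : V' -> V'') :
  pre_hilbert X -> pre_hilbert Y -> pre_hilbert Z ->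
  bounded_op X Y F -> bounded_op Y Z K -> bounded_op X Z (fun x => K (F x)).
Proof.
move=> hX hY hZ hF hK; split.
- by move=> x dx; exact: (bop_dom hK (bop_dom hF dx)).
- move=> a x y dx dy; have dFx := bop_dom hF dx; have dFy := bop_dom hF dy.
  apply: (heq_trans hZ _ _ _
    (bop_heq hY hZ hK _ _ (bop_lin hF a dx dy)) (bop_lin hK a dFx dFy)).
  + by apply: (bop_dom hK); apply: (bop_dom hF); hilb.
  + by hilb; exact: (bop_dom hK).
  + by apply: (bop_dom hK); hilb.
  + by apply: (bop_dom hF); hilb.
  + by hilb.
- have [C C0 hC] := bop_bound hF; have [C' C'0 hC'] := bop_bound hK.
  exists (C' * C) => x dx; apply: le_trans (hC' _ (bop_dom hF dx)) _.
  by rewrite -mulrA ler_wpM2l// hC.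
Qed.

(** * Complex-valued integrals *)

Section ComplexIntegral.
Variables (d : measure_display) (M : measurableType d) (R : realType).
Variables (mu : {measure set M -> \bar R}) (D : set M).
Hypothesis mD : measurable D.

Definition cintegrable (f : M -> R[i]) : Prop :=
  mu.-integrable D (EFin \o (fun x => complex.Re (f x))) /\
  mu.-integrable D (EFin \o (fun x => complex.Im (f x))).

Lemma integrable_lincomb (a b : R) (f g : M -> R) :
  mu.-integrable D (EFin \o f) -> mu.-integrable D (EFin \o g) ->
  mu.-integrable D (EFin \o (fun x => a * f x + b * g x)).
Proof.
move=> hf hg.
have -> : EFin \o (fun x => a * f x + b * g x) =
  ((fun x => a%:E * (EFin \o f) x) \+ (fun x => b%:E * (EFin \o g) x))%E by [].
by apply: integrableD => //; exact: integrableZl.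
Qed.

Lemma Rintegral_lincomb (a b : R) (f g : M -> R) :
  mu.-integrable D (EFin \o f) -> mu.-integrable D (EFin \o g) ->
  \int[mu]_(x in D) (a * f x + b * g x) =
  a * \int[mu]_(x in D) f x + b * \int[mu]_(x in D) g x.
Proof.
move=> hf hg; have z f' : mu.-integrable D (EFin \o f') -> forall c : R,
    mu.-integrable D (EFin \o (fun x => c * f' x)).
  move=> hf' c; have -> : EFin \o (fun x => c * f' x) =
    (fun x => c%:E * (EFin \o f') x)%E by [].
  exact: integrableZl.
rewrite RintegralD//; [|exact: z|exact: z].
by rewrite !RintegralZl.
Qed.

Lemma dominated_integrable (f g : M -> R) : measurable_fun D f ->
  (forall x, D x -> `|f x| <= g x) -> mu.-integrable D (EFin \o g) ->
  mu.-integrable D (EFin \o f).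
Proof.
move=> mf fg; apply: le_integrable => //; first exact/measurable_EFinP.
by move=> x Dx /=; rewrite lee_fin (le_trans (fg x Dx))// ler_norm.
Qed.

Lemma ae_eq_Rintegral (f g : M -> R) :
  mu.-integrable D (EFin \o f) -> mu.-integrable D (EFin \o g) ->
  {ae mu, forall x, D x -> f x = g x} ->
  \int[mu]_(x in D) f x = \int[mu]_(x in D) g x.
Proof.
move=> hf hg h; congr fine; apply: ae_eq_integral => //.
- exact: measurable_int hf.
- exact: measurable_int hg.
- by apply: filterS h => x h Dx; rewrite h.
Qed.

Lemma ae_eq_cint (f g : M -> R[i]) : cintegrable f -> cintegrable g ->
  {ae mu, forall x, D x -> f x = g x} -> cint mu D f = cint mu D g.
Proof.
move=> [f1 f2] [g1 g2] h; rewrite /cint; congr (_ +i* _);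
  by apply: ae_eq_Rintegral => //; apply: filterS h => x h Dx; rewrite h.
Qed.

Lemma cintegrable_lin (a : R[i]) (f g : M -> R[i]) :
  cintegrable f -> cintegrable g -> cintegrable (fun x => a * f x + g x).
Proof.
case: a => a b [f1 f2] [g1 g2]; split.
- have -> : (fun x => complex.Re ((a +i* b) * f x + g x)) =
    (fun x => 1 * (a * complex.Re (f x) + (- b) * complex.Im (f x)) +
       1 * complex.Re (g x)).
    by apply/funext => x; case: (f x) => ? ?; case: (g x) => ? ? /=; ring.
  by apply: integrable_lincomb => //; exact: integrable_lincomb.
- have -> : (fun x => complex.Im ((a +i* b) * f x + g x)) =
    (fun x => 1 * (a * complex.Im (f x) + b * complex.Re (f x)) +
       1 * complex.Im (g x)).
    by apply/funext => x; case: (f x) => ? ?; case: (g x) => ? ? /=; ring.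
  by apply: integrable_lincomb => //; exact: integrable_lincomb.
Qed.

Lemma cint_lin (a : R[i]) (f g : M -> R[i]) : cintegrable f -> cintegrable g ->
  cint mu D (fun x => a * f x + g x) = a * cint mu D f + cint mu D g.
Proof.
case: a => a b [f1 f2] [g1 g2]; rewrite /cint.
have -> : (fun x => complex.Re ((a +i* b) * f x + g x)) =
    (fun x => 1 * (a * complex.Re (f x) + (- b) * complex.Im (f x)) +
       1 * complex.Re (g x)).
  by apply/funext => x; case: (f x) => ? ?; case: (g x) => ? ? /=; ring.
have -> : (fun x => complex.Im ((a +i* b) * f x + g x)) =
    (fun x => 1 * (a * complex.Im (f x) + b * complex.Re (f x)) +
       1 * complex.Im (g x)).
  by apply/funext => x; case: (f x) => ? ?; case: (g x) => ? ? /=; ring.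
rewrite 2?Rintegral_lincomb//; try exact: integrable_lincomb.
rewrite 2?Rintegral_lincomb//.
set x1 := Rintegral _ _ _; set x2 := Rintegral _ _ _.
set x3 := Rintegral _ _ _; set x4 := Rintegral _ _ _.
by apply/eqP; rewrite eq_complex /=; apply/andP; split; apply/eqP; ring.
Qed.

Lemma cint_conj (f : M -> R[i]) : cintegrable f ->
  cint mu D (fun x => conjc (f x)) = conjc (cint mu D f).
Proof.
case=> f1 f2; rewrite /cint /=; congr (_ +i* _).
  by congr Rintegral; apply/funext => x; case: (f x).
have -> : (fun x => complex.Im (conjc (f x))) = (fun x => (-1) * complex.Im (f x)).
  by apply/funext => x; case: (f x) => a b /=; rewrite mulN1r.
by rewrite RintegralZl// mulN1r.
Qed.

(** The pointwise laws are required only almost everywhere, because the coefficient matrices are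
    symmetric and positive only outside a null set. *)
Lemma cint_pre_hilbert (V : lmodType R[i]) (A : set V) (q : V -> V -> M -> R[i]) :
  A 0 -> (forall (a : R[i]) f g, A f -> A g -> A (a *: f + g)) ->
  (forall f g, A f -> A g -> cintegrable (q f g)) ->
  (forall (a : R[i]) f g h, A f -> A g -> A h -> {ae mu, forall x, D x ->
     q (a *: f + g) h x = a * q f h x + q g h x}) ->
  (forall f g, A f -> A g -> {ae mu, forall x, D x -> q g f x = conjc (q f g x)}) ->
  (forall f, A f -> {ae mu, forall x, D x -> 0 <= q f f x}) ->
  pre_hilbert (HSpace A (fun f g => cint mu D (q f g))).
Proof.
move=> A0 Al hi hl hc hp.
have cc f : cintegrable f -> cintegrable (fun x => conjc (f x)).
  case=> f1 f2; split.
    by congr (mu.-integrable D (EFin \o _)) : f1; apply/funext => x; case: (f x).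
  have -> : (fun x => complex.Im (conjc (f x))) =
      (fun x => (-1) * complex.Im (f x) + 0 * complex.Im (f x)).
    by apply/funext => x; case: (f x) => a b /=; ring.
  exact: integrable_lincomb.
split => //.
- move=> a f g h Af Ag Ah; rewrite /hip -cint_lin; [|exact: hi|exact: hi].
  apply: ae_eq_cint (hl a f g h Af Ag Ah); first by apply: hi => //; exact: Al.
  by apply: cintegrable_lin; exact: hi.
- move=> f g Af Ag; rewrite /hip -cint_conj; last exact: hi.
  apply: ae_eq_cint (hc f g Af Ag); first exact: hi.
  by apply: cc; exact: hi.
- move=> f Af; rewrite /hip lecE /=; have [h1 h2] := hi _ _ Af Af.
  have m0 : mu.-integrable D (EFin \o (fun _ => 0 : R)).
    exact: integrable0.
  apply/andP; split.
    apply/eqP; transitivity (\int[mu]_(x in D) (0 : R)).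
      apply: ae_eq_Rintegral => //; apply: filterS (hp _ Af) => x h Dx.
      by have := h Dx; rewrite lecE => /andP[/eqP].
    by rewrite Rintegral_cst// mul0r.
  (* The integrand is nonnegative only almost everywhere, so it is first replaced by its absolute
     value. *)
  rewrite (@ae_eq_Rintegral _ (fun x => `|complex.Re (q f f x)|))//.
  + by apply: Rintegral_ge0 => x _.
  + by have := integrable_norm h1.
  + apply: filterS (hp _ Af) => x h Dx.
    by have := h Dx; rewrite lecE => /andP[_ /ger0_norm].
Qed.

End ComplexIntegral.

(** * Functions of time *)

Section TimeFunctions.
Variables (R : realType) (V : lmodType R[i]) (X : hspace V).
Hypothesis hX : pre_hilbert X.
Implicit Types (D B : set R) (f g : R -> V).

(** Off B the value is 0 whatever f is there. The same formula thus serves as extension by zero and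
    as the projection onto functions supported in B. *)
Definition cut B f : R -> V := fun t => (\1_B t : R)%:C *: f t.

Lemma cut_in B f t : B t -> cut B f t = f t.
Proof. by move=> Bt; rewrite /cut indicE mem_set// scale1r. Qed.

Lemma cut_out B f t : ~ B t -> cut B f t = 0.
Proof. by move=> Bt; rewrite /cut indicE memNset// scale0r. Qed.

Lemma hdom_sum (I : Type) (r : seq I) (F : I -> V) :
  (forall i, hdom X (F i)) -> hdom X (\sum_(i <- r) F i).
Proof.
by move=> h; elim/big_ind: _ => [|x y dx dy|//]; [exact: hdom0|exact: hdomD].
Qed.

Lemma simple_in_time_lin D (a : R[i]) f g :
  simple_in_time X D f -> simple_in_time X D g ->
  simple_in_time X D (fun t => a *: f t + g t).
Proof.
move=> [m [E [u [mE du fE]]]] [n [E' [u' [mE' du' gE]]]].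
exists (m + n)%N,
  (fun i : 'I_(m + n) => match fintype.split i with inl j => E j | inr j => E' j end),
  (fun i : 'I_(m + n) => match fintype.split i with inl j => a *: u j | inr j => u' j end).
split.
- by move=> i; case: fintype.split.
- by move=> i; case: fintype.split => j; hilb; [exact: du|exact: du'].
- move=> t Dt; rewrite fE// gE// big_split_ord/= scaler_sumr; congr (_ + _).
    apply: eq_bigr => i _.
    by rewrite (unsplitK (inl _ i)) !scalerA mulrC.
  by apply: eq_bigr => i _; rewrite (unsplitK (inr _ i)).
Qed.

Lemma simple_in_time_dom D f t : simple_in_time X D f -> D t -> hdom X (f t).
Proof.
move=> [m [E [u [mE du fE]]]] Dt; rewrite fE//.
by apply: hdom_sum => i; hilb; exact: du.
Qed.

Lemma strongly_measurable_lin D (a : R[i]) f g :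
  strongly_measurable X D f -> strongly_measurable X D g ->
  strongly_measurable X D (fun t => a *: f t + g t).
Proof.
move=> [df [F [sF cF]]] [dg [G [sG cG]]]; split.
  by move=> t Dt; hilb; [exact: df|exact: dg].
exists (fun k t => a *: F k t + G k t); split.
  by move=> k; exact: simple_in_time_lin.
move=> t Dt; have dF k := simple_in_time_dom (sF k) Dt.
have dG k := simple_in_time_dom (sG k) Dt.
have dft := df _ Dt; have dgt := dg _ Dt.
set na : R := Num.sqrt (complex.Re a ^+ 2 + complex.Im a ^+ 2).
have h : (fun k => na * hnorm X (F k t - f t) + hnorm X (G k t - g t)) @ \oo -->
    (0 : R).
  have -> : (0 : R) = na * 0 + 0 by rewrite mulr0 addr0.
  by apply: cvgD; [apply: cvgMr; exact: cF|exact: cG].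
apply: (squeeze_cvgr _ (cvg_cst 0) h); apply: nearW => k.
rewrite hnorm_ge0/=.
have -> : a *: F k t + G k t - (a *: f t + g t) =
    a *: (F k t - f t) + (G k t - g t).
  by rewrite scalerBr opprD addrACA.
rewrite -(hnormZ hX); last by hilb.
by apply: ler_hnormD; hilb.
Qed.

Lemma strongly_measurable_cut D B f : measurable (B : set (measurableTypeR R)) ->
  strongly_measurable X (D `&` B) f -> strongly_measurable X D (cut B f).
Proof.
move=> mB [df [F [sF cF]]]; split.
  move=> t Dt; have [Bt|Bt] := pselect (B t); last by rewrite cut_out//; hilb.
  by rewrite cut_in//; exact: df.
exists (fun k => cut B (F k)); split.
  move=> k; have [m [E [u [mE du fE]]]] := sF k.
  exists m, (fun i => B `&` E i), u; split => //.
    by move=> i; exact: measurableI.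
  move=> t Dt; have [Bt|Bt] := pselect (B t).
    rewrite cut_in// fE//; apply: eq_bigr => i _.
    by rewrite indicI/= [\1_B t]indicE mem_set// mul1r.
  rewrite cut_out// big1// => i _.
  by rewrite indicI/= [\1_B t]indicE memNset// mul0r scale0r.
move=> t Dt; have [Bt|Bt] := pselect (B t).
  have -> : (fun k => hnorm X (cut B (F k) t - cut B f t)) =
      (fun k => hnorm X (F k t - f t)).
    by apply/funext => k; rewrite !cut_in.
  exact: cF.
have -> : (fun k => hnorm X (cut B (F k) t - cut B f t)) = (fun=> 0).
  by apply/funext => k; rewrite !cut_out// subrr hnorm0.
exact: cvg_cst.
Qed.

Lemma strongly_measurableS D B f : B `<=` D ->
  strongly_measurable X D f -> strongly_measurable X B f.
Proof.
move=> BD [df [F [sF cF]]]; split; first by move=> t /BD; exact: df.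
exists F; split; last by move=> t /BD; exact: cF.
move=> k; have [m [E [u [mE du fE]]]] := sF k.
by exists m, E, u; split => // t /BD; exact: fE.
Qed.

(** For simple f the expression is a finite sum of indicators times functions [phi u]; the bound at
    each fixed t lets the pointwise limit pass. The dependence of [phi] on time accommodates kernels
    such as Re (S (t - r) (Gr u), x). *)
Lemma strongly_measurable_form D (phi : V -> R -> R) f :
  (forall u, hdom X u -> measurable_fun (D : set (measurableTypeR R)) (phi u)) ->
  (forall t, D t -> forall (a : R) u v, hdom X u -> hdom X v ->
    phi (a%:C *: u + v) t = a * phi u t + phi v t) ->
  (forall t, D t -> exists C : R, forall u, hdom X u ->
    `|phi u t| <= C * hnorm X u) ->
  strongly_measurable X D f ->
  measurable_fun (D : set (measurableTypeR R)) (fun t => phi (f t) t).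
Proof.
move=> mphi lphi bphi [df [F [sF cF]]].
have phi0 t : D t -> phi 0 t = 0.
  move=> Dt; have [C hC] := bphi _ Dt; apply/eqP; rewrite -normr_le0.
  by have := hC _ (hdom0 hX); rewrite hnorm0// mulr0.
have phis (m : nat) t (c : 'I_m -> R) (u : 'I_m -> V) : D t ->
    (forall i, hdom X (u i)) ->
    phi (\sum_(i < m) (c i)%:C *: u i) t = \sum_(i < m) c i * phi (u i) t.
  move=> Dt; elim: m c u => [|m IH] c u du; first by rewrite !big_ord0 phi0.
  rewrite !big_ord_recl/= lphi//; last first.
    by apply: hdom_sum => i; hilb; exact: du.
  by congr (_ + _); exact: IH.
apply: (@measurable_fun_cvg _ _ _ _ (fun k t => phi (F k t) t)).
  move=> k; have [m [E [u [mE du fE]]]] := sF k.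
  apply: (@eq_measurable_fun _ _ _ _ _
      (fun t => \sum_(i < m) (\1_(E i) t : R) * phi (u i) t)).
    by move=> t /set_mem Dt; rewrite fE// phis.
  apply: measurable_sum => i; apply: measurable_funM; last exact: mphi.
  exact: measurable_indic.
move=> t Dt; have [C hC] := bphi _ Dt.
have dF k := simple_in_time_dom (sF k) Dt.
have dft := df _ Dt.
have h : (fun k => C * hnorm X (F k t - f t)) @ \oo --> (0 : R).
  by rewrite -(mulr0 C); apply: cvgMr; exact: cF.
apply/cvgrPdist_le => e e0; have /cvgr0Pnorm_le/(_ _ e0) := h.
apply: filterS => k; apply: le_trans.
have <- : phi (f t - F k t) t = phi (f t) t - phi (F k t) t.
  rewrite addrC -scaleN1r; have -> : -1 = (-1 : R)%:C by rewrite rmorphN.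
  by rewrite lphi//; ring.
apply: le_trans (ler_norm _); rewrite (hnormB_sym hX)//.
by apply: hC; hilb.
Qed.

Lemma continuous_in_time_measurable (a b : R) (phi : R -> R) :
  (forall t, a < t < b -> forall e : R, 0 < e -> exists2 d : R, 0 < d &
    forall q, a < q < b -> `|q - t| < d -> `|phi q - phi t| < e) ->
  measurable_fun (`]a, b[ : set (measurableTypeR R)) phi.
Proof.
move=> h; apply: open_continuous_measurable_fun; first exact: interval_open.
move=> t /set_mem/=; rewrite in_itv/= => tab.
apply/cvgrPdist_lt => e e0; have [d d0 hd] := h t tab e e0.
near=> q; rewrite distrC; apply: hd.
  suff : q \in `]a, b[ by rewrite in_itv.
  by near: q; apply: near_in_itvoo; rewrite in_itv.
by near: q; exists d => //= q /=; rewrite distrC.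
Unshelve. all: by end_near. Qed.

Lemma measurable_hip D f g :
  strongly_measurable X D f -> strongly_measurable X D g ->
  measurable_fun (D : set (measurableTypeR R)) (fun t => rip X (f t) (g t)).
Proof.
move=> mf mg; apply: (@strongly_measurable_form D (fun u t => rip X u (g t)) f) => //.
- move=> u du; apply: (@eq_measurable_fun _ _ _ _ _ (fun t => rip X (g t) u)).
    by move=> t /set_mem Dt; rewrite ripC//; exact: mg.1.
  apply: (@strongly_measurable_form D (fun v _ => rip X v u) g) => //.
  + by move=> t Dt a v w dv dw; rip.
  + move=> t Dt; exists (hnorm X u) => v dv; rewrite mulrC.
    exact: cauchy_schwarz.
- by move=> t Dt a v w dv dw; have dg := mg.1 t Dt; rip.
- move=> t Dt; exists (hnorm X (g t)) => v dv; rewrite mulrC.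
  by apply: cauchy_schwarz => //; exact: mg.1.
Qed.

Lemma measurable_sqr_hnorm D f : strongly_measurable X D f ->
  measurable_fun (D : set (measurableTypeR R)) (fun t => hnorm X (f t) ^+ 2).
Proof.
move=> mf; apply: (@eq_measurable_fun _ _ _ _ _ (fun t => rip X (f t) (f t))).
  by move=> t /set_mem Dt; rewrite sqr_hnorm//; exact: mf.1.
exact: measurable_hip.
Qed.

End TimeFunctions.

(** * L^2 in time as an inner-product space *)

Section TimeSpace.
Variables (R : realType) (V : lmodType R[i]) (X : hspace V).
Hypothesis hX : pre_hilbert X.
Local Notation leb := (@lebesgue_measure R).

Definition time_space (s t : R) : hspace (R -> V) :=
  HSpace (L2_in_time X s t)
    (fun f g => cint leb `]s, t[ (fun r => hip X (f r) (g r))).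

Variables s t : R.
Implicit Types (f g : R -> V) (B : set R).

Lemma measurable_oo : measurable (`]s, t[%classic : set (measurableTypeR R)).
Proof. exact: measurable_itv. Qed.

Lemma L2_in_time_dom f r : L2_in_time X s t f -> s < r < t -> hdom X (f r).
Proof. by case=> -[h _] _ rst; apply: h; rewrite /= in_itv. Qed.

Lemma L2_integrable f : L2_in_time X s t f ->
  leb.-integrable `]s, t[ (EFin \o (fun r => hnorm X (f r) ^+ 2)).
Proof.
case=> mf fi; apply/integrableP; split.
  by apply/measurable_EFinP; exact: measurable_sqr_hnorm.
apply: le_lt_trans fi; rewrite le_eqVlt; apply/orP; left; apply/eqP.
by apply: eq_integral => r _ /=; rewrite ger0_norm// sqr_ge0.
Qed.

Lemma integrable_L2 f (g : R -> R) : strongly_measurable X `]s, t[ f ->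
  (forall r, s < r < t -> hnorm X (f r) ^+ 2 <= g r) ->
  leb.-integrable `]s, t[ (EFin \o g) -> L2_in_time X s t f.
Proof.
move=> mf fg ig; split => //.
have : leb.-integrable `]s, t[ (EFin \o (fun r => hnorm X (f r) ^+ 2)).
  apply: dominated_integrable ig; first exact: measurable_oo.
    exact: measurable_sqr_hnorm.
  by move=> r /=; rewrite in_itv/= => rst; rewrite ger0_norm ?sqr_ge0// fg.
case/integrableP => _; apply: le_lt_trans; rewrite le_eqVlt; apply/orP; left.
by apply/eqP; apply: eq_integral => r _ /=; rewrite ger0_norm// sqr_ge0.
Qed.

Lemma L2_rip_integrable f g : L2_in_time X s t f -> L2_in_time X s t g ->
  leb.-integrable `]s, t[ (EFin \o (fun r => rip X (f r) (g r))).
Proof.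
move=> hf hg.
apply: (@dominated_integrable _ _ _ _ _ measurable_oo _
    (fun r => 1 * hnorm X (f r) ^+ 2 + 1 * hnorm X (g r) ^+ 2)).
- by apply: measurable_hip => //; [case: hf|case: hg].
- move=> r /=; rewrite in_itv/= => rst.
  apply: le_trans (cauchy_schwarz hX (L2_in_time_dom hf rst) (L2_in_time_dom hg rst)) _.
  have := hnorm_ge0 X (f r); have := hnorm_ge0 X (g r).
  set x := hnorm _ _; set y := hnorm _ _ => x0 y0.
  have := sqr_ge0 (y - x); have := mulr_ge0 x0 y0; rewrite !mul1r sqrrB; lra.
- by apply: integrable_lincomb; [exact: measurable_oo|exact: L2_integrable|exact: L2_integrable].
Qed.

Lemma L2_lin (a : R[i]) f g : L2_in_time X s t f -> L2_in_time X s t g ->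
  L2_in_time X s t (a *: f + g).
Proof.
move=> hf hg; set na : R := Num.sqrt (complex.Re a ^+ 2 + complex.Im a ^+ 2).
apply: (@integrable_L2 _ (fun r => (2 * na ^+ 2) * hnorm X (f r) ^+ 2 +
    2 * hnorm X (g r) ^+ 2)).
- by apply: strongly_measurable_lin => //; [case: hf|case: hg].
- move=> r rst; have df := L2_in_time_dom hf rst; have dg := L2_in_time_dom hg rst.
  have h : hnorm X (a *: f r + g r) <= na * hnorm X (f r) + hnorm X (g r).
    by rewrite -(hnormZ hX)//; apply: ler_hnormD; hilb.
  have -> : (a *: f + g) r = a *: f r + g r by [].
  apply: (@le_trans _ _ ((na * hnorm X (f r) + hnorm X (g r)) ^+ 2)).
    rewrite ler_pXn2r// nnegrE ?hnorm_ge0//.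
    by rewrite addr_ge0 ?mulr_ge0 ?hnorm_ge0 ?sqrtr_ge0.
  have := sqr_ge0 (na * hnorm X (f r) - hnorm X (g r)).
  by rewrite -mulrA -exprMn sqrrB sqrrD; lra.
- by apply: integrable_lincomb; [exact: measurable_oo|exact: L2_integrable|exact: L2_integrable].
Qed.

Lemma L2_0 : L2_in_time X s t 0.
Proof.
apply: (@integrable_L2 _ (fun=> 0)).
- split; first by move=> r _; exact: hdom0.
  exists (fun _ => 0); split.
    move=> _; exists 0%N, (fun=> set0), (fun=> 0); split => [i|i|r _]; rewrite ?big_ord0//.
    exact: hdom0.
  move=> r _; have -> : (fun=> hnorm X ((0 : R -> V) r - (0 : R -> V) r)) = (fun=> 0) :> (nat -> R).
    by apply/funext => k; rewrite subrr hnorm0.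
  exact: cvg_cst.
- by move=> r _; rewrite hnorm0// expr0n.
- exact: integrable0.
Qed.

Lemma L2_hip_integrable f g : L2_in_time X s t f -> L2_in_time X s t g ->
  cintegrable leb `]s, t[ (fun r => hip X (f r) (g r)).
Proof.
move=> hf hg; split; first exact: L2_rip_integrable.
have hf' : L2_in_time X s t (- 'i%C *: f).
  by rewrite -[_ *: f]addr0; apply: L2_lin => //; exact: L2_0.
apply: (@eq_integrable _ _ _ _ _ measurable_oo
   (EFin \o (fun r => rip X ((- 'i%C *: f) r) (g r)))).
  move=> r /set_mem/=; rewrite in_itv/= => rst; congr EFin.
  by rewrite (Im_hip hX (L2_in_time_dom hf rst) (L2_in_time_dom hg rst)).
exact: L2_rip_integrable.
Qed.

Lemma time_space_pre_hilbert : pre_hilbert (time_space s t).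
Proof.
apply: cint_pre_hilbert => /=.
- exact: measurable_oo.
- exact: L2_0.
- exact: L2_lin.
- exact: L2_hip_integrable.
- move=> a f g h hf hg hh; apply: aeW => r /=; rewrite in_itv/= => rst.
  have df := L2_in_time_dom hf rst; have dg := L2_in_time_dom hg rst.
  have dh := L2_in_time_dom hh rst.
  have e : hip X ((a *: f + g) r) (h r) = hip X (a *: f r + g r) (h r) by [].
  by rewrite e hipDl ?hipZl//; hilb.
- move=> f g hf hg; apply: aeW => r /=; rewrite in_itv/= => rst.
  exact: (hip_conj hX (L2_in_time_dom hf rst) (L2_in_time_dom hg rst)).
- move=> f hf; apply: aeW => r /=; rewrite in_itv/= => rst.
  by case: hX => _ _ _; apply; exact: L2_in_time_dom rst.
Qed.

Lemma sqnorm_rip f : L2_in_time X s t f ->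
  sqnorm_in_time X s t f = rip (time_space s t) f f.
Proof.
move=> hf; apply: eq_Rintegral => r /set_mem/=; rewrite in_itv/= => rst.
by rewrite sqr_hnorm//; exact: L2_in_time_dom rst.
Qed.

Lemma L2norm_hnorm f : L2_in_time X s t f ->
  L2norm_in_time X s t f = hnorm (time_space s t) f.
Proof. by move=> hf; rewrite /L2norm_in_time sqnorm_rip. Qed.

Lemma L2_cut B f : measurable (B : set (measurableTypeR R)) ->
  L2_in_time X s t f -> L2_in_time X s t (cut B f).
Proof.
move=> mB hf; apply: (@integrable_L2 _ (fun r => hnorm X (f r) ^+ 2)).
- apply: strongly_measurable_cut => //.
  apply: strongly_measurableS (hf.1); exact: subIsetl.
- move=> r rst; have [Br|Br] := pselect (B r); first by rewrite cut_in.
  by rewrite cut_out// hnorm0// expr0n/= sqr_ge0.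
- exact: L2_integrable.
Qed.

Lemma rip_cut B f g : measurable (B : set (measurableTypeR R)) ->
  L2_in_time X s t f -> L2_in_time X s t g ->
  rip (time_space s t) (cut B f) g = rip (time_space s t) f (cut B g).
Proof.
move=> mB hf hg; apply: eq_Rintegral => r /set_mem/=; rewrite in_itv/= => rst.
have df := L2_in_time_dom hf rst; have dg := L2_in_time_dom hg rst.
have [Br|Br] := pselect (B r); first by rewrite !cut_in.
by rewrite !cut_out// hip0l// (hip_conj hX (hdom0 hX) df) hip0l.
Qed.

End TimeSpace.

(** * Restriction to a subinterval and extension by zero *)

Section ZeroExtension.
Variables (R : realType) (V : lmodType R[i]) (X : hspace V).
Hypothesis hX : pre_hilbert X.
Local Notation leb := (@lebesgue_measure R).
Variables (s t a b : R).
Hypotheses (sa : a <= s) (tb : t <= b).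
Implicit Types (f g : R -> V).

Let sub : `]s, t[%classic `<=` (`]a, b[%classic : set R).
Proof.
move=> r /=; rewrite !in_itv/= => /andP[sr rt].
by rewrite (le_lt_trans sa)//= (lt_le_trans rt).
Qed.

Let subI : (`]a, b[%classic : set R) `&` `]s, t[%classic = `]s, t[%classic.
Proof. exact: setIidr. Qed.

Lemma L2_restrict f : L2_in_time X a b f -> L2_in_time X s t f.
Proof.
move=> hf; apply: (@integrable_L2 _ _ _ hX _ _ _ (fun r => hnorm X (f r) ^+ 2)) => //.
  exact: strongly_measurableS hf.1.
exact: (integrableS (measurable_oo a b) (measurable_oo s t) sub (L2_integrable hX hf)).
Qed.

Lemma L2_extend f : L2_in_time X s t f -> L2_in_time X a b (cut `]s, t[ f).
Proof.
move=> hf.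
apply: (@integrable_L2 _ _ _ hX _ _ _ ((fun r => hnorm X (f r) ^+ 2) \_ `]s, t[)).
- by apply: strongly_measurable_cut => //; rewrite subI; exact: hf.1.
- move=> r _; rewrite patchE; case: ifPn => [/set_mem|/negP] rst.
    by rewrite cut_in.
  by rewrite cut_out ?hnorm0 ?expr0n//= => h; apply: rst; exact: mem_set.
- have -> : EFin \o ((fun r => hnorm X (f r) ^+ 2) \_ `]s, t[) =
      (EFin \o (fun r => hnorm X (f r) ^+ 2)) \_ `]s, t[.
    by apply/funext => r; rewrite restrict_EFin.
  apply: (iffLR (integrable_restrict leb (measurable_oo s t) (measurable_oo a b) _)).
  by rewrite subI; exact: L2_integrable.
Qed.

Lemma sqnorm_extend f :
  sqnorm_in_time X s t f = sqnorm_in_time X a b (cut `]s, t[ f).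
Proof.
rewrite /sqnorm_in_time -[in LHS]subI Rintegral_mkcondr; apply: eq_Rintegral => r _.
rewrite patchE; case: ifPn => [/set_mem|/negP] rst; first by rewrite cut_in.
have nr : ~ (`]s, t[%classic : set R) r by move=> h; apply: rst; exact: mem_set.
by rewrite (cut_out _ nr) hnorm0// expr0n.
Qed.

Lemma L2norm_extend f : L2norm_in_time X s t f = L2norm_in_time X a b (cut `]s, t[ f).
Proof. by rewrite /L2norm_in_time sqnorm_extend. Qed.

End ZeroExtension.

(** * Contraction semigroups and their adjoints *)

Section Semigroup.
Variables (R : realType) (V : lmodType R[i]) (Y : hspace V).
Hypothesis hY : pre_hilbert Y.
Local Notation dom := (hdom Y).
Local Notation norm := (hnorm Y).

Definition uniformly_continuous_orbits (F : R -> V -> V) : Prop :=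
  forall x, dom x -> forall e : R, 0 < e -> exists2 d : R, 0 < d &
    forall t q, 0 <= t -> 0 <= q -> `|q - t| < d -> norm (F q x - F t x) < e.

(** For t < q, F q x - F t x = F t (F (q - t) x - x) up to null vectors, and F t does not increase
    norms, so the modulus of continuity at time 0 serves for all times. The hypotheses are those
    common to the semigroup and its adjoint. *)
Lemma contraction_semigroup_orbits (F : R -> V -> V) :
  (forall t x, 0 <= t -> dom x -> dom (F t x)) ->
  (forall t x y, 0 <= t -> dom x -> dom y ->
    norm (F t x - F t y) <= norm (x - y)) ->
  (forall t r x, 0 <= t -> 0 <= r -> dom x -> heq Y (F (t + r) x) (F t (F r x))) ->
  (forall x, dom x -> forall e : R, 0 < e -> exists2 d : R, 0 < d &
    forall h, 0 < h -> h < d -> norm (F h x - x) < e) ->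
  uniformly_continuous_orbits F.
Proof.
move=> Fd Fc Fs F0 x dx e e0; have [d d0 hd] := F0 x dx e e0; exists d => // t q.
wlog tq : t q / t <= q => [hw t0 q0 h|t0 q0].
  have [/hw|/ltW/hw] := leP t q; first exact.
  by rewrite (hnormB_sym hY) 1?distrC; [apply|exact: Fd|exact: Fd].
move: tq; rewrite le_eqVlt => /predU1P[<- _|tq h].
  by rewrite subrr hnorm0.
have qt : 0 < q - t by rewrite subr_gt0.
have e1 : heq Y (F q x) (F t (F (q - t) x)).
  by rewrite -{1}(subrK t q) addrC; apply: Fs => //; exact: ltW.
have d1 : dom (F (q - t) x) by apply: Fd => //; exact: ltW.
have d2 := Fd _ _ t0 d1; have d3 := Fd _ _ q0 dx; have d4 := Fd _ _ t0 dx.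
apply: (le_lt_trans (ler_hnorm_via hY d3 d4 d2)); rewrite e1 add0r.
apply: (le_lt_trans (Fc _ _ _ t0 d1 dx)).
by apply: hd => //; rewrite -(gtr0_norm qt).
Qed.

Variables (A As : V -> V -> Prop) (S Ss : R -> V -> V).
Hypothesis hS : generates_contraction_semigroup Y A S.
Hypothesis hAs : is_adjoint_graph Y A As.
Hypothesis hSs : forall t, 0 <= t -> is_adjoint Y (S t) (Ss t).

Lemma S_dom t x : 0 <= t -> dom x -> dom (S t x).
Proof. by case: hS => h _ _ _ _ /h[h1 _ _]; exact: h1. Qed.

Lemma S_contr t x : 0 <= t -> dom x -> norm (S t x) <= norm x.
Proof. by case: hS => h _ _ _ _ /h[_ _ h1]; exact: h1. Qed.

Lemma S_bop t : 0 <= t -> bounded_op Y Y (S t).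
Proof.
move=> t0; split; first by move=> x; exact: S_dom.
  by case: hS => h _ _ _ _; have [_ h1 _] := h t t0.
by exists 1 => x dx; rewrite mul1r; exact: S_contr.
Qed.

Lemma S_dist t x y : 0 <= t -> dom x -> dom y -> norm (S t x - S t y) <= norm (x - y).
Proof.
move=> t0 dx dy; rewrite -[leRHS]mul1r; apply: (bop_dist hY hY (S_bop t0)) => //.
by move=> z dz; rewrite mul1r; exact: S_contr.
Qed.

Lemma S_zero x : dom x -> heq Y (S 0 x) x.
Proof. by case: hS => _ h _ _ _; exact: h. Qed.

Lemma S_add t r x : 0 <= t -> 0 <= r -> dom x -> heq Y (S (t + r) x) (S t (S r x)).
Proof. by case: hS => _ _ h _ _; exact: h. Qed.

Lemma S_right x : dom x -> forall e : R, 0 < e -> exists2 d : R, 0 < d &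
  forall h, 0 < h -> h < d -> norm (S h x - x) < e.
Proof.
case: hS => _ _ _ h _ /h /cvgr0Pnorm_lt hc e /hc [d /= d0 hd]; exists d => // r r0 rd.
have := hd r _ r0; rewrite ger0_norm ?hnorm_ge0//; apply.
by rewrite /= sub0r normrN gtr0_norm.
Qed.

Lemma S_orbits : uniformly_continuous_orbits S.
Proof.
apply: contraction_semigroup_orbits => //.
- by move=> t x; exact: S_dom.
- exact: S_dist.
- exact: S_add.
- exact: S_right.
Qed.

Lemma Ss_dom t x : 0 <= t -> dom x -> dom (Ss t x).
Proof. by move=> /hSs[h _]; exact: h. Qed.

Lemma Ss_adj t x y : 0 <= t -> dom x -> dom y -> hip Y (S t x) y = hip Y x (Ss t y).
Proof. by move=> /hSs[_ h]; exact: h. Qed.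

Lemma Ss_rip t x y : 0 <= t -> dom x -> dom y -> rip Y (S t x) y = rip Y x (Ss t y).
Proof. by move=> t0 dx dy; rewrite /rip Ss_adj. Qed.

Lemma Ss_contr t x : 0 <= t -> dom x -> norm (Ss t x) <= norm x.
Proof.
move=> t0 dx; have ds := Ss_dom t0 dx.
have [->|n0] := eqVneq (norm (Ss t x)) 0; first exact: hnorm_ge0.
have np : 0 < norm (Ss t x) by rewrite lt_neqAle eq_sym n0 hnorm_ge0.
rewrite -(ler_pM2l np) -expr2 sqr_hnorm// -Ss_rip//.
apply: le_trans (rip_le hY (S_dom t0 ds) dx) _.
by rewrite ler_wpM2r ?hnorm_ge0// S_contr.
Qed.

Lemma Ss_dist t x y : 0 <= t -> dom x -> dom y ->
  norm (Ss t x - Ss t y) <= norm (x - y).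
Proof.
move=> t0 dx dy; have dsx := Ss_dom t0 dx; have dsy := Ss_dom t0 dy.
have dxy : dom (x - y) by hilb.
have dsxy := Ss_dom t0 dxy.
rewrite (@heq_hnorm _ _ _ hY _ (Ss t (x - y))); [exact: Ss_contr|hilb|exact: dsxy|].
apply: (heqP hY) => //; first by hilb.
move=> z dz; have dSz := S_dom t0 dz.
rip; rewrite !(ripC hY _ dz)// -!Ss_rip//; by rip.
Qed.

Lemma Ss_add t r x : 0 <= t -> 0 <= r -> dom x -> heq Y (Ss (t + r) x) (Ss t (Ss r x)).
Proof.
move=> t0 r0 dx; have tr0 : 0 <= t + r by exact: addr_ge0.
have d1 := Ss_dom r0 dx; have d2 := Ss_dom t0 d1; have d3 := Ss_dom tr0 dx.
apply: (heqP hY) => // z dz; have dz1 := S_dom t0 dz.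
rewrite !(ripC hY _ dz)// -!Ss_rip// addrC.
by apply: (heq_rip hY _ _ dx (S_add r0 t0 dz)); apply: S_dom => //; exact: addr_ge0.
Qed.

(* |Ss h x - x|^2 <= 2 |x|^2 - 2 Re (S h x, x), because Ss h is a contraction. *)
Lemma Ss_right x : dom x -> forall e : R, 0 < e -> exists2 d : R, 0 < d &
  forall h, 0 < h -> h < d -> norm (Ss h x - x) < e.
Proof.
(* Chosen so that 2 |S h x - x| (|x| + 1) < e^2; the added 1 keeps the denominator positive when |x|
   = 0. *)
move=> dx e e0; have e20 : 0 < e ^+ 2 / (2 * (norm x + 1)).
  by rewrite divr_gt0 ?exprn_gt0 ?mulr_gt0 ?ltr_wpDl ?hnorm_ge0.
have [d d0 hd] := S_right dx e20; exists d => // h h0 hd'.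
have {hd'} hh := hd h h0 hd'; have dS := S_dom (ltW h0) dx.
have dSs := Ss_dom (ltW h0) dx.
rewrite -(@ltr_pXn2r _ 2)// ?nnegrE ?hnorm_ge0 ?ltW//.
have b1 : norm (Ss h x - x) ^+ 2 <= 2 * rip Y (x - S h x) x.
  rewrite sqr_hnorm; [|exact: hY|hilb].
  rip; rewrite -!sqr_hnorm// (ripC hY dSs dx) -Ss_rip; [|exact: ltW|exact: dx|exact: dx].
  have : norm (Ss h x) ^+ 2 <= norm x ^+ 2.
    by rewrite ler_pXn2r ?nnegrE ?hnorm_ge0// Ss_contr// ltW.
  lra.
have b2 : rip Y (x - S h x) x <= norm (S h x - x) * norm x.
  by rewrite -(hnormB_sym hY)//; apply: (rip_le hY); hilb.
apply: (le_lt_trans b1).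
have b3 : norm (S h x - x) * norm x <= norm (S h x - x) * (norm x + 1).
  by rewrite ler_wpM2l ?hnorm_ge0// lerDl.
have p : 0 < norm x + 1 by rewrite ltr_wpDl ?hnorm_ge0.
move: hh; rewrite ltr_pdivlMr ?mulr_gt0//; lra.
Qed.

Lemma Ss_orbits : uniformly_continuous_orbits Ss.
Proof.
apply: contraction_semigroup_orbits => //.
- by move=> t x; exact: Ss_dom.
- exact: Ss_dist.
- exact: Ss_add.
- exact: Ss_right.
Qed.

Lemma A_dom x y : A x y -> dom x /\ dom y.
Proof. by case: hS => _ _ _ _ h /h[]. Qed.

Lemma A_quotient x y : A x y -> forall e : R, 0 < e -> exists2 d : R, 0 < d &
  forall h, 0 < h -> h < d -> norm ((h^-1)%:C *: (S h x - x) - y) < e.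
Proof.
case: hS => _ _ _ _ h /h[_ _ /cvgr0Pnorm_lt hc] e /hc [d /= d0 hd].
exists d => // r r0 rd.
have := hd r _ r0; rewrite ger0_norm ?hnorm_ge0//; apply.
by rewrite /= sub0r normrN gtr0_norm.
Qed.

(** Re (S h x - x, x) <= |S h x| |x| - |x|^2 <= 0, and the difference quotients converge to y. *)
Lemma A_dissipative x y : A x y -> rip Y y x <= 0.
Proof.
move=> Axy; have [dx dy] := A_dom Axy; apply/ler_addgt0Pl => e e0; rewrite addr0.
have p : 0 < norm x + 1 by rewrite ltr_wpDl ?hnorm_ge0.
have [d d0 hd] := A_quotient Axy (divr_gt0 e0 p).
have h0 : 0 < d / 2 by rewrite divr_gt0.
have hlt : d / 2 < d by lra.
have hh := hd (d / 2) h0 hlt.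
have dS := S_dom (ltW h0) dx.
set q := ((d / 2)^-1)%:C *: (S (d / 2) x - x) in hh.
have dq : dom q by rewrite /q; hilb.
have -> : rip Y y x = rip Y (y - q) x + rip Y q x by rip; rewrite subrK.
have b1 : rip Y q x <= 0.
  rewrite /q; rip; rewrite mulr_ge0_le0 ?invr_ge0 ?(ltW h0)// subr_le0 -sqr_hnorm//.
  apply: le_trans (rip_le hY dS dx) _; rewrite expr2.
  by rewrite ler_wpM2r ?hnorm_ge0// S_contr// ltW.
have b2 : rip Y (y - q) x <= norm (q - y) * (norm x + 1).
  rewrite -(hnormB_sym hY)//; apply: (@le_trans _ _ (norm (y - q) * norm x)).
    by apply: (rip_le hY); hilb.
  by rewrite ler_wpM2l ?hnorm_ge0// lerDl.
move: hh; rewrite ltr_pdivlMr//; lra.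
Qed.

(** Up to null vectors, the difference quotient at [S t x] is [S t] applied to the one at x, and
    [S t] is a contraction. *)
Lemma A_S t x y : 0 <= t -> A x y -> A (S t x) (S t y).
Proof.
move=> t0 Axy; have [dx dy] := A_dom Axy.
have dSx := S_dom t0 dx; have dSy := S_dom t0 dy.
case: hS => _ _ _ _ h; apply/h; split => //.
apply/cvgr0Pnorm_lt => e e0; have [d d0 hd] := A_quotient Axy e0.
exists d => //= r; rewrite /= sub0r normrN => rd r0.
rewrite ger0_norm ?hnorm_ge0//; move: rd; rewrite gtr0_norm// => rd.
have r0' := ltW r0.
have dSr := S_dom r0' dx; have dq : dom (S r x - x) by hilb.
apply: le_lt_trans (hd r r0 rd).
have d1 := S_dom r0' dSx; have d2 := S_dom t0 (S_dom r0' dx).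
have d3 : dom (S t ((r^-1)%:C *: (S r x - x))) by apply: S_dom => //; hilb.
have e1 : heq Y (S r (S t x)) (S t (S r x)).
  have dd : dom (S (r + t) x) by apply: S_dom => //; exact: addr_ge0.
  apply: (heq_trans hY d1 d2 dd).
    by apply: (heq_sym hY) => //; exact: S_add.
  by rewrite addrC; exact: S_add.
have e2 : heq Y (S t ((r^-1)%:C *: (S r x - x)))
    ((r^-1)%:C *: (S r (S t x) - S t x)).
  apply: (heqP hY) => //; first by hilb.
  move=> z dz; have d4 := S_dom r0' dx.
  have -> : (r^-1)%:C *: (S r x - x) = (r^-1)%:C *: (S r x - x) + 0 by rewrite addr0.
  rewrite (bop_ripl hY hY (S_bop t0))//; [|hilb].
  have b0 : rip Y (S t 0) z = 0.
    apply: (rip_null hY) => //; first by apply: S_dom => //; exact: hdom0.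
    by apply: (bop_null (S_bop t0)); [exact: hdom0|exact: hnorm0].
  rewrite b0 addr0 (heq_rip hY _ _ dz (bop_sub (S_bop t0) d4 dx)).
  - by rip; rewrite (heq_rip hY _ _ dz e1).
  - by apply: S_dom.
  - by hilb.
rewrite (@heq_hnorm _ _ _ hY _ (S t ((r^-1)%:C *: (S r x - x)) - S t y)).
- by apply: S_dist => //; hilb.
- by hilb.
- by hilb.
- rewrite /heq opprB addrA subrK.
  by rewrite (hnormB_sym hY)//; hilb.
Qed.

Lemma As_dom z w : As z w -> dom z /\ dom w.
Proof. by case: hAs => _ h /h[]. Qed.

Lemma As_adj x y z w : A x y -> As z w -> hip Y y z = hip Y x w.
Proof. by case: hAs => _ h Axy /h[_ _]; exact. Qed.

Lemma As_uniq z w w' : As z w -> As z w' -> heq Y w w'.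
Proof.
move=> h1 h2; have [dz dw] := As_dom h1; have [_ dw'] := As_dom h2.
have dww : dom (w - w') by hilb.
apply: (rip_dense_null hY _ hAs.1) => //; first by move=> x [y /A_dom[]].
move=> x [y Axy]; have [dx dy] := A_dom Axy.
rip; rewrite (ripC hY dw dx) (ripC hY dw' dx) /rip.
by rewrite -(As_adj Axy h1) -(As_adj Axy h2) subrr.
Qed.

(** Dual to [A_S]. Since [S_ext] evaluates functionals at [Ss t z], this invariance is what gives
    [gval As (Ss t z)] its intended value in the input integral. *)
Lemma As_Ss t z w : 0 <= t -> As z w -> As (Ss t z) (Ss t w).
Proof.
move=> t0 h; have [dz dw] := As_dom h; case: hAs => _ hh; apply/hh; split.
- exact: Ss_dom.
- exact: Ss_dom.
- move=> x y Axy; have [dx dy] := A_dom Axy.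
  by rewrite -!Ss_adj// (As_adj (A_S t0 Axy) h).
Qed.

Lemma gval_As z : gdom As z -> As z (gval As z).
Proof.
case=> w Azw; rewrite /gval.
exact: (@xgetPex _ _ [set y | As z y]) (ex_intro _ w Azw).
Qed.

End Semigroup.

(** * States of the control system *)

Lemma integrable_cst_itv (R : realType) (s t c : R) :
  (@lebesgue_measure R).-integrable `]s, t[ (EFin \o (fun=> c)).
Proof.
apply/integrableP; split; first exact/measurable_EFinP/measurable_cst.
rewrite integral_cst/=; last exact: measurable_itv.
rewrite lebesgue_measure_itv/=; case: ifPn => _.
  by rewrite -EFinB -EFinM ltry.
by rewrite mule0 ltry.
Qed.

Section Input.
Variables (R : realType) (V W : lmodType R[i]) (Y : hspace V) (U : hspace W).
Hypotheses (hY : pre_hilbert Y) (hU : pre_hilbert U).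
Variables (A As : V -> V -> Prop) (S Ss : R -> V -> V) (Gr : W -> V).
Hypothesis hS : generates_contraction_semigroup Y A S.
Hypothesis hAs : is_adjoint_graph Y A As.
Hypothesis hSs : forall t, 0 <= t -> is_adjoint Y (S t) (Ss t).
Hypothesis hGr : bounded_op U Y Gr.
Hypothesis dAs : hdense Y (gdom As).
Local Notation leb := (@lebesgue_measure R).
Local Notation input := (input_integral Y As Ss Gr).

Lemma SGr_bop t : 0 <= t -> bounded_op U Y (fun u => S t (Gr u)).
Proof. by move=> t0; exact: bop_comp hU hY hY hGr (S_bop hS t0). Qed.

Lemma SGr_bound : exists2 K : R, 0 <= K & forall t u, 0 <= t -> hdom U u ->
  hnorm Y (S t (Gr u)) <= K * hnorm U u.
Proof.
have [K K0 hK] := bop_bound hGr; exists K => // t u t0 du.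
by apply: le_trans (hK u du); apply: (S_contr hS) => //; exact: (bop_dom hGr).
Qed.

Lemma B_kernel t u z w : 0 <= t -> hdom U u -> As z w ->
  S_ext Ss t (B_ctl Y As Gr u) z = hip Y (S t (Gr u)) (z - w).
Proof.
move=> t0 du Azw; have [dz dw] := As_dom hAs Azw.
have dG := bop_dom hGr du; have dzw : hdom Y (z - w) by hilb.
have dS := S_dom hS t0 dG.
have h1 := As_Ss hY hS hAs hSs t0 Azw.
have h2 := gval_As (ex_intro _ _ h1).
have [d1 d2] := As_dom hAs h1; have [_ d3] := As_dom hAs h2.
rewrite /S_ext /B_ctl /pivot /A_ext.
rewrite (heq_hipr hY d3 d2 dG (As_uniq hY hS hAs h2 h1)) -!(Ss_adj hSs)//.
rewrite (hip_conj hY dzw dS) hipDl//; last by hilb.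
rewrite -scaleN1r hipZl// mulN1r (hip_conj hY dS dz) (hip_conj hY dS dw).
by case: (hip Y _ z) => ? ?; case: (hip Y _ w) => ? ?;
  apply/eqP; rewrite eq_complex /=; apply/andP; split; apply/eqP; ring.
Qed.

Lemma orbit_measurable s t v x : hdom Y v -> hdom Y x ->
  measurable_fun (`]s, t[ : set (measurableTypeR R)) (fun r => rip Y (S (t - r) v) x).
Proof.
move=> dv dx; apply: continuous_in_time_measurable => r /andP[sr rt] e e0.
have p : 0 < hnorm Y x + 1 by rewrite ltr_wpDl ?hnorm_ge0.
have [d d0 hd] := S_orbits hY hS dv (divr_gt0 e0 p); exists d => // q /andP[sq qt] qr.
have r0 : 0 <= t - r by rewrite subr_ge0 ltW.
have q0 : 0 <= t - q by rewrite subr_ge0 ltW.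
have dr := S_dom hS r0 dv; have dq := S_dom hS q0 dv.
have -> : rip Y (S (t - q) v) x - rip Y (S (t - r) v) x =
    rip Y (S (t - q) v - S (t - r) v) x by rip.
have dqr : hdom Y (S (t - q) v - S (t - r) v) by hilb.
apply: (le_lt_trans (cauchy_schwarz hY dqr dx)).
have := hd (t - r) (t - q) r0 q0.
have -> : t - q - (t - r) = - (q - r) by ring.
rewrite normrN ltr_pdivlMr// => /(_ qr); apply: le_lt_trans.
by rewrite ler_wpM2l ?hnorm_ge0// lerDl.
Qed.

Lemma kernel_rip_integrable s t g x : L2_in_time U s t g -> hdom Y x ->
  leb.-integrable `]s, t[ (EFin \o (fun r => rip Y (S (t - r) (Gr (g r))) x)).
Proof.
move=> hg dx; have [K K0 hK] := SGr_bound.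
have pos r : r \in `]s, t[ -> 0 <= t - r.
  by rewrite in_itv/= => /andP[_ rt]; rewrite subr_ge0 ltW.
(* The majorant comes from |g| <= |g|^2 + 1 on an interval of finite length. *)
apply: (@dominated_integrable _ _ _ _ _ (measurable_oo s t) _
    (fun r => (K * hnorm Y x) * hnorm U (g r) ^+ 2 + (K * hnorm Y x) * 1)).
- apply: (strongly_measurable_form hU (phi := fun u r => rip Y (S (t - r) (Gr u)) x)).
  + by move=> u du; apply: orbit_measurable => //; exact: (bop_dom hGr).
  + by move=> r /pos r0 a u v du dv; exact: (bop_ripl hU hY (SGr_bop r0)).
  + move=> r /pos r0; exists (K * hnorm Y x) => u du; rewrite mulrAC.
    have dS := bop_dom (SGr_bop r0) du.
    apply: le_trans (cauchy_schwarz hY dS dx) _.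
    by rewrite ler_wpM2r ?hnorm_ge0// hK.
  + exact: hg.1.
- move=> r /= rst; have r0 := pos r rst.
  have du : hdom U (g r) by apply: (L2_in_time_dom hg); move: rst; rewrite in_itv.
  have dS := bop_dom (SGr_bop r0) du.
  apply: le_trans (cauchy_schwarz hY dS dx) _.
  apply: (@le_trans _ _ (K * hnorm U (g r) * hnorm Y x)).
    by rewrite ler_wpM2r ?hnorm_ge0// hK.
  rewrite mulrAC -mulrDr ler_wpM2l ?mulr_ge0 ?hnorm_ge0//.
  by have := sqr_ge0 (hnorm U (g r) - 1); have := sqr_ge0 (hnorm U (g r));
    rewrite sqrrB; lra.
- apply: integrable_lincomb; [exact: measurable_oo|exact: L2_integrable|].
  exact: integrable_cst_itv.
Qed.


Lemma kernel_cintegrable s t g x : L2_in_time U s t g -> hdom Y x ->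
  cintegrable leb `]s, t[ (fun r => hip Y (S (t - r) (Gr (g r))) x).
Proof.
move=> hg dx; split; first exact: kernel_rip_integrable.
have hg' : L2_in_time U s t (- 'i%C *: g).
  by rewrite -[_ *: g]addr0; apply: L2_lin => //; exact: L2_0.
apply: (@eq_integrable _ _ _ _ _ (measurable_oo s t)
   (EFin \o (fun r => rip Y (S (t - r) (Gr ((- 'i%C *: g) r))) x))).
  move=> r /set_mem/=; rewrite in_itv/= => rst; congr EFin.
  have r0 : 0 <= t - r by case/andP: rst => _ /ltW; rewrite subr_ge0.
  have du := L2_in_time_dom hg rst; have dS := bop_dom (SGr_bop r0) du.
  rewrite (Im_hip hY dS dx) /rip.
  have -> : (- 'i%C *: g) r = - 'i%C *: g r + 0 by rewrite addr0.
  have d0 := hdom0 hU.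
  rewrite (bop_hipl hU hY (SGr_bop r0))// hipZl//.
  rewrite (hip_null hY _ dx (bop_null (SGr_bop r0) d0 (hnorm0 hU))) ?addr0//.
  exact: (bop_dom (SGr_bop r0)).
exact: kernel_rip_integrable.
Qed.

Lemma input_kernel s t g z w : As z w ->
  (forall r, s < r < t -> hdom U (g r)) ->
  input s t g z = cint leb `]s, t[ (fun r => hip Y (S (t - r) (Gr (g r))) (z - w)).
Proof.
move=> Azw dg; rewrite /input_integral /cint; congr (_ +i* _);
  apply: eq_Rintegral => r /set_mem/=; rewrite in_itv/= => rst;
  (have r0 : 0 <= t - r by case/andP: rst => _ /ltW; rewrite subr_ge0);
  by rewrite (B_kernel r0 (dg _ rst) Azw).
Qed.

Lemma input_lin s t (a : R[i]) g h z : gdom As z ->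
  L2_in_time U s t g -> L2_in_time U s t h ->
  input s t (a *: g + h) z = a * input s t g z + input s t h z.
Proof.
move=> [w Azw] hg hh; have [dz dw] := As_dom hAs Azw.
have dzw : hdom Y (z - w) by hilb.
rewrite !(input_kernel Azw); try by move=> r rst; apply: (L2_in_time_dom _ rst); try exact: L2_lin.
rewrite -cint_lin; [|exact: measurable_oo|exact: kernel_cintegrable|exact: kernel_cintegrable].
rewrite /cint; congr (_ +i* _);
  apply: eq_Rintegral => r /set_mem/=; rewrite in_itv/= => rst; congr (_ _);
  (have r0 : 0 <= t - r by case/andP: rst => _ /ltW; rewrite subr_ge0);
  exact: (bop_hipl hU hY (SGr_bop r0) _ (L2_in_time_dom hg rst) (L2_in_time_dom hh rst)).
Qed.

Lemma input_cut a s t b g z : a <= s -> s <= t -> t <= b -> gdom As z ->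
  L2_in_time U s b g ->
  input a t (cut `]s, b[ g) z = input s t g z.
Proof.
move=> a_s st tb [w Azw] hg; have [dz dw] := As_dom hAs Azw.
have dzw : hdom Y (z - w) by hilb.
have sub r : s < r < t -> (`]s, b[%classic : set R) r.
  by case/andP=> sr rt; rewrite /= in_itv/= sr (lt_le_trans rt).
rewrite !(input_kernel Azw); first last.
- move=> r /andP[_ rt]; have [h|h] := pselect ((`]s, b[%classic : set R) r).
    by rewrite cut_in//; apply: (L2_in_time_dom hg); move: h; rewrite /= in_itv.
  by rewrite cut_out//; exact: hdom0.
- by move=> r /sub h; apply: (L2_in_time_dom hg); move: h; rewrite /= in_itv.
have subI : (`]a, t[%classic : set R) `&` `]s, t[%classic = `]s, t[%classic.
  apply: setIidr => r /=; rewrite !in_itv/= => /andP[sr ->].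
  by rewrite (le_lt_trans a_s).
(* [Gr 0] is only known to be a null vector, so the kernel vanishes through its inner product with
   [z - w]. *)
have e0 r : a < r < t -> ~ (`]s, t[%classic : set R) r ->
    hip Y (S (t - r) (Gr (cut `]s, b[ g r))) (z - w) = 0.
  move=> /andP[_ rt] nr; rewrite cut_out; last first.
    by move=> /=; rewrite in_itv/= => /andP[sr _]; apply: nr; rewrite /= in_itv/= sr.
  have r0 : 0 <= t - r by rewrite subr_ge0 ltW.
  have d0 := hdom0 hU; apply: (hip_null hY (bop_dom (SGr_bop r0) d0) dzw).
  exact: (bop_null (SGr_bop r0) d0 (hnorm0 hU)).
rewrite /cint; congr (_ +i* _); rewrite -[in RHS]subI Rintegral_mkcondr;
  apply: eq_Rintegral => r /set_mem/=; rewrite in_itv/= => rat; rewrite patchE;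
  case: ifPn => [/set_mem/= rst|/negP nr];
  [rewrite cut_in//; apply: sub; by rewrite in_itv in rst
  |rewrite e0// => h; apply: nr; exact: mem_set
  |rewrite cut_in//; apply: sub; by rewrite in_itv in rst
  |rewrite e0// => h; apply: nr; exact: mem_set].
Qed.

(* For z in the domain of A* the integrand of (L h, z) is controlled by |h(r)|
   alone, hence the factor sqrt (b - a), here hidden in AM-GM form. *)
Lemma input_small z w : As z w -> exists2 K : R, 0 <= K &
  forall t g (p q : R), L2_in_time U 0 t g -> p <= q ->
    (forall r, ~ (p < r <= q) -> g r = 0) ->
  forall lam : R, 0 < lam ->
    `|complex.Re (input 0 t g z)| <=
      K * (lam * sqnorm_in_time U 0 t g + lam^-1 * (q - p)).
Proof.
move=> Azw; have [dz dw] := As_dom hAs Azw.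
have dzw : hdom Y (z - w) by hilb.
have [K K0 hK] := SGr_bound; exists (K * hnorm Y (z - w)).
  by rewrite mulr_ge0 ?hnorm_ge0.
move=> t g p q hg pq g0 lam lam0; have : 0 <= K * hnorm Y (z - w) by rewrite mulr_ge0 ?hnorm_ge0.
move eK' : (K * hnorm Y (z - w)) => K' K'0.
rewrite (input_kernel Azw); last by move=> r; exact: L2_in_time_dom.
have h1 := kernel_rip_integrable hg dzw.
have i1 : leb.-integrable `]0, t[ (EFin \o (\1_(`]p, q]) : R -> R)).
  apply: (dominated_integrable (measurable_oo 0 t) _ _ (integrable_cst_itv 0 t 1)).
    exact: measurable_indic.
  by move=> r _; rewrite ger0_norm// indicE; case: (_ \in _).
have mle : \int[leb]_(r in `]0, t[) (\1_(`]p, q]) r : R) <= q - p.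
  rewrite /Rintegral integral_indic//.
  have lpq : leb (`]p, q]%classic : set R) = (q - p)%:E.
    rewrite lebesgue_measure_itv/= lte_fin; case: ltP => // qp.
    by have -> : q = p; [apply/eqP; rewrite eq_le qp pq|rewrite subrr].
  have le1 : (leb ((`]p, q]%classic : set R) `&` `]0%R, t[) <= (q - p)%:E)%E.
    rewrite -lpq; apply: le_measure; rewrite ?inE//.
    exact: measurableI.
  have fin : leb ((`]p, q]%classic : set R) `&` `]0%R, t[) \is a fin_num.
    by rewrite ge0_fin_numE// (le_lt_trans le1)// ltry.
  by rewrite -lee_fin fineK.
have h2 : leb.-integrable `]0, t[ (EFin \o (fun r =>
    (K' * lam) * hnorm U (g r) ^+ 2 + (K' * lam^-1) * \1_(`]p, q]) r)).
  by apply: integrable_lincomb => //; exact: L2_integrable.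
apply: (@le_trans _ _ (\int[leb]_(r in `]0, t[) (
    (K' * lam) * hnorm U (g r) ^+ 2 + (K' * lam^-1) * \1_(`]p, q]) r))).
  apply: le_trans (le_normr_Rintegral (measurable_oo 0 t) h1) _.
  apply: le_Rintegral => //.
    by have := integrable_norm h1.
  move=> r /=; rewrite in_itv/= => r0t.
  have r0 : 0 <= t - r by case/andP: r0t => _ /ltW; rewrite subr_ge0.
  have du := L2_in_time_dom hg r0t; have dS := bop_dom (SGr_bop r0) du.
  apply: le_trans (cauchy_schwarz hY dS dzw) _.
  apply: (@le_trans _ _ (K' * hnorm U (g r))).
    by rewrite -eK' mulrAC ler_wpM2r ?hnorm_ge0// hK.
  rewrite -!mulrA -mulrDr ler_wpM2l//.
  have [prq|nprq] := boolP (r \in `]p, q]).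
    rewrite indicE mem_set// mulr1; set x := hnorm _ _.
    have l0 : lam != 0 by rewrite gt_eqF.
    have := mulr_ge0 (ltW lam0) (sqr_ge0 (x - lam^-1)).
    have -> : lam * (x - lam^-1) ^+ 2 = lam * x ^+ 2 - 2 * x + lam^-1 by field.
    have : 0 <= x by exact: hnorm_ge0.
    by move: (lam * x ^+ 2) (lam^-1) => u v; lra.
  rewrite g0 ?hnorm0// ?expr0n/= ?mulr0 ?add0r; last first.
    by move: nprq; rewrite in_itv/= => /negP.
  by rewrite mulr_ge0 ?invr_ge0 ?(ltW lam0).
rewrite Rintegral_lincomb//; last exact: L2_integrable.
rewrite mulrDr !mulrA lerD2l ler_wpM2l//.
by rewrite mulr_ge0// invr_ge0 ltW.
Qed.

Lemma state_unique s T x g y y' : is_state Y As S Ss Gr s T x g y ->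
  is_state Y As S Ss Gr s T x g y' -> forall t, s <= t <= T -> heq Y (y t) (y' t).
Proof.
move=> [c1 h1] [c2 h2] t st; have [d1 _] := c1 t st; have [d2 _] := c2 t st.
have ddom : gdom As `<=` hdom Y by move=> z [w /(As_dom hAs)[]].
have dd : hdom Y (y t - y' t) by hilb.
apply: (rip_dense_null hY ddom dAs dd) => z Az.
have dz := ddom _ Az; rip.
have := h1 t st z Az; rewrite -(h2 t st z Az) /pivot /rip => ->.
by rewrite subrr.
Qed.

Lemma continuous_in_time_lin s T (a : R[i]) (f g : R -> V) :
  continuous_in_time Y s T f -> continuous_in_time Y s T g ->
  continuous_in_time Y s T (fun t => a *: f t + g t).
Proof.
move=> cf cg r sr; have [df hf] := cf r sr; have [dg hg] := cg r sr.
split; first by hilb.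
move=> e e0; set na : R := Num.sqrt (complex.Re a ^+ 2 + complex.Im a ^+ 2).
have p : 0 < na + 1 by rewrite ltr_wpDl ?sqrtr_ge0.
have e1 : 0 < e / 2 / (na + 1) by rewrite !divr_gt0.
have e2 : 0 < e / 2 by rewrite divr_gt0.
have [d1 d10 h1] := hf _ e1; have [d2 d20 h2] := hg _ e2.
exists (Num.min d1 d2); first by rewrite lt_min d10.
move=> q sq; rewrite lt_min => /andP[q1 q2].
have [dfq _] := cf q sq; have [dgq _] := cg q sq.
have -> : a *: f q + g q - (a *: f r + g r) =
    a *: (f q - f r) + (g q - g r) by rewrite scalerBr opprD addrACA.
apply: (@le_lt_trans _ _ (na * hnorm Y (f q - f r) + hnorm Y (g q - g r))).
  by rewrite -(hnormZ hY); [apply: ler_hnormD|]; hilb.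
have := h1 q sq q1; have := h2 q sq q2; rewrite (ltr_pdivlMr _ _ p) mulrDr mulr1.
by have := hnorm_ge0 Y (f q - f r); rewrite [_ * na]mulrC; lra.
Qed.

Lemma state_lin s T x y g h u v (a : R[i]) : s <= T ->
  hdom Y x -> hdom Y y -> L2_in_time U s T g -> L2_in_time U s T h ->
  is_state Y As S Ss Gr s T x g u -> is_state Y As S Ss Gr s T y h v ->
  is_state Y As S Ss Gr s T (a *: x + y) (a *: g + h)
    (fun t => a *: u t + v t).
Proof.
move=> sT dx dy hg hh [cu hu] [cv hv]; split; first exact: continuous_in_time_lin.
move=> t st z Az; have [w Azw] := Az; have [dz _] := As_dom hAs Azw.
have [du _] := cu t st; have [dv _] := cv t st.
have t0 : 0 <= t - s by rewrite subr_ge0; case/andP: st.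
have tT : t <= T by case/andP: st.
rewrite /pivot (bop_hipl hY hY (S_bop hS t0))// input_lin//; last 2 first.
- exact: L2_restrict hg.
- exact: L2_restrict hh.
have := hu t st z Az; have := hv t st z Az; rewrite /pivot => hv' hu'.
rewrite hipDl ?hipZl ?hu' ?hv'//; hilb.
by rewrite mulrDr addrACA.
Qed.

(** * The control-to-state map on (0, T) and its consequences for all initial times *)

Section States.
Variables (T C : R) (Lam : (R -> W) -> R -> V).
Hypothesis T0 : 0 <= T.
Hypothesis C0 : 0 <= C.
Local Notation H := (time_space U 0 T).
Hypothesis hLam : forall g, L2_in_time U 0 T g ->
  is_state Y As S Ss Gr 0 T 0 g (Lam g) /\
  forall t, 0 <= t <= T -> hnorm Y (Lam g t) <= C * hnorm H g.

Lemma Lam_dom g t : L2_in_time U 0 T g -> 0 <= t <= T -> hdom Y (Lam g t).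
Proof. by move=> /hLam[[c _] _] /c[]. Qed.

Lemma S_null t : 0 <= t -> hnorm Y (S t 0) = 0.
Proof. by move=> t0; apply: (bop_null (S_bop hS t0)); [exact: hdom0|exact: hnorm0]. Qed.

(** [Lam g] is some state driven by g; linearity up to [heq] comes from superposition and uniqueness
    of states. *)
Lemma Lam_lin g h (a : R[i]) t : L2_in_time U 0 T g -> L2_in_time U 0 T h ->
  0 <= t <= T -> heq Y (Lam (a *: g + h) t) (a *: Lam g t + Lam h t).
Proof.
move=> hg hh; have [sg _] := hLam hg; have [sh _] := hLam hh.
have hgh : L2_in_time U 0 T (a *: g + h) by exact: L2_lin.
have [sgh _] := hLam hgh; have d0 := hdom0 hY.
have := state_lin a T0 d0 d0 hg hh sg sh; rewrite scaler0 addr0 => sl tT.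
exact: (state_unique sgh sl tT).
Qed.

Lemma Lam_bop t : 0 <= t <= T -> bounded_op H Y (fun g => Lam g t).
Proof.
move=> tT; split; first by move=> g hg; exact: Lam_dom.
  by move=> a g h hg hh; exact: Lam_lin.
by exists C => g hg; have [_ h] := hLam hg; exact: h.
Qed.

(** Both sides have the same pairings with the domain of A*, because the input integral from 0 of
    the zero extension equals the input integral of g from s. Every initial time is thereby reduced
    to the single map [Lam], whose bound C is independent of s. *)
Lemma state_repr s x g y t : 0 <= s <= T -> hdom Y x -> L2_in_time U s T g ->
  is_state Y As S Ss Gr s T x g y -> s <= t <= T ->
  heq Y (y t) (S (t - s) x + Lam (cut `]s, T[ g) t).
Proof.
move=> /andP[s0 sT] dx hg [c h] st; have [dy _] := c t st.
have [st' tT] := andP st.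
have hcg := L2_extend hU s0 (lexx T) hg.
have t0T : 0 <= t <= T by rewrite (le_trans s0).
have ts : 0 <= t - s by rewrite subr_ge0.
have dL := Lam_dom hcg t0T; have dS := S_dom hS ts dx.
have ddom : gdom As `<=` hdom Y by move=> z [w /(As_dom hAs)[]].
have dd : hdom Y (y t - (S (t - s) x + Lam (cut `]s, T[ g) t)) by hilb.
apply: (rip_dense_null hY ddom dAs dd) => z Az.
have dz := ddom _ Az; rip.
have [[_ hc] _] := hLam hcg.
have e1 := h t st z Az; have e2 := hc t t0T z Az.
rewrite subr0 (@input_cut 0 s t T g z) in e2 => //.
have t0 : 0 <= t by case/andP: t0T.
rewrite /pivot (hip_null hY _ dz (S_null t0)) in e2; last first.
  by apply: (S_dom hS) => //; exact: hdom0.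
rewrite add0r in e2; rewrite /pivot -e2 in e1.
rewrite /rip e1; case: (hip Y (S (t - s) x) z) => a b.
by case: (hip Y (Lam _ t) z) => c' d' /=; ring.
Qed.

(** Provides the competitors of the first variation: the given state plus a multiple of the state
    that h drives from 0. As h vanishes up to time s, restricting [Lam h] to [s, T] gives a state
    with initial value 0. *)
Lemma state_perturb s x g y h (a : R) : 0 <= s <= T -> hdom Y x ->
  L2_in_time U s T g -> L2_in_time U 0 T h -> cut `]s, T[ h = h ->
  is_state Y As S Ss Gr s T x g y ->
  is_state Y As S Ss Gr s T x (a%:C *: h + g) (fun t => a%:C *: Lam h t + y t).
Proof.
move=> /andP[s0 sT] dx hg hh ch sy; have d0 := hdom0 hY.
have hs := L2_restrict hU s0 (lexx T) hh.
have sL : is_state Y As S Ss Gr s T 0 h (Lam h).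
  have [[c hc] _] := hLam hh; split.
    move=> r /andP[sr rT]; have [|dr hr] := c r; first by rewrite (le_trans s0).
    split=> // e e0; have [d dp hd] := hr e e0; exists d => // q /andP[sq qT].
    by apply: hd; rewrite (le_trans s0).
  move=> t /andP[st tT] z Az; have t0 : 0 <= t by exact: le_trans st.
  have [w /(As_dom hAs)[dz _]] := Az.
  have ts : 0 <= t - s by rewrite subr_ge0.
  rewrite (hc t _ z Az) ?t0// subr0 -[in LHS]ch (@input_cut 0 s t T h z)//.
  rewrite /pivot !(hip_null hY _ dz (S_null _))//; exact: (S_dom hS).
by have := state_lin a%:C sT d0 dx hs hg sL sy; rewrite scaler0 add0r.
Qed.

(** Boundedness of [Lam] gives only C |g|, however short the support; the gain appears after pairing
    with a fixed q. The width d depends on q. *)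
Lemma final_state_small q : hdom Y q -> forall e : R, 0 < e ->
  exists2 d : R, 0 < d & forall g (a b : R), L2_in_time U 0 T g -> a <= b ->
    (forall r, ~ (a < r <= b) -> g r = 0) -> b - a < d ->
    `|rip Y (Lam g T) q| <= e * hnorm H g.
Proof.
move=> dq e e0; have C1 : 0 < C + 1 by rewrite ltr_wpDl.
(* Replacing q by z in the domain of A* at this distance costs at most (e/2) |g|. *)
have e1 : 0 < e / 2 / (C + 1) by rewrite !divr_gt0.
have [z [w Azw] qz] := dAs dq e1.
have [dz _] := As_dom hAs Azw; have [K K0 hK] := input_small Azw.
have K1 : 0 < K + 1 by rewrite ltr_wpDl.
(* Chosen so that 2 (K + 1) rho = e/2, the share left for z. *)
pose rho := e / 4 / (K + 1); have rho0 : 0 < rho by rewrite !divr_gt0.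
exists (rho ^+ 2); first by rewrite exprn_gt0.
move=> g a b hg ab g0 bad.
have tT : 0 <= T <= T by rewrite T0 lexx.
have [[_ hc] /(_ T tT) hb] := hLam hg; have dL := Lam_dom hg tT.
have hH := time_space_pre_hilbert hU 0 T.
have dqz : hdom Y (q - z) by hilb.
set N := hnorm H g in hb *.
have N0 : 0 <= N by exact: hnorm_ge0.
have b1 : `|rip Y (Lam g T) (q - z)| <= e / 2 * N.
  apply: le_trans (cauchy_schwarz hY dL dqz) _.
  apply: (@le_trans _ _ ((C + 1) * N * (e / 2 / (C + 1)))).
    apply: ler_pM; rewrite ?hnorm_ge0 ?(ltW qz)//.
    by apply: le_trans hb _; rewrite ler_wpM2r// lerDl.
  rewrite le_eqVlt; apply/orP; left; apply/eqP; field.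
  by rewrite gt_eqF.
have [N00|Nn0] := eqVneq N 0.
  apply: le_trans (cauchy_schwarz hY dL dq) _.
  by move: hb; rewrite N00 !mulr0 => hb; rewrite mulr_le0_ge0 ?hnorm_ge0.
have Np : 0 < N by rewrite lt_neqAle eq_sym Nn0.
have b2 : `|rip Y (Lam g T) z| <= e / 2 * N.
  have -> : rip Y (Lam g T) z = complex.Re (input 0 T g z).
    rewrite /rip; have := hc T tT z (ex_intro _ w Azw).
    rewrite /pivot subr0 (hip_null hY _ dz (S_null T0)) ?add0r => [->//|].
    by apply: (S_dom hS) => //; exact: hdom0.
  (* With lam = rho / N and b - a < rho^2, both terms of the bound from [input_small] are at most K
     rho N. Dividing by N is why N = 0 was treated separately. *)
  have l0 : 0 < rho / N by rewrite divr_gt0.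
  apply: le_trans (hK _ _ _ _ hg ab g0 _ l0) _.
  rewrite (sqnorm_rip hU hg) -(sqr_hnorm hH hg) -/N.
  apply: (@le_trans _ _ (K * (rho / N * N ^+ 2 + (rho / N)^-1 * rho ^+ 2))).
    by rewrite ler_wpM2l// lerD2l ler_wpM2l ?invr_ge0 ?ltW.
  have -> : K * (rho / N * N ^+ 2 + (rho / N)^-1 * rho ^+ 2) = 2 * (K * rho) * N.
    by field; rewrite (gt_eqF rho0) Nn0.
  rewrite ler_wpM2r//; apply: (@le_trans _ _ (2 * ((K + 1) * rho))).
    by rewrite ler_wpM2l// ler_wpM2r ?(ltW rho0)// lerDl.
  rewrite /rho le_eqVlt; apply/orP; left; apply/eqP; field.
  by rewrite gt_eqF.
have -> : rip Y (Lam g T) q = rip Y (Lam g T) (q - z) + rip Y (Lam g T) z.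
  by rip; rewrite subrK.
apply: le_trans (ler_normD _ _) _; lra.
Qed.

End States.

Lemma state_family T : 0 < T -> well_posed Y U As S Ss Gr T ->
  exists2 C : R, 0 <= C & exists Lam : (R -> W) -> R -> V,
    forall g, L2_in_time U 0 T g -> is_state Y As S Ss Gr 0 T 0 g (Lam g) /\
      forall t, 0 <= t <= T -> hnorm Y (Lam g t) <= C * hnorm (time_space U 0 T) g.
Proof.
move=> T0 wp; have [|C hC] := wp 0; first by rewrite lexx.
(* [well_posed] does not fix the sign of its constant. The constant used is the one for initial time
   0, hence the same for every s. *)
exists `|C| => //.
have /choice[Lam hLam] : forall g, exists y, L2_in_time U 0 T g ->
    is_state Y As S Ss Gr 0 T 0 g y /\
    forall t, 0 <= t <= T -> hnorm Y (y t) <= `|C| * hnorm (time_space U 0 T) g.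
  move=> g; have [hg|ng] := pselect (L2_in_time U 0 T g); last by exists (fun=> 0).
  have [y sy hy] := hC g hg; exists y => _; split => // t t0.
  apply: le_trans (hy t t0) _; rewrite L2norm_hnorm//.
  by rewrite ler_wpM2r ?hnorm_ge0// ler_norm.
by exists Lam.
Qed.

End Input.

(** * Euler equations of the quadratic cost *)

Section OptimalPairs.
Variables (R : realType) (V Z : lmodType R[i]) (Y : hspace V) (H : hspace Z).
Hypotheses (hY : pre_hilbert Y) (hH : pre_hilbert H).
Variables (L : Z -> V) (C alpha M : R).
Hypothesis hL : bounded_op H Y L.
Hypothesis C0 : 0 <= C.
Hypothesis hC : forall g, hdom H g -> hnorm Y (L g) <= C * hnorm H g.
Hypothesis alpha0 : 0 < alpha.
Hypothesis M0 : 0 <= M.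

Lemma adjoint_bound (G Gs : V -> V) : is_adjoint Y G Gs ->
  (forall x, hdom Y x -> hdom Y (G x)) ->
  (forall x, hdom Y x -> hnorm Y (G x) <= M * hnorm Y x) ->
  forall x, hdom Y x -> hnorm Y (Gs x) <= M * hnorm Y x.
Proof.
move=> [ds adj] dG hM x dx; have d1 := ds x dx; have d2 := dG _ d1.
have [->|n0] := eqVneq (hnorm Y (Gs x)) 0; first by rewrite mulr_ge0 ?hnorm_ge0.
have np : 0 < hnorm Y (Gs x) by rewrite lt_neqAle eq_sym n0 hnorm_ge0.
rewrite -(ler_pM2l np) -expr2 sqr_hnorm// /rip -adj//.
apply: le_trans (rip_le hY d2 dx) _; rewrite mulrCA mulrA.
by rewrite ler_wpM2r ?hnorm_ge0// hM.
Qed.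

(** [is_adjoint] does not state that [Gs] is linear; additivity up to null vectors follows by
    duality from the pairing with [G z]. *)
Lemma adjoint_dist (G Gs : V -> V) : is_adjoint Y G Gs ->
  (forall x, hdom Y x -> hdom Y (G x)) ->
  (forall x, hdom Y x -> hnorm Y (G x) <= M * hnorm Y x) ->
  forall x y, hdom Y x -> hdom Y y -> hnorm Y (Gs x - Gs y) <= M * hnorm Y (x - y).
Proof.
move=> hG dG hM x y dx dy; have [ds adj] := hG.
have dxs := ds x dx; have dys := ds y dy.
have dxy : hdom Y (x - y) by hilb.
have dxys := ds _ dxy.
rewrite (@heq_hnorm _ _ _ hY _ (Gs (x - y))); [|hilb|exact: dxys|].
  exact: (adjoint_bound hG dG hM).
apply: (heqP hY) => //; first by hilb.
move=> z dz; have dGz := dG _ dz.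
have adj' u v : hdom Y u -> hdom Y v -> rip Y (G u) v = rip Y u (Gs v).
  by move=> du dv; rewrite /rip adj.
by rip; rewrite !(ripC hY _ dz)// -!adj'//; rip.
Qed.

Section OneObservable.
Variables (G Gs : V -> V).
Hypothesis hG : bounded_op Y Y G.
Hypothesis hM : forall x, hdom Y x -> hnorm Y (G x) <= M * hnorm Y x.
Hypothesis hGs : is_adjoint Y G Gs.

(* Euler's equation for the minimum over g in the subspace K of
   alpha |g|^2 + |G (e + L g)|^2. *)
Definition optimal_pair (K : set Z) (e : V) (g : Z) (y : V) : Prop :=
  [/\ K g, hdom Y y, heq Y y (e + L g) &
      forall h, K h -> alpha * rip H g h + rip Y (G y) (G (L h)) = 0].

Variable K : set Z.
Hypothesis KH : K `<=` hdom H.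

(** Testing Euler's equation with h = g gives alpha |g|^2 + |G y|^2 = Re (G e, G y), which controls
    both terms. The bounds depend on G only through M, so they are uniform over the approximating
    observations. *)
Lemma optimal_pair_bound e g y : hdom Y e -> optimal_pair K e g y ->
  hnorm Y (G y) <= M * hnorm Y e /\
  hnorm H g <= M / Num.sqrt alpha * hnorm Y e.
Proof.
move=> de [Kg dy yE eu]; have dg := KH Kg.
have dLg := bop_dom hL dg; have dGy := bop_dom hG dy.
have dGL := bop_dom hG dLg; have dGe := bop_dom hG de.
have del : hdom Y (e + L g) by hilb.
have e1 : rip Y (G y) (G y) = rip Y (G e) (G y) + rip Y (G (L g)) (G y).
  rewrite (heq_rip hY dGy (bop_dom hG del) dGy (bop_heq hY hY hG dy del yE)).
  have -> : e + L g = 1%:C *: e + L g by rewrite scale1r.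
  by rewrite (bop_ripl hY hY hG)// mul1r.
have := eu g Kg; rewrite (ripC hY dGy dGL) => e2.
have b1 : rip Y (G e) (G y) <= hnorm Y (G e) * hnorm Y (G y) by exact: (rip_le hY).
have b2 := hM de.
have s1 : alpha * hnorm H g ^+ 2 + hnorm Y (G y) ^+ 2 <=
    M * hnorm Y e * hnorm Y (G y).
  rewrite !sqr_hnorm// e1; apply: (@le_trans _ _ (hnorm Y (G e) * hnorm Y (G y))).
    by lra.
  by rewrite ler_wpM2r ?hnorm_ge0.
have g0 := hnorm_ge0 H g; have y0 := hnorm_ge0 Y (G y).
have n0 : 0 <= M * hnorm Y e by rewrite mulr_ge0 ?hnorm_ge0.
have ag : 0 <= alpha * hnorm H g ^+ 2 by rewrite mulr_ge0 ?sqr_ge0 ?ltW.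
have b3 : hnorm Y (G y) <= M * hnorm Y e.
  have [->//|nn] := eqVneq (hnorm Y (G y)) 0.
  have np : 0 < hnorm Y (G y) by rewrite lt_neqAle eq_sym nn.
  by rewrite -(ler_pM2r np) -expr2; lra.
split => //.
have sa : 0 < Num.sqrt alpha by rewrite sqrtr_gt0.
rewrite mulrAC ler_pdivlMr// -(@ler_pXn2r _ 2)// ?nnegrE ?mulr_ge0 ?hnorm_ge0 ?(ltW sa)//.
rewrite exprMn (sqr_sqrtr (ltW alpha0)) [leLHS]mulrC.
have : M * hnorm Y e * hnorm Y (G y) <= (M * hnorm Y e) * (M * hnorm Y e).
  by rewrite ler_wpM2l.
have := sqr_ge0 (hnorm Y (G y)); rewrite [in X in _ -> _ -> X]expr2; lra.
Qed.

End OneObservable.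

(** With d = gn - g, subtracting the two Euler equations tested with d gives alpha |d|^2 + |Gn L
    d|^2 = Re ((Gs - Gns) G y, L d) + Re ((G - Gn) y, Gn L d). The operator errors act only on y and
    G y, which do not depend on n, so strong convergence suffices. *)
Lemma optimal_pair_diff (G Gs Gn Gns : V -> V) (K : set Z) (e : V) g y gn yn :
  bounded_op Y Y G -> is_adjoint Y G Gs ->
  bounded_op Y Y Gn -> is_adjoint Y Gn Gns ->
  (forall x, hdom Y x -> hnorm Y (Gn x) <= M * hnorm Y x) ->
  K `<=` hdom H -> (forall g h, K g -> K h -> K (g - h)) -> hdom Y e ->
  optimal_pair G K e g y -> optimal_pair Gn K e gn yn ->
  alpha * hnorm H (gn - g) <=
    C * (M * hnorm Y (Gn y - G y) + hnorm Y (Gns (G y) - Gs (G y))).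
Proof.
move=> hG hGs hGn hGns hM KH KB de [Kg dy yE eu] [Kgn dyn ynE eun].
set d := gn - g; have Kd : K d by exact: KB.
have dg := KH _ Kg; have dgn := KH _ Kgn; have dd := KH _ Kd.
have dLd := bop_dom hL dd; have dLg := bop_dom hL dg; have dLgn := bop_dom hL dgn.
have dGy := bop_dom hG dy; have dGnyn := bop_dom hGn dyn.
have dGny := bop_dom hGn dy.
have dGLd := bop_dom hG dLd; have dGnLd := bop_dom hGn dLd.
have dyL : hdom Y (y + L d) by hilb.
have ynE' : heq Y yn (y + L d).
  have de1 : hdom Y (e + L gn) by hilb.
  have de2 : hdom Y (e + L g) by hilb.
  apply: (heqP hY) => // z dz.
  rewrite (heq_rip hY dyn de1 dz ynE); rip; rewrite (heq_rip hY dy de2 dz yE).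
  rip; rewrite (heq_rip hY dLd _ dz (bop_sub hL dgn dg)); last by hilb.
  by rip; ring.
have e1 : rip Y (Gn yn) (Gn (L d)) =
    rip Y (Gn y) (Gn (L d)) + rip Y (Gn (L d)) (Gn (L d)).
  rewrite (heq_rip hY dGnyn (bop_dom hGn dyL) dGnLd (bop_heq hY hY hGn dyn dyL ynE')).
  have -> : y + L d = 1%:C *: y + L d by rewrite scale1r.
  by rewrite (bop_ripl hY hY hGn)// mul1r.
have [ds adj] := hGs; have [dns adjn] := hGns.
have dsG := ds _ dGy; have dnsG := dns _ dGy.
have a1 : rip Y (G y) (G (L d)) = rip Y (Gs (G y)) (L d).
  by rewrite (ripC hY dGy dGLd) /rip adj// -/(rip _ _ _) (ripC hY dLd dsG).
have a2 : rip Y (G y) (Gn (L d)) = rip Y (Gns (G y)) (L d).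
  by rewrite (ripC hY dGy dGnLd) /rip adjn// -/(rip _ _ _) (ripC hY dLd dnsG).
have e2 : alpha * hnorm H d ^+ 2 + hnorm Y (Gn (L d)) ^+ 2 =
    rip Y (Gs (G y) - Gns (G y)) (L d) + rip Y (G y - Gn y) (Gn (L d)).
  rewrite !sqr_hnorm//; have := eu d Kd; have := eun d Kd; rewrite e1 a1.
  have -> : rip H d d = rip H gn d - rip H g d by rewrite {1}/d; rip.
  by rip; rewrite a2; lra.
have b1 : rip Y (Gs (G y) - Gns (G y)) (L d) <=
    hnorm Y (Gns (G y) - Gs (G y)) * (C * hnorm H d).
  rewrite -(hnormB_sym hY)//; apply: le_trans (rip_le hY _ dLd) _; first by hilb.
  by rewrite ler_wpM2l ?hnorm_ge0// hC.
have b2 : rip Y (G y - Gn y) (Gn (L d)) <=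
    hnorm Y (Gn y - G y) * (M * (C * hnorm H d)).
  rewrite -(hnormB_sym hY)//; apply: le_trans (rip_le hY _ dGnLd) _; first by hilb.
  rewrite ler_wpM2l ?hnorm_ge0//; apply: le_trans (hM _ dLd) _.
  by rewrite ler_wpM2l// hC.
have [->|dn0] := eqVneq (hnorm H d) 0.
  by rewrite mulr0 mulr_ge0// addr_ge0 ?mulr_ge0 ?hnorm_ge0.
have dp : 0 < hnorm H d by rewrite lt_neqAle eq_sym dn0 hnorm_ge0.
rewrite -(ler_pM2r dp); have := sqr_ge0 (hnorm Y (Gn (L d))); lra.
Qed.

(** * Continuity of the optimal final state in the initial time; [chi s] is the projection onto
    controls supported in (s, T) *)

Section Continuity.
Variables (T : R) (chi : R -> Z -> Z).
Hypothesis chi_dom : forall s g, hdom H g -> hdom H (chi s g).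
Hypothesis chi_sub : forall s g h, chi s (g - h) = chi s g - chi s h.
Hypothesis chi_rip : forall s g h, hdom H g -> hdom H h ->
  rip H (chi s g) h = rip H g (chi s h).
Hypothesis chi_comp : forall s t g, s <= t -> chi s (chi t g) = chi t g.
Hypothesis small : forall q, hdom Y q -> forall e : R, 0 < e ->
  exists2 d : R, 0 < d & forall g s t, hdom H g ->
    0 <= s -> s <= t -> t <= T -> t - s < d -> chi s g = g ->
    `|rip Y (L (g - chi t g)) q| <= e * hnorm H (g - chi t g).

(** A symmetric idempotent does not increase norms: |chi g|^2 = Re (g, chi g). *)
Lemma chi_norm s g : hdom H g -> hnorm H (chi s g) <= hnorm H g.
Proof.
move=> dg; have dc := chi_dom s dg.
have [->|n0] := eqVneq (hnorm H (chi s g)) 0; first exact: hnorm_ge0.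
have np : 0 < hnorm H (chi s g) by rewrite lt_neqAle eq_sym n0 hnorm_ge0.
rewrite -(ler_pM2l np) -expr2 sqr_hnorm// chi_rip// chi_comp// ripC//.
exact: (rip_le hH).
Qed.

Definition window s : set Z := [set g | hdom H g /\ chi s g = g].

Lemma window_dom s : window s `<=` hdom H.
Proof. by move=> ? []. Qed.

Lemma windowB s g h : window s g -> window s h -> window s (g - h).
Proof. by move=> [dg cg] [dh ch]; split; [hilb|rewrite chi_sub cg ch]. Qed.

Variables (G Gs : V -> V) (S : R -> V -> V) (x : V).
Hypothesis hG : bounded_op Y Y G.
Hypothesis hM : forall x, hdom Y x -> hnorm Y (G x) <= M * hnorm Y x.
Hypothesis hGs : is_adjoint Y G Gs.
Hypothesis Sd : forall t, 0 <= t -> hdom Y (S t x).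
Hypothesis Sn : forall t, 0 <= t -> hnorm Y (S t x) <= hnorm Y x.
Hypothesis Sc : forall e : R, 0 < e -> exists2 d : R, 0 < d &
  forall t q, 0 <= t -> 0 <= q -> `|q - t| < d -> hnorm Y (S q x - S t x) < e.
Variables (g : R -> Z) (y : R -> V).
Hypothesis opt : forall s, 0 <= s <= T ->
  optimal_pair G (window s) (S (T - s) x) (g s) (y s).

Let Ts s : 0 <= s <= T -> 0 <= T - s.
Proof. by case/andP => _; rewrite subr_ge0. Qed.

Let g_le s : 0 <= s <= T -> hnorm H (g s) <= M / Num.sqrt alpha * hnorm Y x.
Proof.
move=> sT; have [_] := optimal_pair_bound hG hM (@window_dom s) (Sd (Ts sT)) (opt sT).
move/le_trans; apply; rewrite ler_wpM2l ?Sn ?Ts//.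
by rewrite divr_ge0 ?sqrtr_ge0.
Qed.

Let Gy_le s : 0 <= s <= T -> hnorm Y (G (y s)) <= M * hnorm Y x.
Proof.
move=> sT; have [+ _] := optimal_pair_bound hG hM (@window_dom s) (Sd (Ts sT)) (opt sT).
by move/le_trans; apply; rewrite ler_wpM2l ?Sn ?Ts.
Qed.

(* Testing both Euler equations with d = g(t) - g(s) and subtracting. *)
Lemma optimal_pair_shift s t : 0 <= s -> s <= t -> t <= T ->
  let d := g t - g s in
  [/\ hdom H d, chi s d = d,
    alpha * hnorm H d ^+ 2 <=
    M * (M * hnorm Y (S (T - t) x - S (T - s) x)) * (C * hnorm H d) +
      rip Y (L (d - chi t d)) (Gs (G (y t))) &
    hnorm Y (y t - y s) <= hnorm Y (S (T - t) x - S (T - s) x) + C * hnorm H d].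
Proof.
move=> s0 st tT d.
have sT : 0 <= s <= T by rewrite s0 (le_trans st).
have tT' : 0 <= t <= T by rewrite tT (le_trans s0).
have [[dgs cgs] dys ysE eus] := opt sT; have [[dgt cgt] dyt ytE eut] := opt tT'.
have dSs := Sd (Ts sT); have dSt := Sd (Ts tT').
set p := S (T - t) x - S (T - s) x; have dp : hdom Y p by rewrite /p; hilb.
have dd : hdom H d by rewrite /d; hilb.
have cd : chi s d = d by rewrite /d chi_sub cgs -cgt chi_comp.
have dc := chi_dom t dd.
set d1 := d - chi t d; have dd1 : hdom H d1 by rewrite /d1; hilb.
have dL1 := bop_dom hL dd1; have dLd := bop_dom hL dd; have dLc := bop_dom hL dc.
have dLs := bop_dom hL dgs; have dLt := bop_dom hL dgt.
have dGs := bop_dom hG dys; have dGt := bop_dom hG dyt.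
have dGd := bop_dom hG dLd; have dGc := bop_dom hG dLc; have dG1 := bop_dom hG dL1.
have dGp := bop_dom hG dp.
have yE : heq Y (y t - y s) (p + L d).
  have de1 : hdom Y (S (T - s) x + L (g s)) by hilb.
  have de2 : hdom Y (S (T - t) x + L (g t)) by hilb.
  apply: (heqP hY); [by hilb|by hilb|] => z dz; rip.
  rewrite (heq_rip hY dys de1 dz ysE) (heq_rip hY dyt de2 dz ytE); rip.
  rewrite (heq_rip hY dLd _ dz (bop_sub hL dgt dgs)); last by hilb.
  by rewrite /p; rip; ring.
split => //.
- have e1 := eus d (conj dd cd).
  (* At time t only [chi t d] is an admissible test, whereas d is admissible at s. The part d1 that
     is left over produces the term with [Gs (G (y t))]; it is invisible to [g t], which is fixed by
     [chi t]. *)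
  have e2 : alpha * rip H (g t) (chi t d) + rip Y (G (y t)) (G (L (chi t d))) = 0.
    by apply: eut; split; [exact: chi_dom|rewrite chi_comp].
  have e3 : rip H (g t) (chi t d) = rip H (g t) d by rewrite -chi_rip// cgt.
  have e4 : rip Y (G (y t)) (G (L (chi t d))) =
      rip Y (G (y t)) (G (L d)) - rip Y (G (y t)) (G (L d1)).
    have h1 : heq Y (L d1) (L d - L (chi t d)) by exact: (bop_sub hL dd dc).
    have dLL : hdom Y (L d - L (chi t d)) by hilb.
    have h2 := bop_heq hY hY hG dL1 dLL h1.
    rewrite (ripC hY dGt dG1) (heq_rip hY dG1 (bop_dom hG dLL) dGt h2).
    rewrite (heq_rip hY (bop_dom hG dLL) _ dGt (bop_sub hG dLd dLc)); last by hilb.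
    by rip; rewrite (ripC hY dGd dGt) (ripC hY dGc dGt); ring.
  have e5 : rip Y (G (y t)) (G (L d)) - rip Y (G (y s)) (G (L d)) =
      rip Y (G p) (G (L d)) + rip Y (G (L d)) (G (L d)).
    have dyy : hdom Y (y t - y s) by hilb.
    have dpL : hdom Y (p + L d) by hilb.
    have h2 := bop_heq hY hY hG dyy dpL yE.
    have h3 := bop_sub hG dyt dys.
    have dGG : hdom Y (G (y t) - G (y s)) by hilb.
    transitivity (rip Y (G (y t) - G (y s)) (G (L d))); first by rip.
    rewrite -(heq_rip hY (bop_dom hG dyy) dGG dGd h3).
    rewrite (heq_rip hY (bop_dom hG dyy) (bop_dom hG dpL) dGd h2).
    have -> : p + L d = 1%:C *: p + L d by rewrite scale1r.
    by rewrite (bop_ripl hY hY hG)// mul1r.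
  have e6 : rip Y (G (y t)) (G (L d1)) = rip Y (L d1) (Gs (G (y t))).
    by rewrite (ripC hY dGt dG1) /rip; case: hGs => _ ->.
  have e7 : rip H d d = rip H (g t) d - rip H (g s) d by rewrite {1}/d; rip.
  have e8 : alpha * hnorm H d ^+ 2 + hnorm Y (G (L d)) ^+ 2 =
      - rip Y (G p) (G (L d)) + rip Y (L d1) (Gs (G (y t))).
    by rewrite !sqr_hnorm// -e6 e7; rewrite e3 e4 in e2; lra.
  have b1 : - rip Y (G p) (G (L d)) <= M * (M * hnorm Y p) * (C * hnorm H d).
    have -> : - rip Y (G p) (G (L d)) = rip Y (- G p) (G (L d)) by rip.
    apply: le_trans (rip_le hY _ dGd) _; first by hilb.
    rewrite (hnormN hY)//.
    apply: (@le_trans _ _ ((M * hnorm Y p) * (M * (C * hnorm H d)))).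
      apply: ler_pM; rewrite ?hnorm_ge0 ?hM//.
      by apply: le_trans (hM dLd) _; rewrite ler_wpM2l ?hC.
    by rewrite le_eqVlt; apply/orP; left; apply/eqP; ring.
  by have := sqr_ge0 (hnorm Y (G (L d))); lra.
- rewrite (heq_hnorm hY _ _ yE); [|by hilb|by hilb].
  apply: le_trans (ler_hnormD hY dp dLd) _.
  by rewrite lerD2l hC.
Qed.

(* Testing the Euler equation at s with the part of g(s) living on ]s, t]. *)
Lemma optimal_pair_gap s t : 0 <= s -> s <= t -> t <= T ->
  let d := g t - g s in let d1 := d - chi t d in
  alpha * hnorm H d1 ^+ 2 = rip Y (L d1) (Gs (G (y s))).
Proof.
move=> s0 st tT d d1.
have sT : 0 <= s <= T by rewrite s0 (le_trans st).
have tT' : 0 <= t <= T by rewrite tT (le_trans s0).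
have [[dgs cgs] dys ysE eus] := opt sT; have [[dgt cgt] dyt ytE eut] := opt tT'.
have dc := chi_dom t dgs; set k := g s - chi t (g s).
have dk : hdom H k by rewrite /k; hilb.
(* [g t] is fixed by [chi t], so it cancels from d1 and only the part of [g s] before t remains. *)
have d1E : d1 = - k.
  by rewrite /d1 /d chi_sub cgt /k opprB opprB addrC addrA subrK.
have dd1 : hdom H d1 by rewrite d1E; hilb.
have cd1 : chi s d1 = d1.
  by rewrite /d1 /d !chi_sub !chi_comp// cgs -cgt chi_comp.
have ctd : chi t d1 = 0 by rewrite /d1 chi_sub chi_comp// subrr.
clearbody d1; have := eus d1 (conj dd1 cd1).
have dGy := bop_dom hG dys; have dL1 := bop_dom hL dd1.
have dG1 := bop_dom hG dL1.
have -> : rip Y (G (y s)) (G (L d1)) = rip Y (L d1) (Gs (G (y s))).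
  by rewrite (ripC hY dGy dG1) /rip; case: hGs => _ ->.
have -> : rip H (g s) d1 = - rip H d1 d1.
  have -> : rip H (g s) d1 = rip H k d1 + rip H (chi t (g s)) d1.
    by rewrite /k; rip; rewrite subrK.
  have -> : rip H (chi t (g s)) d1 = 0.
    rewrite chi_rip// ctd.
    by rewrite ripC// ?(rip_null hH) ?hnorm0//; hilb.
  by rewrite addr0 {1}d1E d1E; rip; rewrite opprK.
by rewrite sqr_hnorm// => h; lra.
Qed.

Lemma optimal_state_continuous : continuous_in_time Y 0 T y.
Proof.
move=> r rT; have [[dgr cgr] dyr _ _] := opt rT; split => // e e0.
have dGy := bop_dom hG dyr; have dq : hdom Y (Gs (G (y r))) by case: hGs => h _; exact: h.
(* D bounds |g t - g s| for all s and t, by the a priori bound on optimal controls. *)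
pose D := 2 * (M / Num.sqrt alpha * hnorm Y x) + 1.
have Mx : 0 <= M / Num.sqrt alpha * hnorm Y x.
  by rewrite mulr_ge0 ?divr_ge0 ?sqrtr_ge0 ?hnorm_ge0.
have D0 : 0 < D by rewrite /D; lra.
(* The target for |d|: it makes C |d| < e/2. Below, B is half of alpha rho^2, one half for each term
   in the bound on alpha |d|^2. *)
pose rho := e / 2 / (C + 1).
have C1 : 0 < C + 1 by rewrite ltr_wpDl.
have rho0 : 0 < rho by rewrite !divr_gt0.
pose B := alpha * rho ^+ 2 / 2.
have B0 : 0 < B by rewrite /B divr_gt0// mulr_gt0// exprn_gt0.
(* K exceeds both 2 D, needed when r is the right end, and M^2 |x| C / alpha, needed when r is the
   left end; the factor B / K then yields less than B in either case. *)
pose K := M * (M * hnorm Y x) * C / alpha + 2 * D + 1.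
have K0 : 0 < K.
  rewrite /K; have : 0 <= M * (M * hnorm Y x) * C / alpha.
    by rewrite divr_ge0 ?(ltW alpha0)// !mulr_ge0 ?hnorm_ge0.
  by lra.
have [d1 d10 h1] := small dq (divr_gt0 B0 K0).
have den0 : 0 < M * M * C * D + 1.
  by apply: ltr_wpDl => //; rewrite !mulr_ge0// ltW.
(* The first bound makes the free evolutions differ by less than e/2 in the state; the second makes
   their contribution to alpha |d|^2 less than B. *)
have p1 : 0 < Num.min (e / 2) (B / (M * M * C * D + 1)).
  by rewrite lt_min; apply/andP; split; apply: divr_gt0.
have [d2 d20 h2] := Sc p1.
exists (Num.min d1 d2); first by rewrite lt_min d10.
(* The estimates need s <= t, while the point r may be either end. *)
suff main s t : 0 <= s -> s <= t -> t <= T -> (s = r \/ t = r) ->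
    t - s < Num.min d1 d2 -> hnorm Y (y t - y s) < e.
  move=> q qT; have [dyq _] : hdom Y (y q) /\ True by case: (opt qT).
  have [/andP[q0 qT'] /andP[r0 rT']] := (qT, rT).
  have [qr|/ltW rq] := leP q r.
    rewrite (hnormB_sym hY)// ler0_norm ?subr_le0// opprB => h.
    by apply: main => //; right.
  by rewrite ger0_norm ?subr_ge0// => h; apply: main => //; left.
move=> s0 st tT str; rewrite lt_min => /andP[ts1 ts2].
have sT : 0 <= s <= T by rewrite s0 (le_trans st).
have tT' : 0 <= t <= T by rewrite tT (le_trans s0).
have [dd cd hd hy] := optimal_pair_shift s0 st tT.
have gap := optimal_pair_gap s0 st tT; move: gap hd hy dd cd => /=.
set d := g t - g s; set p := S _ _ - S _ _; set k := d - chi t d.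
move=> gap hd hy dd cd.
have := h2 (T - s) (T - t) (Ts sT) (Ts tT').
rewrite -/p opprB addrC addrA subrK distrC ger0_norm ?subr_ge0// => /(_ ts2).
rewrite lt_min => /andP[pe pB].
have dc := chi_dom t dd; have dk : hdom H k by rewrite /k; hilb.
have dLk := bop_dom hL dk.
have [[dgs _] dys _ _] := opt sT; have [[dgt _] dyt _ _] := opt tT'.
have dD : hnorm H d <= D.
  apply: le_trans (ler_hnormB hH dgt dgs) _.
  by have := g_le sT; have := g_le tT'; rewrite /D; lra.
have hk := h1 d s t dd s0 st tT ts1 cd.
have r_le : rip Y (L k) (Gs (G (y t))) < B.
  have KE : B / K * K = B by rewrite mulrVK// unitfE gt_eqF.
  case: str => [sr|tr].
    (* near s = r: the gap identity makes d - chi t d small in norm *)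
    have dGt := bop_dom hG dyt; have [dGsd _] := hGs.
    have dqt := dGsd _ dGt.
    have kn : alpha * hnorm H k <= B / K.
      have [->|k0] := eqVneq (hnorm H k) 0; first by rewrite mulr0 divr_ge0 ?ltW.
      have kp : 0 < hnorm H k by rewrite lt_neqAle eq_sym k0 hnorm_ge0.
      rewrite -(ler_pM2r kp) -mulrA -expr2 gap sr.
      by apply: le_trans hk; exact: ler_norm.
    apply: le_lt_trans (rip_le hY dLk dqt) _.
    have q_le : hnorm Y (Gs (G (y t))) <= M * (M * hnorm Y x).
      apply: le_trans (adjoint_bound hGs (bop_dom hG) hM dGt) _.
      by rewrite ler_wpM2l// Gy_le.
    apply: (@le_lt_trans _ _ (C * (B / K / alpha) * (M * (M * hnorm Y x)))).
      apply: ler_pM; rewrite ?hnorm_ge0//; apply: le_trans (hC dk) _.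
      by rewrite ler_wpM2l// ler_pdivlMr// mulrC.
    rewrite -[ltRHS]KE.
    have -> : C * (B / K / alpha) * (M * (M * hnorm Y x)) =
        B / K * (M * (M * hnorm Y x) * C / alpha) by ring.
    rewrite ltr_pM2l; last exact: divr_gt0.
    by rewrite /K; move: (M * _ * _ / _) => u; lra.
  rewrite tr; apply: le_lt_trans (ler_norm _) _; apply: le_lt_trans hk _.
  have hk2 : hnorm H k <= 2 * D.
    apply: le_trans (ler_hnormB hH dd dc) _.
    by have := chi_norm t dd; lra.
  rewrite -[ltRHS]KE ltr_pM2l; last exact: divr_gt0.
  apply: le_lt_trans hk2 _; rewrite /K.
  have : 0 <= M * (M * hnorm Y x) * C / alpha.
    by rewrite divr_ge0 ?(ltW alpha0)// !mulr_ge0 ?hnorm_ge0.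
  by move: (M * _ * _ / _) => u; lra.
have hd2 : alpha * hnorm H d ^+ 2 < alpha * rho ^+ 2.
  apply: le_lt_trans hd _.
  have b1 : M * (M * hnorm Y p) * (C * hnorm H d) <= M * M * C * D * hnorm Y p.
    have -> : M * M * C * D * hnorm Y p = M * (M * hnorm Y p) * (C * D) by ring.
    by rewrite ler_wpM2l ?mulr_ge0 ?hnorm_ge0// ler_wpM2l.
  move: pB; rewrite ltr_pdivlMr// => pB.
  have BE : alpha * rho ^+ 2 = B + B by rewrite /B; lra.
  rewrite BE; have := hnorm_ge0 Y p; move: b1 pB r_le.
  by rewrite [hnorm Y p * _]mulrC mulrDl; lra.
move: hd2; rewrite ltr_pM2l// ltr_pXn2r// ?nnegrE ?hnorm_ge0 ?(ltW rho0)// => hd2.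
apply: le_lt_trans hy _.
have rE : (C + 1) * rho = e / 2 by rewrite /rho; field; rewrite gt_eqF.
have : C * hnorm H d <= C * rho by rewrite ler_wpM2l// ltW.
by move: rE; rewrite mulrDl; lra.
Qed.

End Continuity.

End OptimalPairs.

(** * Yosida approximation *)

Section YosidaApproximation.
Variables (R : realType) (V : lmodType R[i]) (Y : hspace V).
Hypothesis hY : pre_hilbert Y.
Variables (A : V -> V -> Prop) (S : R -> V -> V) (Res : nat -> V -> V).
Hypothesis hS : generates_contraction_semigroup Y A S.
Hypothesis dA : hdense Y (gdom A).
Hypothesis hRes : forall n, (0 < n)%N -> is_resolvent Y A (n%:R : R[i]) (Res n).

Definition yosida n x : V := (n%:R : R[i]) *: Res n x.

Lemma yosida_real n x : yosida n x = (n%:R : R)%:C *: Res n x.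
Proof. by rewrite /yosida rmorph_nat. Qed.

Lemma resolvent_dom n x : (0 < n)%N -> hdom Y x -> hdom Y (Res n x).
Proof. by move=> /hRes[h _ _]; exact: (bop_dom h). Qed.

Lemma yosida_dom n x : (0 < n)%N -> hdom Y x -> hdom Y (yosida n x).
Proof. by move=> n0 dx; rewrite /yosida; have := resolvent_dom n0 dx; hilb => dr; hilb. Qed.

(** For u = [Res n x] and w = A u, dissipativity gives n |u|^2 <= Re (n u - w, u) = Re (x, u) <= |x|
    |u|. *)
Lemma resolvent_le n x : (0 < n)%N -> hdom Y x ->
  n%:R * hnorm Y (Res n x) <= hnorm Y x.
Proof.
move=> n0 dx; have du := resolvent_dom n0 dx.
have [_ /(_ x dx)[w Aw ew] _] := hRes n0; have [_ dw] := A_dom hS Aw.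
have [->|u0] := eqVneq (hnorm Y (Res n x)) 0; first by rewrite mulr0 hnorm_ge0.
have up : 0 < hnorm Y (Res n x) by rewrite lt_neqAle eq_sym u0 hnorm_ge0.
have ds : hdom Y (n%:R *: Res n x - w) by hilb.
rewrite -(ler_pM2r up) -mulrA -expr2 sqr_hnorm//.
apply: le_trans (rip_le hY dx du); rewrite -(heq_rip hY ds dx du ew).
have -> : (n%:R : R[i]) = (n%:R : R)%:C by rewrite rmorph_nat.
by rip; have := A_dissipative hY hS Aw; lra.
Qed.

Lemma yosida_le n x : (0 < n)%N -> hdom Y x -> hnorm Y (yosida n x) <= hnorm Y x.
Proof.
move=> n0 dx; rewrite yosida_real hnormZr//; last exact: resolvent_dom.
by rewrite ger0_norm// resolvent_le.
Qed.

Lemma yosida_bop n : (0 < n)%N -> bounded_op Y Y (yosida n).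
Proof.
move=> n0; have [hb _ _] := hRes n0; split.
- by move=> x; exact: yosida_dom.
- move=> a x y dx dy; have dRx := resolvent_dom n0 dx; have dRy := resolvent_dom n0 dy.
  have dxy : hdom Y (a *: x + y) by hilb.
  have dRxy := resolvent_dom n0 dxy.
  apply: (heqP hY); [exact: yosida_dom|by rewrite /yosida; hilb|] => z dz.
  have -> : a *: yosida n x + yosida n y =
      (n%:R : R)%:C *: (a *: Res n x + Res n y).
    by rewrite !yosida_real scalerDr !scalerA mulrC.
  rewrite yosida_real ripZl// [RHS]ripZl//; last by hilb.
  by rewrite (heq_rip hY _ _ dz (bop_lin hb a dx dy))//; hilb.
- by exists 1 => x dx; rewrite mul1r yosida_le.
Qed.

(** On the domain of A, J_n u - u = (n I - A)^-1 A u, whose norm is at most |A u| / n. Density and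
    contractivity extend the convergence to every x, with one third of e for each of the three
    differences. *)
Lemma yosida_cvg x : hdom Y x -> forall e : R, 0 < e ->
  \forall n \near \oo, hnorm Y (yosida n x - x) < e.
Proof.
move=> dx e e0; have e3 : 0 < e / 3 by rewrite divr_gt0.
have [u [w Auw] xu] := dA dx e3; have [du dw] := A_dom hS Auw.
near=> n.
have n0 : (0 < n)%N by near: n; exact: nbhs_infty_gt.
have nw : hnorm Y w / (e / 3) < n%:R.
  near: n; exact: nbhs_infty_gtr.
have dRw := resolvent_dom n0 dw; have dJu := yosida_dom n0 du.
have dJx := yosida_dom n0 dx; have dRu := resolvent_dom n0 du.
have b1 : hnorm Y (yosida n u - u) < e / 3.
  have [hb _ hr] := hRes n0; have := hr _ _ Auw.
  set ru := Res n (n%:R *: u - w) => er.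
  have dru : hdom Y ru by apply: resolvent_dom => //; hilb.
  rewrite (@heq_hnorm _ _ _ hY _ (Res n w)); [|by hilb|exact: dRw|].
    rewrite -(@ltr_pM2l _ n%:R) ?ltr0n//.
    apply: le_lt_trans (resolvent_le n0 dw) _.
    by rewrite -ltr_pdivrMr// mulrC.
  apply: (heqP hY) => //; first by hilb.
  move=> z dz; rip; rewrite -(heq_rip hY dru du dz er) /ru.
  have e1 : heq Y (Res n (n%:R *: u - w)) (n%:R *: Res n u - Res n w).
    have := bop_lin hb (n%:R) du (hdomN hY dw).
    have dnu : hdom Y (n%:R *: Res n u) by hilb.
    have dRn : hdom Y (Res n (- w)) by apply: resolvent_dom => //; hilb.
    have eN : heq Y (Res n (- w)) (- Res n w).
      have := bop_sub hb (hdom0 hY) dw; rewrite sub0r => h1.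
      have dR0 := resolvent_dom n0 (hdom0 hY).
      apply: (heqP hY) => //; first by hilb.
      move=> v dv; rewrite (heq_rip hY dRn _ dv h1); last by hilb.
      rip; rewrite (rip_null hY dR0 dv) ?sub0r//.
      by apply: (bop_null hb); [exact: hdom0|exact: hnorm0].
    move=> h; apply: (heqP hY) => //; first by hilb.
    move=> v dv; rewrite (heq_rip hY dru _ dv h); last by hilb.
    by rip; rewrite (heq_rip hY dRn _ dv eN); [rip|hilb].
  rewrite (heq_rip hY dru _ dz e1); last by hilb.
  by rewrite /yosida; rip; ring.
have b2 : hnorm Y (yosida n x - yosida n u) <= hnorm Y (x - u).
  rewrite -[leRHS]mul1r; apply: (bop_dist hY hY (yosida_bop n0)) => // v dv.
  by rewrite mul1r yosida_le.
apply: (le_lt_trans (ler_hnorm_via hY dJx dx dJu)).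
apply: (@le_lt_trans _ _ (e / 3 + (hnorm Y (yosida n u - u) + hnorm Y (u - x)))).
  by apply: lerD; [exact: le_trans b2 (ltW xu)|exact: ler_hnorm_via].
by move: xu; rewrite (hnormB_sym hY dx du); lra.
Unshelve. all: by end_near. Qed.

(** * The observations G J_n and their adjoints *)

Section Observation.
Variables (G Gs : V -> V) (M : R).
Hypothesis hG : bounded_op Y Y G.
Hypothesis hGs : is_adjoint Y G Gs.
Hypothesis hM : forall x, hdom Y x -> hnorm Y (G x) <= M * hnorm Y x.
Hypothesis M0 : 0 <= M.
Variable Gns : nat -> V -> V.
Hypothesis hGns : forall n, (0 < n)%N -> is_adjoint Y (fun y => G (yosida n y)) (Gns n).

Lemma observation_bop n : (0 < n)%N -> bounded_op Y Y (fun y => G (yosida n y)).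
Proof. by move=> n0; exact: bop_comp hY hY hY (yosida_bop n0) hG. Qed.

Lemma observation_le n x : (0 < n)%N -> hdom Y x ->
  hnorm Y (G (yosida n x)) <= M * hnorm Y x.
Proof.
move=> n0 dx; apply: le_trans (hM (yosida_dom n0 dx)) _.
by rewrite ler_wpM2l// yosida_le.
Qed.

Lemma observation_cvg x : hdom Y x -> forall e : R, 0 < e ->
  \forall n \near \oo, hnorm Y (G (yosida n x) - G x) < e.
Proof.
move=> dx e e0; have M1 : 0 < M + 1 by rewrite ltr_wpDl.
have h := yosida_cvg dx (divr_gt0 e0 M1); near=> n.
have n0 : (0 < n)%N by near: n; exact: nbhs_infty_gt.
have dJ := yosida_dom n0 dx.
apply: (le_lt_trans (bop_dist hY hY hG hM dJ dx)).
have hn : hnorm Y (yosida n x - x) < e / (M + 1) by near: n; exact: h.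
move: hn; rewrite ltr_pdivlMr// => hn; apply: le_lt_trans hn.
by rewrite [leRHS]mulrC ler_wpM2r ?hnorm_ge0// lerDl.
Unshelve. all: by end_near. Qed.

(* (G J_n)* w = J_n* G* w with J_n a contraction, so the argument for the strong
   continuity of the adjoint semigroup applies. *)
Lemma adjoint_observation_cvg w : hdom Y w -> forall e : R, 0 < e ->
  \forall n \near \oo, hnorm Y (Gns n w - Gs w) < e.
Proof.
move=> dw e e0; have [ds adj] := hGs; have dv := ds w dw; set v := Gs w.
have p : 0 < hnorm Y v + 1 by rewrite ltr_wpDl ?hnorm_ge0.
have e1 : 0 < e ^+ 2 / (2 * (hnorm Y v + 1)).
  by rewrite divr_gt0 ?exprn_gt0 ?mulr_gt0.
have h := yosida_cvg dv e1; near=> n.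
have n0 : (0 < n)%N by near: n; exact: nbhs_infty_gt.
have [dns adjn] := hGns n0; have du := dns w dw; set u := Gns n w.
have dJu := yosida_dom n0 du; have dJv := yosida_dom n0 dv.
have dGJu := bop_dom hG dJu; have dGJv := bop_dom hG dJv.
have key x : hdom Y x -> rip Y x u = rip Y (yosida n x) v.
  move=> dx; have dJ := yosida_dom n0 dx.
  by rewrite /rip -adj// -adjn.
have uv : hnorm Y u <= hnorm Y v.
  have [->|u0] := eqVneq (hnorm Y u) 0; first exact: hnorm_ge0.
  have up : 0 < hnorm Y u by rewrite lt_neqAle eq_sym u0 hnorm_ge0.
  rewrite -(ler_pM2l up) -expr2 sqr_hnorm// key//.
  apply: le_trans (rip_le hY dJu dv) _.
  by rewrite ler_wpM2r ?hnorm_ge0// yosida_le.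
have hn : hnorm Y (yosida n v - v) < e ^+ 2 / (2 * (hnorm Y v + 1)).
  by near: n; exact: h.
rewrite -(@ltr_pXn2r _ 2)// ?nnegrE ?hnorm_ge0 ?ltW//.
(* Expand the square: |u| <= |v|, and [key] gives Re (v, u) = Re (J_n v, v). *)
have b1 : hnorm Y (u - v) ^+ 2 <= 2 * rip Y (v - yosida n v) v.
  rewrite sqr_hnorm; [|exact: hY|by hilb].
  rip; rewrite (ripC hY du dv) (key v dv) -!sqr_hnorm//.
  have : hnorm Y u ^+ 2 <= hnorm Y v ^+ 2 by rewrite ler_pXn2r ?nnegrE ?hnorm_ge0.
  lra.
have b2 : rip Y (v - yosida n v) v <= hnorm Y (yosida n v - v) * hnorm Y v.
  by rewrite -(hnormB_sym hY)//; apply: (rip_le hY) => //; hilb.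
apply: (le_lt_trans b1).
have b3 : hnorm Y (yosida n v - v) * hnorm Y v <=
    hnorm Y (yosida n v - v) * (hnorm Y v + 1).
  by rewrite ler_wpM2l ?hnorm_ge0// lerDl.
move: hn; rewrite ltr_pdivlMr ?mulr_gt0//; lra.
Unshelve. all: by end_near. Qed.

End Observation.
End YosidaApproximation.

(** Equi-Lipschitz maps that converge pointwise converge uniformly on the compact image of a
    continuous curve. The index n = 0 is excluded because nothing is assumed about the resolvent
    there. *)
Lemma cvg_on_curve (R : realType) (V : lmodType R[i]) (Y : hspace V) (T K : R)
    (F : nat -> V -> V) (F0 : V -> V) (y : R -> V) : pre_hilbert Y ->
  0 <= K -> (forall x, hdom Y x -> hdom Y (F0 x)) ->
  (forall n x, (0 < n)%N -> hdom Y x -> hdom Y (F n x)) ->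
  (forall x z, hdom Y x -> hdom Y z -> hnorm Y (F0 x - F0 z) <= K * hnorm Y (x - z)) ->
  (forall n x z, (0 < n)%N -> hdom Y x -> hdom Y z ->
    hnorm Y (F n x - F n z) <= K * hnorm Y (x - z)) ->
  (forall x, hdom Y x -> forall e : R, 0 < e ->
    \forall n \near \oo, hnorm Y (F n x - F0 x) < e) ->
  continuous_in_time Y 0 T y ->
  forall e : R, 0 < e -> \forall n \near \oo,
    forall t, 0 <= t <= T -> hnorm Y (F n (y t) - F0 (y t)) < e.
Proof.
move=> hY K0 d0 dn l0 ln pw cy e e0.
have K1 : 0 < K + 1 by rewrite ltr_wpDl.
have e3 : 0 < e / 3 by rewrite divr_gt0.
(* In this form compactness glues estimates that hold jointly near each time t and for large n into
   one valid on all of [0, T]. *)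
have /compact_near_coveringP cpt := @segment_compact R 0 T.
have := cpt nat \oo (fun n t => 0 <= t <= T -> hnorm Y (F n (y t) - F0 (y t)) < e) _.
have h t : `[0, T]%classic t -> \forall t' \near t & n \near \oo,
    0 <= t' <= T -> hnorm Y (F n (y t') - F0 (y t')) < e.
  rewrite /= in_itv/= => tT; have [dy hy] := cy t tT.
  have [d dp hd] := hy _ (divr_gt0 e3 K1).
  near=> t' n => t'T.
  have n0 : (0 < n)%N by near: n; exact: nbhs_infty_gt.
  have [dy' _] := cy t' t'T.
  have b1 : hnorm Y (y t' - y t) < e / 3 / (K + 1).
    apply: hd => //; near: t'; exists d => //= q /=; by rewrite distrC.
  have b2 : hnorm Y (F n (y t) - F0 (y t)) < e / 3 by near: n; exact: pw.
  have Kb : K * hnorm Y (y t' - y t) <= e / 3.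
    move: b1; rewrite ltr_pdivlMr// => /ltW; apply: le_trans.
    by rewrite [leRHS]mulrC ler_wpM2r ?hnorm_ge0// lerDl.
  have dF := dn n _ n0 dy; have dF' := dn n _ n0 dy'.
  have dF0 := d0 _ dy; have dF0' := d0 _ dy'.
  apply: (le_lt_trans (ler_hnorm_via hY dF' dF0' dF)).
  have b3 := ler_hnorm_via hY dF dF0' dF0.
  have b4 := ln n _ _ n0 dy' dy.
  have b5 := l0 _ _ dy dy'; rewrite (hnormB_sym hY dy dy') in b5.
  lra.
move=> /(_ _ h); apply: filterS => n hn t tT.
by apply: hn => //=; rewrite in_itv.
Unshelve. all: by end_near. Qed.

(** * Convergence of the optimal pairs *)

Section LinearQuadratic.
Variables (R : realType) (V W : lmodType R[i]) (Y : hspace V) (U : hspace W).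
Hypotheses (hY : pre_hilbert Y) (hU : pre_hilbert U).
Variables (A As : V -> V -> Prop) (S Ss : R -> V -> V) (Gr : W -> V).
Hypothesis hS : generates_contraction_semigroup Y A S.
Hypothesis hAs : is_adjoint_graph Y A As.
Hypothesis hSs : forall t, 0 <= t -> is_adjoint Y (S t) (Ss t).
Hypothesis hGr : bounded_op U Y Gr.
Hypothesis dAs : hdense Y (gdom As).
Variables (T C : R) (Lam : (R -> W) -> R -> V).
Hypothesis T0 : 0 < T.
Hypothesis C0 : 0 <= C.
Local Notation H := (time_space U 0 T).
Hypothesis hLam : forall g, L2_in_time U 0 T g ->
  is_state Y As S Ss Gr 0 T 0 g (Lam g) /\
  forall t, 0 <= t <= T -> hnorm Y (Lam g t) <= C * hnorm H g.
Variable alpha : R.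
Hypothesis alpha0 : 0 < alpha.

Local Notation L := (fun g => Lam g T).
Definition tail (s : R) (g : R -> W) : R -> W := cut `]s, T[ g.

Let hH : pre_hilbert H := time_space_pre_hilbert hU 0 T.
Let T0' : 0 <= T := ltW T0.
Let TT : 0 <= T <= T. Proof. by rewrite T0' lexx. Qed.
Let hL : bounded_op H Y L := Lam_bop hY hU hS hAs hSs hGr dAs T0' hLam TT.
Let hC g : hdom H g -> hnorm Y (L g) <= C * hnorm H g.
Proof. by move=> hg; have [_ h] := hLam hg; exact: h. Qed.

Lemma tail_dom s g : hdom H g -> hdom H (tail s g).
Proof. by apply: (L2_cut hU); exact: measurable_oo. Qed.

Lemma tail_sub s g h : tail s (g - h) = tail s g - tail s h.
Proof.
apply/funext => r; rewrite /tail /cut.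
have -> : (g - h) r = g r - h r by [].
by rewrite scalerBr.
Qed.

Lemma tail_rip s g h : hdom H g -> hdom H h ->
  rip H (tail s g) h = rip H g (tail s h).
Proof. by apply: (rip_cut hU); exact: measurable_oo. Qed.

Lemma tail_comp s t g : s <= t -> tail s (tail t g) = tail t g.
Proof.
move=> st; apply/funext => r; rewrite /tail.
have [h|h] := pselect ((`]t, T[%classic : set R) r).
  rewrite [LHS]cut_in//; move: h; rewrite /= !in_itv/= => /andP[h ->].
  by rewrite (le_lt_trans st).
have [h'|h'] := pselect ((`]s, T[%classic : set R) r); first by rewrite cut_in.
by rewrite [LHS]cut_out// [RHS]cut_out.
Qed.

Lemma tail_small q : hdom Y q -> forall e : R, 0 < e ->
  exists2 d : R, 0 < d & forall g s t, hdom H g ->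
    0 <= s -> s <= t -> t <= T -> t - s < d -> tail s g = g ->
    `|rip Y (L (g - tail t g)) q| <= e * hnorm H (g - tail t g).
Proof.
move=> dq e e0.
have [d d0 hd] := final_state_small hY hU hS hAs hSs hGr dAs T0' C0 hLam dq e0.
exists d => // g s t dg s0 st tT ts sg; have dt := tail_dom t dg.
have dgt : hdom H (g - tail t g) by hilb.
apply: (hd _ s t dgt st _ ts).
(* The interval is closed at t: [tail t g] vanishes at t itself, where g need not. After t the two
   terms cancel, and outside (s, T) g is 0 because it equals [tail s g]. *)
move=> r nr; have -> : (g - tail t g) r = g r - tail t g r by [].
have [h|h] := pselect ((`]t, T[%classic : set R) r).
  by rewrite /tail cut_in// subrr.
have -> : tail t g r = 0 by exact: cut_out.
rewrite subr0 -sg; apply: cut_out => h'; apply: nr.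
move: h h'; rewrite /= !in_itv/= => /negP; rewrite negb_and -!leNgt.
by move=> /orP[rt|Tr] /andP[sr rT]; [rewrite sr|rewrite leNgt rT in Tr].
Qed.

(** The cost of g + a h minus the cost of g is a quadratic polynomial in the real number a without
    constant term. Optimality makes it nonnegative, so [discr_le] forces its linear coefficient to
    vanish. *)
Lemma euler_of_optimal (G : V -> V) s x g y : bounded_op Y Y G ->
  0 <= s < T -> hdom Y x -> is_optimal Y U As S Ss Gr alpha G s T x g y ->
  optimal_pair Y H L alpha G (window H tail s) (S (T - s) x) (tail s g) (y T).
Proof.
move=> hG /andP[s0 sT] dx [hg sy hopt].
have sT' : 0 <= s <= T by rewrite s0 ltW.
have sTT : s <= T <= T by rewrite lexx ltW.
have [cy _] := sy; have [dy _] := cy T sTT.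
have hsg : hdom H (tail s g) by exact: (L2_extend hU s0 (lexx T) hg).
split => //; first by split => //; exact: tail_comp.
  exact: (state_repr hY hU hS hAs hSs hGr dAs hLam sT' dx hg sy sTT).
move=> h [dh ch]; have dLh := bop_dom hL dh.
have dGy := bop_dom hG dy; have dGL := bop_dom hG dLh.
apply/eqP; rewrite -sqrf_eq0; apply/eqP/le_anti; rewrite sqr_ge0 andbT.
rewrite -[leRHS](mul0r (alpha * rip H h h + rip Y (G (L h)) (G (L h)))).
apply: discr_le.
  by rewrite addr_ge0 ?mulr_ge0 ?(ltW alpha0)// rip_ge0.
move=> a.
have sa := state_perturb hY hU hS hAs hSs hGr hLam a sT' dx hg dh ch sy.
have hag : L2_in_time U s T (a%:C *: h + g).
  by apply: L2_lin => //; exact: (L2_restrict hU s0 (lexx T) dh).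
have := hopt _ _ hag sa; rewrite /cost.
rewrite !(sqnorm_extend hU s0 (lexx T)).
have -> : cut `]s, T[ (a%:C *: h + g) = a%:C *: h + tail s g.
  rewrite -{2}ch; apply/funext => r; transitivity
    (a%:C *: cut `]s, T[ h r + cut `]s, T[ g r) => //.
  rewrite /cut; have -> : (a%:C *: h + g) r = a%:C *: h r + g r by [].
  by rewrite scalerDr !scalerA mulrC.
have dahg : hdom H (a%:C *: h + tail s g) by hilb.
rewrite -/(tail s g) (sqnorm_rip hU hsg) (sqnorm_rip hU dahg).
have daL : hdom Y (a%:C *: L h + y T) by hilb.
have dGa := bop_dom hG daL.
rewrite !sqr_hnorm//.
have dGG : hdom Y (a%:C *: G (L h) + G (y T)) by hilb.
have e1 := bop_lin hG a%:C dLh dy.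
rewrite (heq_rip hY dGa dGG dGa e1) (ripC hY dGG dGa) (heq_rip hY dGa dGG dGG e1).
rip; rewrite (ripC hH hsg dh) (ripC hY dGy dGL).
set a1 := rip H _ _; set a2 := rip H _ _; set a3 := rip H _ _.
set b1 := rip Y _ _; set b2 := rip Y _ _; set b3 := rip Y _ _.
by lra.
Qed.


(** Optimal pairs are given for s < T only. The value 0 at s = T, with final state x, extends the
    family to the compact interval [0, T], in agreement with the convention of [cost_operator]. *)
Definition extended_control (gx : R -> R -> W) (s : R) : R -> W :=
  if s < T then tail s (gx s) else 0.

Definition extended_final (x : V) (yx : R -> R -> V) (s : R) : V :=
  if s < T then yx s T else x.

Lemma extended_optimal (G : V -> V) (x : V) gx yx : bounded_op Y Y G -> hdom Y x ->
  (forall s, 0 <= s < T -> is_optimal Y U As S Ss Gr alpha G s T x (gx s) (yx s)) ->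
  forall s, 0 <= s <= T ->
  optimal_pair Y H L alpha G (window H tail s) (S (T - s) x)
    (extended_control gx s) (extended_final x yx s).
Proof.
move=> hG dx hopt s /andP[s0 sT]; rewrite /extended_control /extended_final.
case: ifPn => [sT'|]; first by apply: euler_of_optimal => //; [|apply: hopt]; rewrite s0.
rewrite -leNgt => Ts; have -> : s = T by apply/eqP; rewrite eq_le sT Ts.
have d0 := hdom0 hH; have dL0 := bop_dom hL d0.
have t00 : tail T 0 = 0.
  by apply/funext => r; rewrite /tail /cut scaler0.
have dGx := bop_dom hG dx.
have L0 := bop_null hL d0 (hnorm0 hH).
have S0d : hdom Y (S (T - T) x) by apply: (S_dom hS) => //; rewrite subrr.
split => //.
  apply: (heqP hY) => //; first by hilb.
  move=> z dz; rip; rewrite (rip_null hY dL0 dz L0) addr0.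
  rewrite subrr in S0d *; apply: (heq_rip hY dx S0d dz).
  by apply: (heq_sym hY) => //; exact: (S_zero hS).
(* The interval (T, T) is empty, so 0 is the only test control and Euler's equation is trivial. *)
move=> h [dh ch]; have h0 : h = 0.
  rewrite -ch; apply/funext => r; apply: cut_out; rewrite /= in_itv/=.
  by move=> /andP[/lt_trans lt] /lt; rewrite ltxx.
rewrite h0; have dGL := bop_dom hG dL0.
rewrite (ripC hY dGx dGL) (rip_null hY dGL dGx) ?(rip_null hH d0 d0) ?hnorm0//.
  by rewrite mulr0 addr0.
exact: (bop_null hG dL0 L0).
Qed.

Variables (G Gs : V -> V) (Res : nat -> V -> V) (Gns : nat -> V -> V).
Hypothesis hG : bounded_op Y Y G.
Hypothesis hGs : is_adjoint Y G Gs.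
Hypothesis hRes : forall n, (0 < n)%N -> is_resolvent Y A (n%:R : R[i]) (Res n).
Hypothesis hGns : forall n, (0 < n)%N ->
  is_adjoint Y (fun y => G (yosida Res n y)) (Gns n).
Local Notation Gn n := (fun y => G (yosida Res n y)).

Variables (x : V) (g : R -> R -> W) (y : R -> R -> V).
Variables (gn : nat -> R -> R -> W) (yn : nat -> R -> R -> V).
Hypothesis dx : hdom Y x.
Hypothesis hopt : forall s, 0 <= s < T ->
  is_optimal Y U As S Ss Gr alpha G s T x (g s) (y s).
Hypothesis hoptn : forall n s, (0 < n)%N -> 0 <= s < T ->
  is_optimal Y U As S Ss Gr alpha (Gn n) s T x (gn n s) (yn n s).

Local Notation gT := (extended_control g).
Local Notation yT := (extended_final x y).
Local Notation gnT n := (extended_control (gn n)).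
Local Notation ynT n := (extended_final x (yn n)).

Let dA : hdense Y (gdom A) := hAs.1.

Let opt := extended_optimal hG dx hopt.

Let Gn_bop n : (0 < n)%N -> bounded_op Y Y (Gn n).
Proof. exact: (observation_bop hY hS hRes hG). Qed.

Let optn n (n0 : (0 < n)%N) := extended_optimal (Gn_bop n0) dx
  (fun s => @hoptn n s n0).

Variable M : R.
Hypothesis M0 : 0 <= M.
Hypothesis hM : forall v, hdom Y v -> hnorm Y (G v) <= M * hnorm Y v.

Let hMn n v : (0 < n)%N -> hdom Y v -> hnorm Y (G (yosida Res n v)) <= M * hnorm Y v.
Proof. exact: (observation_le hY hS hRes hM M0). Qed.

Lemma final_continuous (F Fs : V -> V) gx yx : bounded_op Y Y F ->
  (forall v, hdom Y v -> hnorm Y (F v) <= M * hnorm Y v) -> is_adjoint Y F Fs ->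
  (forall s, 0 <= s <= T -> optimal_pair Y H L alpha F (window H tail s)
    (S (T - s) x) (gx s) (yx s)) ->
  continuous_in_time Y 0 T yx.
Proof.
move=> hF hFM hFs ho.
apply: (optimal_state_continuous hY hH hL C0 hC alpha0 M0 tail_dom tail_sub
  tail_rip tail_comp tail_small hF hFM hFs _ _ (S_orbits hY hS dx) ho).
- by move=> t t0; exact: (S_dom hS).
- by move=> t t0; exact: (S_contr hS).
Qed.

Let yT_cont : continuous_in_time Y 0 T yT := final_continuous hG hM hGs opt.

Let GyT_cont : continuous_in_time Y 0 T (fun s => G (yT s)).
Proof.
move=> r rT; have [dy hy] := yT_cont rT; split; first exact: (bop_dom hG).
move=> e e0; have M1 : 0 < M + 1 by rewrite ltr_wpDl.
have [d d0 hd] := hy _ (divr_gt0 e0 M1); exists d => // q qT qr.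
have [dyq _] := yT_cont qT.
apply: (le_lt_trans (bop_dist hY hY hG hM dyq dy)).
have := hd q qT qr; rewrite ltr_pdivlMr//; apply: le_lt_trans.
by rewrite [leRHS]mulrC ler_wpM2r ?hnorm_ge0// lerDl.
Qed.

(** Together with [Gns_curve], makes both error terms of [optimal_pair_diff] small uniformly in s,
    by continuity of the limit curve [yT]. *)
Let Gn_curve e : 0 < e -> \forall n \near \oo, forall s, 0 <= s <= T ->
  hnorm Y (G (yosida Res n (yT s)) - G (yT s)) < e.
Proof.
apply: (@cvg_on_curve _ _ Y T M (fun n v => G (yosida Res n v)) G yT hY M0).
- by move=> v; exact: (bop_dom hG).
- by move=> n v n0; exact: (bop_dom (Gn_bop n0)).
- by move=> v w dv dw; exact: (bop_dist hY hY hG hM dv dw).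
- move=> n v w n0 dv dw; apply: (bop_dist hY hY (Gn_bop n0) _ dv dw) => u.
  exact: hMn.
- by move=> v dv e' e0; exact: (observation_cvg hY hS dA hRes hG hM M0).
- exact: yT_cont.
Qed.

Let Gns_curve e : 0 < e -> \forall n \near \oo, forall s, 0 <= s <= T ->
  hnorm Y (Gns n (G (yT s)) - Gs (G (yT s))) < e.
Proof.
apply: (@cvg_on_curve _ _ Y T M Gns Gs (fun s => G (yT s)) hY M0).
- by case: hGs.
- by move=> n v n0; case: (hGns n0) => h _; exact: h.
- exact: (adjoint_dist hY M0 hGs (bop_dom hG) hM).
- move=> n v w n0; apply: (adjoint_dist hY M0 (hGns n0) (bop_dom (Gn_bop n0))).
  by move=> u; exact: hMn.
- by move=> v dv e' e0; exact: (adjoint_observation_cvg hY hS dA hRes hG hGs hGns).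
- exact: GyT_cont.
Qed.

Let ST s : 0 <= s <= T -> hdom Y (S (T - s) x) /\ hnorm Y (S (T - s) x) <= hnorm Y x.
Proof.
case/andP=> _ sT; have Ts : 0 <= T - s by rewrite subr_ge0.
by split; [exact: (S_dom hS)|exact: (S_contr hS)].
Qed.

Lemma control_cvg e : 0 < e -> \forall n \near \oo, forall s, 0 <= s <= T ->
  hnorm H (gnT n s - gT s) < e.
Proof.
(* Chosen so that (C + 1) (M k + k) = alpha e, which strictly exceeds the right-hand side of
   [optimal_pair_diff] when both errors are below k. *)
move=> e0; pose k := alpha * e / ((C + 1) * (M + 1)).
have C1 : 0 < C + 1 by rewrite ltr_wpDl.
have M1 : 0 < M + 1 by rewrite ltr_wpDl.
have k0 : 0 < k by rewrite divr_gt0 ?mulr_gt0.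
have h1 := Gn_curve k0; have h2 := Gns_curve k0; near=> n => s sT.
have n0 : (0 < n)%N by near: n; exact: nbhs_infty_gt.
have [dS _] := ST sT.
have := optimal_pair_diff hY hH hL C0 hC M0 hG hGs (Gn_bop n0) (hGns n0)
  (fun v => @hMn n v n0) (@window_dom _ _ H tail s)
  (@windowB _ _ H hH tail tail_sub s) dS (opt sT) (optn n0 sT).
have b1 : hnorm Y (G (yosida Res n (yT s)) - G (yT s)) < k.
  by move: s sT {dS}; near: n.
have b2 : hnorm Y (Gns n (G (yT s)) - Gs (G (yT s))) < k.
  by move: s sT {dS b1}; near: n.
move=> b3; rewrite -(ltr_pM2l alpha0); apply: le_lt_trans b3 _.
have -> : alpha * e = (C + 1) * (M * k + k).
  by rewrite /k; field; rewrite (gt_eqF C1) (gt_eqF M1).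
have -> : (C + 1) * (M * k + k) = C * (M * k + k) + (M * k + k) by ring.
have : 0 < M * k + k by rewrite ltr_wpDl// mulr_ge0// ltW.
have : C * (M * hnorm Y (G (yosida Res n (yT s)) - G (yT s)) +
    hnorm Y (Gns n (G (yT s)) - Gs (G (yT s)))) <= C * (M * k + k).
  apply: ler_wpM2l => //; apply: lerD; last exact: ltW.
  by apply: ler_wpM2l => //; exact: ltW.
lra.
Unshelve. all: by end_near. Qed.

Let gT_dom s : 0 <= s <= T -> hdom H (gT s).
Proof. by move=> /opt[[]]. Qed.

Let gnT_dom n s : (0 < n)%N -> 0 <= s <= T -> hdom H (gnT n s).
Proof. by move=> n0 /(optn n0)[[]]. Qed.

Let yT_dom s : 0 <= s <= T -> hdom Y (yT s).
Proof. by move=> /opt[]. Qed.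

Let ynT_dom n s : (0 < n)%N -> 0 <= s <= T -> hdom Y (ynT n s).
Proof. by move=> n0 /(optn n0)[]. Qed.

Let half_open s : 0 <= s < T -> 0 <= s <= T.
Proof. by case/andP=> -> /ltW. Qed.

Lemma control_L2_cvg e : 0 < e -> \forall n \near \oo, forall s, 0 <= s < T ->
  L2norm_in_time U s T (fun t => gn n s t - g s t) < e.
Proof.
move=> e0; have h := control_cvg e0; near=> n => s sT.
have n0 : (0 < n)%N by near: n; exact: nbhs_infty_gt.
have : hnorm H (gnT n s - gT s) < e by move: s sT => s /half_open; move: s; near: n.
have sT' := half_open sT; have [s0 sT''] := andP sT.
rewrite (L2norm_extend hU s0 (lexx T)) -/(tail s _).
have -> : tail s (fun t => gn n s t - g s t) = gnT n s - gT s.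
  by rewrite /extended_control sT'' -tail_sub.
rewrite (L2norm_hnorm hU)//; have dg := gT_dom sT'; have dgn := gnT_dom n0 sT'.
by have : hdom H (gnT n s - gT s) by hilb.
Unshelve. all: by end_near. Qed.

(** The free evolution cancels by [state_repr]: the difference of the states is the response to the
    difference of the controls, bounded by C uniformly in t and s. *)
Lemma state_cvg e : 0 < e -> \forall n \near \oo, forall s, 0 <= s < T ->
  forall t, s <= t <= T -> hnorm Y (yn n s t - y s t) < e.
Proof.
move=> e0; have C1 : 0 < C + 1 by rewrite ltr_wpDl.
have h := control_cvg (divr_gt0 e0 C1); near=> n => s sT t st.
have n0 : (0 < n)%N by near: n; exact: nbhs_infty_gt.
have sT' := half_open sT; have [s0 sT''] := andP sT.
have hn : hnorm H (gnT n s - gT s) < e / (C + 1) by move: s sT' {sT st s0 sT''}; near: n.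
have dg := gT_dom sT'; have dgn := gnT_dom n0 sT'.
have dd : hdom H (gnT n s - gT s) by hilb.
have [hg sy _] := hopt sT; have [hgn syn _] := hoptn n0 sT.
have t0T : 0 <= t <= T by case/andP: st => st ->; rewrite (le_trans s0).
have r1 := state_repr hY hU hS hAs hSs hGr dAs hLam sT' dx hg sy st.
have r2 := state_repr hY hU hS hAs hSs hGr dAs hLam sT' dx hgn syn st.
have hLt := Lam_bop hY hU hS hAs hSs hGr dAs T0' hLam t0T.
have ts : 0 <= t - s by rewrite subr_ge0; case/andP: st.
have dS := S_dom hS ts dx.
have [[cy _] [cyn _]] := (sy, syn).
have [dy _] := cy t st; have [dyn _] := cyn t st.
have e1 : heq Y (yn n s t - y s t) (Lam (gnT n s - gT s) t).
  have := bop_sub hLt dgn dg.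
  have dL := bop_dom hLt dg; have dLn := bop_dom hLt dgn; have dLd := bop_dom hLt dd.
  move: dL dLn r1 r2; rewrite /extended_control sT'' /tail => dL dLn r1 r2 r3.
  apply: (heqP hY); [by hilb|by move: dLd; rewrite /extended_control sT''|] => z dz.
  have d1 : hdom Y (S (t - s) x + Lam (cut `]s, T[ (g s)) t) by hilb.
  have d2 : hdom Y (S (t - s) x + Lam (cut `]s, T[ (gn n s)) t) by hilb.
  rewrite (heq_rip hY _ _ dz r3); [|by move: dLd; rewrite /extended_control sT''|by hilb].
  by rip; rewrite (heq_rip hY dy d1 dz r1) (heq_rip hY dyn d2 dz r2); rip; ring.
rewrite (heq_hnorm hY _ _ e1); [|by hilb|exact: (bop_dom hLt)].
have [_ /(_ t t0T) hb] := hLam dd; apply: le_lt_trans hb _.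
move: hn; rewrite ltr_pdivlMr//; apply: le_lt_trans.
by rewrite [leRHS]mulrC ler_wpM2r ?hnorm_ge0// lerDl.
Unshelve. all: by end_near. Qed.

Let final_cvg e : 0 < e -> \forall n \near \oo, forall s, 0 <= s <= T ->
  hnorm Y (ynT n s - yT s) < e.
Proof.
move=> e0; have h := state_cvg e0; near=> n => s /andP[s0 sT].
have hn : forall s, 0 <= s < T -> forall t, s <= t <= T ->
    hnorm Y (yn n s t - y s t) < e by near: n.
rewrite /extended_final; have [lt|ge] := ltP s T; last by rewrite subrr hnorm0.
by apply: hn; rewrite ?s0 ?sT ?lexx.
Unshelve. all: by end_near. Qed.

(** Split at [G (yosida Res n (yT s))]: the maps G J_n share the Lipschitz constant M, and the
    remaining difference is handled by [Gn_curve]. *)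
Let observed_cvg e : 0 < e -> \forall n \near \oo, forall s, 0 <= s <= T ->
  hnorm Y (G (yosida Res n (ynT n s)) - G (yT s)) < e.
Proof.
move=> e0; have e2 : 0 < e / 2 by rewrite divr_gt0.
have M1 : 0 < M + 1 by rewrite ltr_wpDl.
have h1 := Gn_curve e2; have h2 := final_cvg (divr_gt0 e2 M1).
near=> n => s sT.
have n0 : (0 < n)%N by near: n; exact: nbhs_infty_gt.
have dy := yT_dom sT; have dyn := ynT_dom n0 sT.
have b1 : hnorm Y (G (yosida Res n (yT s)) - G (yT s)) < e / 2.
  by move: s sT {dy dyn}; near: n.
have b2 : hnorm Y (ynT n s - yT s) < e / 2 / (M + 1).
  by move: s sT {dy dyn b1}; near: n.
have d1 := bop_dom (Gn_bop n0) dyn; have d2 := bop_dom (Gn_bop n0) dy.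
have d3 := bop_dom hG dy.
apply: (le_lt_trans (ler_hnorm_via hY d1 d3 d2)).
have b3 := bop_dist hY hY (Gn_bop n0) (fun v => @hMn n v n0) dyn dy.
have b4 : M * hnorm Y (ynT n s - yT s) <= e / 2.
  move: b2; rewrite ltr_pdivlMr// => /ltW; apply: le_trans.
  by rewrite [leRHS]mulrC ler_wpM2r ?hnorm_ge0// lerDl.
lra.
Unshelve. all: by end_near. Qed.

Lemma cost_cvg e : 0 < e -> \forall n \near \oo, forall s, 0 <= s < T ->
  `|cost Y U alpha (Gn n) s T (gn n s) (yn n s) - cost Y U alpha G s T (g s) (y s)| < e.
Proof.
move=> e0; have X0 : 0 <= M / Num.sqrt alpha * hnorm Y x.
  by rewrite !mulr_ge0 ?hnorm_ge0// invr_ge0 sqrtr_ge0.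
have Z0 : 0 <= M * hnorm Y x by rewrite mulr_ge0 ?hnorm_ge0.
move eX : (M / Num.sqrt alpha * hnorm Y x) X0 => X X0.
move eZ : (M * hnorm Y x) Z0 => Z Z0.
(* X and Z are a priori bounds, uniform in s and n, for the optimal controls and the observed final
   states. B and D bound the sums a + b in a^2 - b^2 = (a - b)(a + b); the added 1 makes them
   positive. *)
pose B := 2 * X + 1; pose D := 2 * Z + 1.
have B0 : 0 < B by rewrite /B; lra.
have D0 : 0 < D by rewrite /D; lra.
have k1 : 0 < e / 3 / (alpha * B) by rewrite !divr_gt0 ?mulr_gt0.
have k2 : 0 < e / 3 / D by rewrite !divr_gt0.
have h1 := control_cvg k1; have h2 := observed_cvg k2.
near=> n => s sT.
have n0 : (0 < n)%N by near: n; exact: nbhs_infty_gt.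
have sT' := half_open sT; have [s0 sT''] := andP sT.
have c1 : hnorm H (gnT n s - gT s) < e / 3 / (alpha * B).
  by move: s sT' {sT s0 sT''}; near: n.
have c2 : hnorm Y (G (yosida Res n (ynT n s)) - G (yT s)) < e / 3 / D.
  by move: s sT' {sT s0 sT'' c1}; near: n.
have dg := gT_dom sT'; have dgn := gnT_dom n0 sT'.
have dy := yT_dom sT'; have dyn := ynT_dom n0 sT'.
have dGy := bop_dom hG dy; have dGn := bop_dom (Gn_bop n0) dyn.
have [dS Sx] := ST sT'.
have [bG bg] := optimal_pair_bound hY hH hL alpha0 M0 hG hM
  (@window_dom _ _ H tail s) dS (opt sT').
have [bGn bgn] := optimal_pair_bound hY hH hL alpha0 M0 (Gn_bop n0)
  (fun v => @hMn n v n0) (@window_dom _ _ H tail s) dS (optn n0 sT').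
have {bG}bG : hnorm Y (G (yT s)) <= Z.
  by apply: le_trans bG _; rewrite -eZ ler_wpM2l.
have {bGn}bGn : hnorm Y (G (yosida Res n (ynT n s))) <= Z.
  by apply: le_trans bGn _; rewrite -eZ ler_wpM2l.
have m0 : 0 <= M / Num.sqrt alpha by rewrite mulr_ge0// invr_ge0 sqrtr_ge0.
have {bg}bg : hnorm H (gT s) <= X.
  by apply: le_trans bg _; rewrite -eX ler_wpM2l.
have {bgn}bgn : hnorm H (gnT n s) <= X.
  by apply: le_trans bgn _; rewrite -eX ler_wpM2l.
have cE (F : V -> V) gx yx : hdom H (extended_control gx s) ->
    cost Y U alpha F s T (gx s) (yx s) =
    alpha * hnorm H (extended_control gx s) ^+ 2 +
      hnorm Y (F (extended_final x yx s)) ^+ 2.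
  rewrite /cost /extended_control /extended_final sT'' => dc.
  rewrite (sqnorm_extend hU s0 (lexx T)) (sqnorm_rip hU); last exact: dc.
  by rewrite (sqr_hnorm hH dc).
rewrite (cE (Gn n))// (cE G)//.
have sq (a b c k m : R) : 0 <= a -> 0 <= b -> `|a - b| <= c -> c < k / m ->
    a + b <= m -> 0 < m -> `|a ^+ 2 - b ^+ 2| <= k.
  move=> a0 b0 ab ck abm mp; rewrite subr_sqr normrM [`|a + b|]ger0_norm ?addr_ge0//.
  apply: (@le_trans _ _ (k / m * m)); last by rewrite divfK// gt_eqF.
  by apply: ler_pM; rewrite ?normr_ge0 ?addr_ge0// (le_trans ab)// ltW.
have x1 : `|hnorm H (gnT n s) ^+ 2 - hnorm H (gT s) ^+ 2| <= e / 3 / alpha.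
  apply: (sq _ _ _ _ B _ _ (ler_dist_hnorm hH dgn dg)); rewrite ?hnorm_ge0//.
    by move: c1; rewrite invfM mulrA.
  by rewrite /B; lra.
have x2 : `|hnorm Y (G (yosida Res n (ynT n s))) ^+ 2 - hnorm Y (G (yT s)) ^+ 2| <= e / 3.
  apply: (sq _ _ _ _ D _ _ (ler_dist_hnorm hY dGn dGy)); rewrite ?hnorm_ge0//.
  by rewrite /D; lra.
have x3 : `|alpha * (hnorm H (gnT n s) ^+ 2 - hnorm H (gT s) ^+ 2)| <= e / 3.
  by rewrite normrM (gtr0_norm alpha0) -ler_pdivlMl// mulrC.
set u := hnorm H (gnT n s) ^+ 2 in x3 *; set v := hnorm H (gT s) ^+ 2 in x3 *.
set u' := hnorm Y _ ^+ 2 in x2 *; set v' := hnorm Y (G (yT s)) ^+ 2 in x2 *.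
have -> : alpha * u + u' - (alpha * v + v') = alpha * (u - v) + (u' - v') by ring.
apply: le_lt_trans (ler_normD _ _) _; lra.
Unshelve. all: by end_near. Qed.

(** Pass through [Ss (T - q)] applied to the vector at time r. One difference is controlled by the
    Lipschitz constant M^2 of Fs F and contractivity of the adjoint semigroup, the other by uniform
    continuity of its orbits. *)
Lemma cost_operator_continuous (F Fs : V -> V) gx yx : bounded_op Y Y F ->
  (forall v, hdom Y v -> hnorm Y (F v) <= M * hnorm Y v) -> is_adjoint Y F Fs ->
  (forall s, 0 <= s <= T -> optimal_pair Y H L alpha F (window H tail s)
    (S (T - s) x) (extended_control gx s) (extended_final x yx s)) ->
  continuous_in_time Y 0 T (fun t => Ss (T - t) (Fs (F (extended_final x yx t)))).
Proof.
move=> hF hFM hFs ho r rT.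
have cy := final_continuous hF hFM hFs ho; have [dy hy] := cy r rT.
have dFs v : hdom Y v -> hdom Y (Fs v) by case: hFs => h _; exact: h.
have Tr : 0 <= T - r by case/andP: rT; rewrite subr_ge0.
have dv := dFs _ (bop_dom hF dy); split; first exact: (Ss_dom hSs).
move=> e e0; have e2 : 0 < e / 2 by rewrite divr_gt0.
have k0 : 0 < M * M + 1 by rewrite ltr_wpDl ?mulr_ge0.
have [d1 d10 h1] := hy _ (divr_gt0 e2 k0).
have [d2 d20 h2] := Ss_orbits hY hS hSs dv e2.
exists (Num.min d1 d2); first by rewrite lt_min d10.
move=> q qT; rewrite lt_min => /andP[q1 q2].
have Tq : 0 <= T - q by case/andP: qT; rewrite subr_ge0.
have [dyq _] := cy q qT; have dvq := dFs _ (bop_dom hF dyq).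
have a1 := Ss_dom hSs Tq dvq; have a2 := Ss_dom hSs Tq dv; have a3 := Ss_dom hSs Tr dv.
apply: (le_lt_trans (ler_hnorm_via hY a1 a3 a2)).
have b1 := Ss_dist hY hS hSs Tq dvq dv.
have b2 := adjoint_dist hY M0 hFs (bop_dom hF) hFM (bop_dom hF dyq) (bop_dom hF dy).
have b3 := bop_dist hY hY hF hFM dyq dy.
have b4 : M * hnorm Y (F (extended_final x yx q) - F (extended_final x yx r)) <=
    M * (M * hnorm Y (extended_final x yx q - extended_final x yx r)).
  by rewrite ler_wpM2l.
have b5 := h1 q qT q1; rewrite ltr_pdivlMr// mulrDr mulr1 in b5.
have b6 : hnorm Y (Ss (T - q) (Fs (F (extended_final x yx r))) -
    Ss (T - r) (Fs (F (extended_final x yx r)))) < e / 2.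
  apply: h2 => //; have -> : T - q - (T - r) = - (q - r) by ring.
  by rewrite normrN.
have := hnorm_ge0 Y (extended_final x yx q - extended_final x yx r); lra.
Qed.

(** The intermediate vector is [Gns n (G (yT t))]: the adjoints share the Lipschitz constant M, and
    [Gns_curve] treats the rest. The outer semigroup only contracts. *)
Lemma cost_operator_cvg e : 0 < e -> \forall n \near \oo, forall t, 0 <= t <= T ->
  hnorm Y (Ss (T - t) (Gns n (G (yosida Res n (ynT n t)))) -
           Ss (T - t) (Gs (G (yT t)))) < e.
Proof.
move=> e0; have e2 : 0 < e / 2 by rewrite divr_gt0.
have M1 : 0 < M + 1 by rewrite ltr_wpDl.
have h1 := observed_cvg (divr_gt0 e2 M1); have h2 := Gns_curve e2.
near=> n => t tT.
have n0 : (0 < n)%N by near: n; exact: nbhs_infty_gt.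
have c1 : hnorm Y (G (yosida Res n (ynT n t)) - G (yT t)) < e / 2 / (M + 1).
  by move: t tT; near: n.
have c2 : hnorm Y (Gns n (G (yT t)) - Gs (G (yT t))) < e / 2.
  by move: t tT {c1}; near: n.
have dy := yT_dom tT; have dyn := ynT_dom n0 tT.
have dGy := bop_dom hG dy; have dGn := bop_dom (Gn_bop n0) dyn.
have dFs v : hdom Y v -> hdom Y (Gs v) by case: hGs => h _; exact: h.
have dFns v : hdom Y v -> hdom Y (Gns n v) by case: (hGns n0) => h _; exact: h.
have a1 := dFs _ dGy; have a2 := dFns _ dGn; have a3 := dFns _ dGy.
have Tt : 0 <= T - t by case/andP: tT; rewrite subr_ge0.
apply: (le_lt_trans (Ss_dist hY hS hSs Tt a2 a1)).
apply: (le_lt_trans (ler_hnorm_via hY a2 a1 a3)).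
have b1 := adjoint_dist hY M0 (hGns n0) (bop_dom (Gn_bop n0))
  (fun v => @hMn n v n0) dGn dGy.
have b4 : M * hnorm Y (G (yosida Res n (ynT n t)) - G (yT t)) <= e / 2.
  move: c1; rewrite ltr_pdivlMr// => /ltW; apply: le_trans.
  by rewrite [leRHS]mulrC ler_wpM2r ?hnorm_ge0// lerDl.
lra.
Unshelve. all: by end_near. Qed.

End LinearQuadratic.

(** * Square-integrable fields and Maxwell's equations *)

Section OpenSets.
Variable R : realType.
Local Notation mR := (measurableTypeR R).
Local Notation pt := (R * R * R)%type.

Let box (c : rat * rat * rat * nat) : set pt :=
  (ball (ratr c.1.1.1 : R) c.2.+1%:R^-1 `*` ball (ratr c.1.1.2 : R) c.2.+1%:R^-1) `*`
  ball (ratr c.1.2 : R) c.2.+1%:R^-1.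

(** An open set is the union of the countably many boxes with rational centre and radius 1/(k+1)
    that it contains, and boxes are measurable for the product sigma-algebra. *)
Lemma open_measurable3 (Om : set pt) : open Om -> measurable (Om : set (mR * mR * mR)).
Proof.
move=> oOm; have mbox c : measurable (box c : set (mR * mR * mR)).
  by apply: measurableX; [apply: measurableX|]; exact: measurable_ball.
have -> : Om = \bigcup_c (if `[< box c `<=` Om >] then box c else set0).
  apply/seteqP; split => [x Ox|x [c _]]; last by case: asboolP => // h /h.
  move: oOm; rewrite openE => /(_ _ Ox)/nbhs_ballP[e /= e0 eOm].
  (* Radius below e/2: any box of this size containing x lies in the ball of radius e around x. *)
  have [k ke] : exists k, k.+1%:R^-1 < e / 2.
    have [k _ hk] := @near_infty_natSinv_lt R (PosNum (divr_gt0 e0 (ltr0n R 2))).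
    by exists k; apply: hk => /=.
  have k0 : 0 < k.+1%:R^-1 :> R by rewrite invr_gt0.
  have app (z : R) : exists q : rat, ball (ratr q : R) k.+1%:R^-1 z.
    have /rat_in_itvoo[q] : z < z + k.+1%:R^-1 by rewrite ltrDl.
    rewrite in_itv/= => /andP[zq qz]; exists q.
    by rewrite /ball/= ger0_norm ?subr_ge0 ?(ltW zq)// ltrBlDl.
  have [q1 h1] := app x.1.1; have [q2 h2] := app x.1.2; have [q3 h3] := app x.2.
  exists (q1, q2, q3, k) => //; rewrite asboolT//.
  move=> z [[/= z1 z2] z3]; apply: eOm.
  have tri (a b q : R) : ball q k.+1%:R^-1 a -> ball q k.+1%:R^-1 b -> ball a e b.
    move=> /ball_sym qa qb; apply: (@le_ball _ _ _ (k.+1%:R^-1 + k.+1%:R^-1)).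
      by rewrite [leRHS]splitr lerD// ltW.
    exact: (ball_triangle qa qb).
  by split; [split|]; [exact: tri h1 z1|exact: tri h2 z2|exact: tri h3 z3].
apply: countable_bigcupT_measurable; first exact: countableP.
by move=> c; case: ifP.
Qed.

End OpenSets.

Section SquareIntegrable.
Variables (R : realType) (d : measure_display) (T : measurableType d).
Variables (mu : {measure set T -> \bar R}) (D : set T).
Hypothesis mD : measurable D.
Local Notation row := 'rV[R[i]]_3.
Local Notation X := (L2_space mu D 1 3).
Implicit Types u v w : T -> row.

Lemma cdot_row (v w : row) : cdot v w = \sum_j v 0 j * conjc (w 0 j).
Proof. by rewrite /cdot big_ord1. Qed.

Lemma csqnorm_row (v : row) :
  csqnorm v = \sum_j (complex.Re (v 0 j) ^+ 2 + complex.Im (v 0 j) ^+ 2).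
Proof.
rewrite /csqnorm cdot_row (raddf_sum (@complex.Re R : {additive R[i] -> R})).
by apply: eq_bigr => j _; case: (v 0 j) => a b /=; ring.
Qed.

Lemma csqnorm_ge0 (v : row) : 0 <= csqnorm v.
Proof. by rewrite csqnorm_row sumr_ge0// => j _; rewrite addr_ge0 ?sqr_ge0. Qed.


Lemma Re_sum (I : finType) (F : I -> R[i]) :
  complex.Re (\sum_i F i) = \sum_i complex.Re (F i).
Proof. exact: (raddf_sum (@complex.Re R : {additive R[i] -> R})). Qed.

Lemma Im_sum (I : finType) (F : I -> R[i]) :
  complex.Im (\sum_i F i) = \sum_i complex.Im (F i).
Proof. exact: (raddf_sum (@complex.Im R : {additive R[i] -> R})). Qed.

Lemma csqnorm_lin (a : R[i]) (v w : row) : csqnorm (a *: v + w) <=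
  2 * (complex.Re a ^+ 2 + complex.Im a ^+ 2) * csqnorm v + 2 * csqnorm w.
Proof.
rewrite !csqnorm_row !mulr_sumr -big_split/=; apply: ler_sum => j _.
rewrite !mxE; case: a => a b; case: (v 0 j) => c e; case: (w 0 j) => f g /=.
have h (p q : R) : (p + q) ^+ 2 <= 2 * p ^+ 2 + 2 * q ^+ 2.
  by have := sqr_ge0 (p - q); rewrite sqrrB sqrrD; lra.
have := h (a * c - b * e) f; have := h (a * e + b * c) g.
have -> : 2 * (a ^+ 2 + b ^+ 2) * (c ^+ 2 + e ^+ 2) =
    2 * (a * c - b * e) ^+ 2 + 2 * (a * e + b * c) ^+ 2 by ring.
lra.
Qed.

Lemma cdot_le (v w : row) : `|complex.Re (cdot v w)| <= csqnorm v + csqnorm w /\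
  `|complex.Im (cdot v w)| <= csqnorm v + csqnorm w.
Proof.
have pq (p q : R) : `|p * q| <= (p ^+ 2 + q ^+ 2) / 2.
  rewrite ler_norml; apply/andP; split.
    by have := sqr_ge0 (p + q); rewrite sqrrD; lra.
  by have := sqr_ge0 (p - q); rewrite sqrrB; lra.
rewrite cdot_row !csqnorm_row Re_sum Im_sum -big_split/=.
split; apply: (le_trans (ler_norm_sum _ _ _)); apply: ler_sum => j _;
  case: (v 0 j) => a b; case: (w 0 j) => c e /=;
  move: (sqr_ge0 a) (sqr_ge0 b) (sqr_ge0 c) (sqr_ge0 e).
  have := pq a c; have := pq b (- e); have := ler_normD (a * c) (- (b * - e)).
  by rewrite normrN sqrrN; lra.
have := pq a (- e); have := pq b c; have := ler_normD (a * - e) (b * c).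
by rewrite sqrrN; lra.
Qed.

Lemma mactE (M : 'M[R]_3) (v : row) j :
  mact M v 0 j = \sum_k v 0 k * (M j k)%:C.
Proof. by rewrite /mact mxE; apply: eq_bigr => k _; rewrite !mxE. Qed.

Lemma Re_mact (M : 'M[R]_3) (v : row) j :
  complex.Re (mact M v 0 j) = \sum_k complex.Re (v 0 k) * M j k.
Proof.
rewrite mactE Re_sum; apply: eq_bigr => k _.
by case: (v 0 k) => a b /=; ring.
Qed.

Lemma Im_mact (M : 'M[R]_3) (v : row) j :
  complex.Im (mact M v 0 j) = \sum_k complex.Im (v 0 k) * M j k.
Proof.
rewrite mactE Im_sum; apply: eq_bigr => k _.
by case: (v 0 k) => a b /=; ring.
Qed.

(** The factor 9 is 3 times 3: Cauchy-Schwarz for a row of three terms, summed over three rows. *)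
Lemma csqnorm_mact (M : 'M[R]_3) (K : R) (v : row) : (forall j k, `|M j k| <= K) ->
  csqnorm (mact M v) <= 9 * K ^+ 2 * csqnorm v.
Proof.
move=> hM.
have s3 (a : 'I_3 -> R) j : (\sum_k a k * M j k) ^+ 2 <= 3 * K ^+ 2 * \sum_k a k ^+ 2.
  have h k : (a k * M j k) ^+ 2 <= K ^+ 2 * a k ^+ 2.
    rewrite exprMn mulrC ler_wpM2r ?sqr_ge0// -(real_normK (num_real (M j k))).
    by rewrite ler_pXn2r ?nnegrE// (le_trans _ (hM j k)).
  rewrite !big_ord_recl !big_ord0.
  set i1 : 'I_3 := lift ord0 ord0; set i2 : 'I_3 := lift ord0 (lift ord0 ord0).
  have := h ord0; have := h i1; have := h i2.
  set p := a ord0 * M j ord0; set q := a i1 * M j i1; set r := a i2 * M j i2.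
  have := sqr_ge0 (p - q); have := sqr_ge0 (p - r); have := sqr_ge0 (q - r).
  have -> : (p + (q + (r + 0))) ^+ 2 =
    3 * (p ^+ 2 + q ^+ 2 + r ^+ 2) - (q - r) ^+ 2 - (p - r) ^+ 2 - (p - q) ^+ 2 by ring.
  lra.
have e : csqnorm (mact M v) <= \sum_(j < 3) (3 * K ^+ 2 * csqnorm v).
  rewrite [X in X <= _]csqnorm_row; apply: ler_sum => j _.
  rewrite Re_mact Im_mact csqnorm_row big_split/= mulrDr.
  by apply: lerD; exact: s3.
apply: le_trans e _; rewrite !big_ord_recl big_ord0.
by move: (csqnorm v) => c; lra.
Qed.

Lemma L2_csqnorm_integrable u : hdom X u ->
  mu.-integrable D (EFin \o (fun x => csqnorm (u x))).
Proof.
move=> [mu_ fi]; apply/integrableP; split.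
  apply/measurable_EFinP.
  have -> : (fun x => csqnorm (u x)) = (fun x => \sum_j (
      complex.Re (u x 0 j) ^+ 2 + complex.Im (u x 0 j) ^+ 2)).
    by apply/funext => x; rewrite csqnorm_row.
  apply: measurable_sum => j; have [m1 m2] := mu_ 0 j.
  by apply: measurable_funD; exact: measurable_funX.
apply: le_lt_trans fi; rewrite le_eqVlt; apply/orP; left; apply/eqP.
by apply: eq_integral => x _ /=; rewrite ger0_norm// csqnorm_ge0.
Qed.

Lemma L2_dominated u (g : T -> R) :
  (forall j, measurable_fun D (fun x => complex.Re (u x 0 j)) /\
             measurable_fun D (fun x => complex.Im (u x 0 j))) ->
  mu.-integrable D (EFin \o g) -> (forall x, D x -> 0 <= g x) ->
  {ae mu, forall x, D x -> csqnorm (u x) <= g x} -> hdom X u.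
Proof.
move=> m ig g0 ug; split; first by move=> i j; rewrite (ord1 i).
case/integrableP : ig => mg ig; apply: le_lt_trans ig.
apply: ae_ge0_le_integral => //=.
- by move=> x _; rewrite lee_fin csqnorm_ge0.
- apply/measurable_EFinP.
  have -> : (fun x => csqnorm (u x)) = (fun x => \sum_j (
      complex.Re (u x 0 j) ^+ 2 + complex.Im (u x 0 j) ^+ 2)).
    by apply/funext => x; rewrite csqnorm_row.
  apply: measurable_sum => j; have [m1 m2] := m j.
  by apply: measurable_funD; exact: measurable_funX.
- apply/measurable_EFinP; apply: measurableT_comp => //; exact/measurable_EFinP.
- apply: filterS ug => x h Dx; rewrite lee_fin; apply: le_trans (h Dx) _.
  exact: ler_norm.
Qed.

Lemma L2_field_lin (a : R[i]) u v : hdom X u -> hdom X v -> hdom X (a *: u + v).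
Proof.
move=> hu hv; have [mu_ _] := hu; have [mv_ _] := hv.
apply: (@L2_dominated _ (fun x => 2 * (complex.Re a ^+ 2 + complex.Im a ^+ 2) *
    csqnorm (u x) + 2 * csqnorm (v x))).
- move=> j; have [m1 m2] := mu_ 0 j; have [m3 m4] := mv_ 0 j; split.
    have -> : (fun x => complex.Re ((a *: u + v) x 0 j)) = (fun x =>
        (complex.Re a * complex.Re (u x 0 j) - complex.Im a * complex.Im (u x 0 j)) +
        complex.Re (v x 0 j)).
      apply/funext => x; have -> : (a *: u + v) x = a *: u x + v x by [].
      by rewrite !mxE; case: (a) => ? ?; case: (u x 0 j) => ? ?; case: (v x 0 j).
    apply: measurable_funD => //; apply: measurable_funB;
      by apply: measurable_funM => //; exact: measurable_cst.
  have -> : (fun x => complex.Im ((a *: u + v) x 0 j)) = (fun x =>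
      (complex.Re a * complex.Im (u x 0 j) + complex.Im a * complex.Re (u x 0 j)) +
      complex.Im (v x 0 j)).
    apply/funext => x; have -> : (a *: u + v) x = a *: u x + v x by [].
    by rewrite !mxE; case: (a) => ? ?; case: (u x 0 j) => ? ?; case: (v x 0 j).
  apply: measurable_funD => //; apply: measurable_funD;
    by apply: measurable_funM => //; exact: measurable_cst.
- by apply: integrable_lincomb => //; exact: L2_csqnorm_integrable.
- by move=> x _; rewrite addr_ge0 ?mulr_ge0 ?addr_ge0 ?sqr_ge0 ?csqnorm_ge0.
- by apply: aeW => x _; exact: csqnorm_lin.
Qed.

Lemma L2_field0 : hdom X 0.
Proof.
apply: (@L2_dominated _ (fun=> 0)).
- move=> j; split.
    have -> : (fun x => complex.Re ((0 : T -> row) x 0 j)) = cst 0.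
      by apply/funext => x; rewrite mxE.
    exact: measurable_cst.
  have -> : (fun x => complex.Im ((0 : T -> row) x 0 j)) = cst 0.
    by apply/funext => x; rewrite mxE.
  exact: measurable_cst.
- exact: integrable0.
- by [].
- apply: aeW => x _; rewrite csqnorm_row big1// => j _.
  by rewrite mxE /= expr0n/= addr0.
Qed.

Definition bounded_coeff (M : T -> 'M[R]_3) : Prop := forall i j,
  measurable_fun D (fun x => M x i j) /\
  exists C : R, {ae mu, forall x, D x -> `|M x i j| <= C}.

Lemma bounded_coeff_uniform M : bounded_coeff M -> exists2 K : R, 0 <= K &
  {ae mu, forall x, D x -> forall i j, `|M x i j| <= K}.
Proof.
move=> hM; have /choice[C hC] : forall ij : 'I_3 * 'I_3, exists C : R,
    {ae mu, forall x, D x -> `|M x ij.1 ij.2| <= C}.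
  by move=> ij; have [_ h] := hM ij.1 ij.2.
exists (\sum_ij `|C ij|); first exact: sumr_ge0.
have h : {ae mu, forall x, forall ij : 'I_3 * 'I_3, D x -> `|M x ij.1 ij.2| <= C ij}.
  exact: (@filter_forall _ _ (fun ij x => D x -> `|M x ij.1 ij.2| <= C ij) _ _ hC).
apply: filterS h => x h Dx i j; apply: le_trans (h (i, j) Dx) _.
rewrite (bigD1 (i, j))//=; apply: le_trans (ler_norm _) _.
by rewrite lerDl sumr_ge0.
Qed.

Lemma L2_mact M u : bounded_coeff M -> hdom X u -> hdom X (fun x => mact (M x) (u x)).
Proof.
move=> hM hu; have [K K0 hK] := bounded_coeff_uniform hM; have [mu_ _] := hu.
apply: (@L2_dominated _ (fun x => 9 * K ^+ 2 * csqnorm (u x) + 0 * csqnorm (u x))).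
- move=> j; split.
    apply: (eq_measurable_fun (fun x => \sum_k complex.Re (u x 0 k) * M x j k)).
      by move=> x _; rewrite Re_mact.
    apply: measurable_sum => k; apply: measurable_funM; last by case: (hM j k).
    by case: (mu_ 0 k).
  apply: (eq_measurable_fun (fun x => \sum_k complex.Im (u x 0 k) * M x j k)).
    by move=> x _; rewrite Im_mact.
  apply: measurable_sum => k; apply: measurable_funM; last by case: (hM j k).
  by case: (mu_ 0 k).
- by apply: integrable_lincomb => //; exact: L2_csqnorm_integrable.
- by move=> x _; rewrite mul0r addr0 !mulr_ge0 ?sqr_ge0 ?csqnorm_ge0.
- by apply: filterS hK => x h Dx; rewrite mul0r addr0; exact: csqnorm_mact (h Dx).
Qed.

Lemma L2_cdot_cintegrable u v : hdom X u -> hdom X v ->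
  cintegrable mu D (fun x => cdot (u x) (v x)).
Proof.
move=> hu hv; have [mu_ _] := hu; have [mv_ _] := hv.
have ig : mu.-integrable D (EFin \o (fun x => 1 * csqnorm (u x) + 1 * csqnorm (v x))).
  by apply: integrable_lincomb => //; exact: L2_csqnorm_integrable.
split; apply: dominated_integrable ig => //.
- apply: (eq_measurable_fun (fun x => \sum_j (
    complex.Re (u x 0 j) * complex.Re (v x 0 j) +
    complex.Im (u x 0 j) * complex.Im (v x 0 j)))).
    move=> x _; rewrite cdot_row Re_sum; apply: eq_bigr => j _.
    by case: (u x 0 j) => ? ?; case: (v x 0 j) => ? ? /=; ring.
  apply: measurable_sum => j; have [m1 m2] := mu_ 0 j; have [m3 m4] := mv_ 0 j.
  by apply: measurable_funD; exact: measurable_funM.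
- by move=> x _; rewrite !mul1r; case: (cdot_le (u x) (v x)).
- apply: (eq_measurable_fun (fun x => \sum_j (
    complex.Im (u x 0 j) * complex.Re (v x 0 j) -
    complex.Re (u x 0 j) * complex.Im (v x 0 j)))).
    move=> x _; rewrite cdot_row Im_sum; apply: eq_bigr => j _.
    by case: (u x 0 j) => ? ?; case: (v x 0 j) => ? ? /=; ring.
  apply: measurable_sum => j; have [m1 m2] := mu_ 0 j; have [m3 m4] := mv_ 0 j.
  by apply: measurable_funB; exact: measurable_funM.
- by move=> x _; rewrite !mul1r; case: (cdot_le (u x) (v x)).
Qed.

Lemma conjc_sum (I : finType) (F : I -> R[i]) :
  conjc (\sum_i F i) = \sum_i conjc (F i).
Proof.
apply/eqP; rewrite eq_complex Re_sum Im_sum.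
have -> : complex.Re (conjc (\sum_i F i)) = complex.Re (\sum_i F i).
  by case: (\sum_i F i).
have -> : complex.Im (conjc (\sum_i F i)) = - complex.Im (\sum_i F i).
  by case: (\sum_i F i).
rewrite Re_sum Im_sum -sumrN; apply/andP; split; apply/eqP; apply: eq_bigr => i _;
  by case: (F i).
Qed.

Lemma cdot_mact (M : 'M[R]_3) (v w : row) :
  cdot v (mact M w) = \sum_j \sum_k (M j k)%:C * (v 0 j * conjc (w 0 k)).
Proof.
rewrite cdot_row; apply: eq_bigr => j _; rewrite mactE conjc_sum mulr_sumr.
apply: eq_bigr => k _; case: (v 0 j) => a b; case: (w 0 k) => c e.
by apply/eqP; rewrite eq_complex/=; apply/andP; split; apply/eqP; ring.
Qed.

Lemma cdot_mact_conj (M : 'M[R]_3) (v w : row) : M^T = M ->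
  cdot w (mact M v) = conjc (cdot v (mact M w)).
Proof.
move=> sM; rewrite !cdot_mact conjc_sum exchange_big/=; apply: eq_bigr => j _.
rewrite conjc_sum; apply: eq_bigr => k _.
have -> : M k j = M j k by rewrite -[in LHS]sM mxE.
case: (v 0 j) => a b; case: (w 0 k) => c e.
by apply/eqP; rewrite eq_complex/=; apply/andP; split; apply/eqP; ring.
Qed.

(** For v = a + i b and a real symmetric M, the cross terms cancel and the form is a M a^T + b M
    b^T. *)
Lemma cdot_mact_ge0 (M : 'M[R]_3) (v : row) : M^T = M ->
  (forall w : 'rV[R]_3, 0 <= (w *m M *m w^T) 0 0) -> 0 <= cdot v (mact M v).
Proof.
move=> sM pM; rewrite lecE; apply/andP; split.
  have := congr1 (@complex.Im R) (cdot_mact_conj v v sM).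
  by case: (cdot _ _) => a b /= h; apply/eqP; lra.
pose a : 'rV[R]_3 := \row_j complex.Re (v 0 j).
pose b : 'rV[R]_3 := \row_j complex.Im (v 0 j).
have -> : complex.Re (cdot v (mact M v)) =
    (a *m M *m a^T) 0 0 + (b *m M *m b^T) 0 0.
  have q (w : 'rV[R]_3) : (w *m M *m w^T) 0 0 = \sum_j \sum_k M j k * (w 0 j * w 0 k).
    rewrite mxE exchange_big/=; apply: eq_bigr => k _.
    rewrite !mxE mulr_suml; apply: eq_bigr => j _; ring.
  rewrite !q -big_split/= cdot_mact Re_sum; apply: eq_bigr => j _.
  rewrite -big_split/= Re_sum; apply: eq_bigr => k _; rewrite !mxE.
  by case: (v 0 j) => ? ?; case: (v 0 k) => ? ? /=; ring.
by rewrite addr_ge0.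
Qed.

Lemma weighted_pre_hilbert M : bounded_coeff M ->
  {ae mu, forall x, D x -> (M x)^T = M x} ->
  {ae mu, forall x, D x -> forall v : 'rV[R]_3, 0 <= (v *m M x *m v^T) 0 0} ->
  pre_hilbert (HSpace (hdom X) (fun u v => hip X u (fun x => mact (M x) (v x)))).
Proof.
move=> hM sM pM.
apply: (@cint_pre_hilbert _ _ _ mu D mD _ _ (fun u v x => cdot (u x) (mact (M x) (v x)))).
- exact: L2_field0.
- exact: L2_field_lin.
- by move=> u v hu hv; apply: L2_cdot_cintegrable => //; exact: L2_mact.
- move=> a u v w _ _ _; apply: aeW => x _; rewrite !cdot_row mulr_sumr -big_split/=.
  by apply: eq_bigr => j _; rewrite !mxE mulrDl mulrA.
- by move=> u v _ _; apply: filterS sM => x h Dx; apply: cdot_mact_conj; exact: h.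
- move=> u _; apply: filterS2 sM pM => x h1 h2 Dx; apply: cdot_mact_ge0; first exact: h1.
  exact: h2.
Qed.

End SquareIntegrable.

(** * Measurable bounded inverses of uniformly positive definite matrices *)

Section InverseCoefficient.
Variables (R : realType) (d : measure_display) (T : measurableType d).
Variables (mu : {measure set T -> \bar R}) (D : set T).

Lemma measurable_det n (M : T -> 'M[R]_n) :
  (forall i j, measurable_fun D (fun x => M x i j)) ->
  measurable_fun D (fun x => \det (M x)).
Proof.
move=> hM; apply: measurable_sum => s; apply: measurable_funM.
  exact: measurable_cst.
by apply: measurable_prod => i _; exact: hM.
Qed.

(* A formula for the inverse whose measurability needs no case distinction on the
   invertibility of A. *)
Definition inv_coeff (A : 'M[R]_3) : 'M[R]_3 :=
  (((\det A ^+ 2) `^ (-1)) * \det A) *: \adj A.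

Lemma inv_coeff_measurable (M : T -> 'M[R]_3) i j :
  (forall i j, measurable_fun D (fun x => M x i j)) ->
  measurable_fun D (fun x => inv_coeff (M x) i j).
Proof.
move=> hM.
have md := measurable_det hM.
apply: (eq_measurable_fun (fun x => ((\det (M x) ^+ 2) `^ (-1) * \det (M x)) *
    ((-1) ^+ (j + i) * \det (row' j (col' i (M x)))))).
  by move=> x _; rewrite /inv_coeff !mxE.
apply: measurable_funM; last first.
  apply: measurable_funM; first exact: measurable_cst.
  apply: measurable_det => k l.
  by apply: (eq_measurable_fun (fun x => M x (lift j k) (lift i l))) => // x _;
    rewrite !mxE.
apply: measurable_funM => //.
have -> : (fun x => (\det (M x) ^+ 2) `^ (-1)) =
  (@powR R ^~ (-1)) \o (fun x => \det (M x) ^+ 2) by [].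
by apply: measurableT_comp; [exact: measurable_powR|exact: measurable_funX].
Qed.

(** Let N be the inverse and test the form with its row i: since N_i M is the i-th unit vector, c
    |N_i|^2 <= N_ii. Hence N_ii <= 1/c, and then N_ij^2 <= N_ii / c <= 1/c^2. *)
Lemma posdef_invmx (c : R) (M : 'M[R]_3) : 0 < c ->
  (forall v : 'rV[R]_3, c * dot3 v v <= (v *m M *m v^T) 0 0) ->
  M \in unitmx /\ forall i j, `|invmx M i j| <= c^-1.
Proof.
move=> c0 hM.
have dotE (v : 'rV[R]_3) : dot3 v v = \sum_j v 0 j ^+ 2.
  by apply: eq_bigr => j _; rewrite expr2.
have uM : M \in unitmx.
  rewrite unitmxE unitfE; apply/det0P => -[v v0 vM].
  have := hM v; rewrite vM mul0mx mxE pmulr_rle0// dotE => h.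
  case/negP: v0; apply/eqP/rowP => j; rewrite mxE.
  apply/eqP; rewrite -sqrf_eq0 eq_le sqr_ge0 andbT; apply: le_trans h.
  by rewrite (bigD1 j)//= lerDl sumr_ge0// => k _; rewrite sqr_ge0.
split => // i j; set N := invmx M.
have := hM (row i N).
have -> : row i N *m M = delta_mx 0 i by rewrite -row_mul mulVmx// row1.
rewrite -rowE !mxE dotE.
have sN k : N i k ^+ 2 <= \sum_j (row i N) 0 j ^+ 2.
  by rewrite (bigD1 k)//= mxE lerDl sumr_ge0// => l _; rewrite sqr_ge0.
move=> h.
have h2 k : c * N i k ^+ 2 <= N i i by apply: le_trans h; rewrite ler_pM2l.
have Nii : N i i <= c^-1.
  have [np|nn] := ltP 0 (N i i); last by rewrite (le_trans nn)// invr_ge0 ltW.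
  by have := h2 i; rewrite expr2 mulrA ger_pMl// -ler_pdivlMl// mulr1.
rewrite -(@ler_pXn2r _ 2)// ?nnegrE ?invr_ge0 ?(ltW c0)// real_normK ?num_real//.
by have := le_trans (h2 j) Nii; rewrite -ler_pdivlMl.
Qed.

Lemma inv_coeffE (A : 'M[R]_3) : A \in unitmx -> inv_coeff A = invmx A.
Proof.
move=> u; have := u; rewrite unitmxE unitfE => d0.
rewrite /inv_coeff /invmx u powR_inv1 ?sqr_ge0//; congr (_ *: _); field.
exact: d0.
Qed.

Lemma inv_coeff_bounded (M : T -> 'M[R]_3) (c : R) : bounded_coeff mu D M -> 0 < c ->
  {ae mu, forall x, D x -> forall v : 'rV[R]_3, c * dot3 v v <= (v *m M x *m v^T) 0 0} ->
  bounded_coeff mu D (fun x => inv_coeff (M x)) /\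
  {ae mu, forall x, D x -> inv_coeff (M x) = invmx (M x)}.
Proof.
move=> bM c0 pM; split.
  move=> i j; split; first by apply: inv_coeff_measurable => k l; case: (bM k l).
  exists c^-1; apply: filterS pM => x h Dx; have [u hu] := posdef_invmx c0 (h Dx).
  by rewrite inv_coeffE.
by apply: filterS pM => x h Dx; have [u _] := posdef_invmx c0 (h Dx); exact: inv_coeffE.
Qed.

End InverseCoefficient.

Lemma pre_hilbert_pair (R : realType) (V W : lmodType R[i]) (X : hspace V)
    (Y : hspace W) : pre_hilbert X -> pre_hilbert Y ->
  pre_hilbert (HSpace [set y : V * W | hdom X y.1 /\ hdom Y y.2]
    (fun y z => hip X y.1 z.1 + hip Y y.2 z.2)).
Proof.
move=> [[a1 a2] b1 c1 d1] [[a1' a2'] b2 c2 d2]; split => /=.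
- by split => // a y z [y1 y2] [z1 z2]; split; [exact: a2|exact: a2'].
- move=> a y z w [y1 y2] [z1 z2] [w1 w2].
  by rewrite b1// b2// mulrDr addrACA.
- move=> y z [y1 y2] [z1 z2]; rewrite c1// c2//.
  case: (hip X _ _) => ? ?; case: (hip Y _ _) => ? ? /=.
  by apply/eqP; rewrite eq_complex/=; apply/andP; split; apply/eqP; ring.
- by move=> y [y1 y2]; rewrite addr_ge0 ?d1 ?d2.
Qed.

(** * The space Y and the domain of the adjoint Maxwell operator *)

Section MaxwellSpace.
Variable R : realType.
Local Notation pt := (R * R * R)%type.
Variables (Om : set pt) (eps mu sigma : pt -> 'M[R]_3).
Hypothesis oOm : open Om.
Hypothesis heps : [/\ symmetric_coeff Om eps, uniformly_posdef Om eps &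
                forall i j, W1_infty Om (fun x => eps x i j)].
Hypothesis hmu : [/\ symmetric_coeff Om mu, uniformly_posdef Om mu &
               forall i j, W1_infty Om (fun x => mu x i j)].
Hypothesis hsigma : forall i j, L_infty Om (fun x => sigma x i j).

Let mOm := open_measurable3 oOm.

Lemma ae_in_sub (P Q : pt -> Prop) : (forall x, Om x -> P x -> Q x) ->
  ae_in Om P -> ae_in Om Q.
Proof.
move=> PQ; apply: (@filterS _ _ (ae_filter_ringOfSetsType _)) => x h Ox.
by apply: PQ => //; exact: h.
Qed.

Lemma W1_infty_bounded (M : pt -> 'M[R]_3) :
  (forall i j, W1_infty Om (fun x => M x i j)) -> bounded_coeff (volume R) Om M.
Proof. by move=> hM i j; case: (hM i j) => h _. Qed.

Let weighted (M : pt -> 'M[R]_3) : [/\ symmetric_coeff Om M, uniformly_posdef Om M &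
    forall i j, W1_infty Om (fun x => M x i j)] ->
  pre_hilbert (HSpace (hdom (L2_dom Om))
    (fun u v => hip (L2_dom Om) u (fun x => mact (M x) (v x)))).
Proof.
move=> [sM [c c0 pM] hM]; apply: (weighted_pre_hilbert mOm).
- exact: W1_infty_bounded.
- exact: sM.
- apply: ae_in_sub pM => x _ h v; apply: le_trans (h v).
  by rewrite mulr_ge0 ?(ltW c0)// sumr_ge0// => j _; rewrite -expr2 sqr_ge0.
Qed.

Lemma Y_space_pre_hilbert : pre_hilbert (Y_space Om eps mu).
Proof. exact: (pre_hilbert_pair (weighted heps) (weighted hmu)). Qed.

(** The two formulas differ only in the signs of the curl terms, so the task is to exhibit a value
    of the adjoint operator in L^2. The value is written with [inv_coeff], which is measurable and
    bounded and agrees almost everywhere with the inverse of eps. Density of the domain of A thereby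
    passes to that of its adjoint. *)
Lemma maxwell_dom_sub :
  gdom (maxwell_op Om eps mu sigma) `<=` gdom (maxwell_adjoint Om eps mu sigma).
Proof.
move=> y [z [[dz1 dz2] [c1 [c2 [h1 h2 h3 h4 h5]]]]].
have [_ [c c0 pM] hM] := heps.
have [bN NE] := inv_coeff_bounded (W1_infty_bounded hM) c0 pM.
set N := fun x => inv_coeff (eps x) in bN.
have lin := @L2_field_lin _ _ _ (volume R) Om mOm.
have [dy1 _ _] := h1; have [_ dc2 _] := h2.
have d0 := L2_field0 (volume R) mOm.
have d1 : hdom (L2_dom Om) (fun x => mact (N x) (c2 x)) by exact: (L2_mact mOm).
have d2 : hdom (L2_dom Om) (fun x => mact (N x) (mact (sigma x) (y.1 x))).
  by apply: (L2_mact mOm bN); apply: (L2_mact mOm).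
pose w1 : pt -> 'rV[R[i]]_3 :=
  fun x => - mact (N x) (c2 x) - mact (N x) (mact (sigma x) (y.1 x)).
exists (w1, - z.2); split.
  split => /=.
    have -> : w1 = (-1 : R[i]) *: (fun x => mact (N x) (c2 x)) +
        ((-1 : R[i]) *: (fun x => mact (N x) (mact (sigma x) (y.1 x))) + 0).
      by rewrite addr0 !scaleN1r.
    exact: (lin _ _ _ d1 (lin _ _ _ d2 d0)).
  have -> : - z.2 = (-1 : R[i]) *: z.2 + 0 by rewrite scaleN1r addr0.
  exact: (lin _ _ _ dz2 d0).
exists c1, c2; split => //=.
  by apply: ae_in_sub NE => x _ h; rewrite /= /w1 /N h.
apply: ae_in_sub h5 => x _ h.
by have -> : (- z.2) x = - z.2 x by []; rewrite h// opprK.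
Qed.

End MaxwellSpace.

Theorem proposition4p2 (R : realType) (Tf : R) (Om : set (R * R * R))
    (eps mu sigma : R * R * R -> 'M[R]_3)
    (* setting *)
    (hTf : 0 < Tf)
    (hOm : [/\ open Om, connected Om, bounded_set Om & C11_domain Om])
    (heps : [/\ symmetric_coeff Om eps, uniformly_posdef Om eps &
                forall i j, W1_infty Om (fun x => eps x i j)])
    (hmu : [/\ symmetric_coeff Om mu, uniformly_posdef Om mu &
               forall i j, W1_infty Om (fun x => mu x i j)])
    (hsigma : [/\ symmetric_coeff Om sigma, nonneg_def Om sigma &
                  forall i j, L_infty Om (fun x => sigma x i j)])
    (* the space U, through the square root Lam of minus the Laplace-Beltrami
       operator *)
    (hLB : [/\ selfadjoint (L2_tan Om) (laplace_beltrami Om),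
               positive_graph (L2_tan Om) (laplace_beltrami Om) &
               invertible_graph (L2_tan Om) (laplace_beltrami Om)])
    (Lam : (R * R * R -> 'rV[R[i]]_3) -> (R * R * R -> 'rV[R[i]]_3) -> Prop)
    (hLam : is_sqrt_graph (L2_tan Om) (laplace_beltrami Om) Lam)
    (ipU : (R * R * R -> 'rV[R[i]]_3) -> (R * R * R -> 'rV[R[i]]_3) -> R[i])
    (hipU : is_U_inner_product Om Lam ipU) :
  let field := R * R * R -> 'rV[R[i]]_3 in
  let U := U_space Om ipU in
  let Y := Y_space Om eps mu in
  let A := maxwell_op Om eps mu sigma in
  let As := maxwell_adjoint Om eps mu sigma in
  forall (* the semigroups e^{tA} and its adjoint, the resolvents (nI - A)^-1 and
            the Green map *)
    (S Ss : R -> field * field -> field * field)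
    (hS : generates_contraction_semigroup Y A S)
    (hAs : is_adjoint_graph Y A As)
    (hSs : forall t, 0 <= t -> is_adjoint Y (S t) (Ss t))
    (Res : nat -> field * field -> field * field)
    (hRes : forall n, (0 < n)%N -> is_resolvent Y A (n%:R : R[i]) (Res n))
    (Gr : field -> field * field)
    (hGr : is_green_map Om eps mu sigma U Gr)
    (hwp : well_posed Y U As S Ss Gr Tf)
    (* the observation G, its approximations and their adjoints *)
    (alpha : R) (halpha : 0 < alpha)
    (G Gs : field * field -> field * field)
    (hG : bounded_op Y Y G) (hGs : is_adjoint Y G Gs)
    (Gns : nat -> field * field -> field * field),
  let Gn := fun (n : nat) y => G ((n%:R : R[i]) *: Res n y) in
  forall
    (hGns : forall n, (0 < n)%N -> is_adjoint Y (Gn n) (Gns n))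
    (* the optimal controls and states *)
    (ghat : R -> field * field -> R -> field)
    (yhat : R -> field * field -> R -> field * field)
    (hopt : forall s y0, 0 <= s < Tf -> hdom Y y0 ->
       is_optimal Y U As S Ss Gr alpha G s Tf y0 (ghat s y0) (yhat s y0))
    (ghatn : nat -> R -> field * field -> R -> field)
    (yhatn : nat -> R -> field * field -> R -> field * field)
    (hoptn : forall n s y0, (0 < n)%N -> 0 <= s < Tf -> hdom Y y0 ->
       is_optimal Y U As S Ss Gr alpha (Gn n) s Tf y0
         (ghatn n s y0) (yhatn n s y0)),
  let P := cost_operator Ss G Gs Tf yhat in
  let Pn := fun n => cost_operator Ss (Gn n) (Gns n) Tf (yhatn n) in
  [/\ (forall y0, hdom Y y0 -> forall e : R, 0 < e ->
         \forall n \near \oo, forall s, 0 <= s < Tf ->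
           L2norm_in_time U s Tf (fun t => ghatn n s y0 t - ghat s y0 t) < e),
      (forall y0, hdom Y y0 -> forall e : R, 0 < e ->
         \forall n \near \oo, forall s, 0 <= s < Tf ->
           forall t, s <= t <= Tf -> hnorm Y (yhatn n s y0 t - yhat s y0 t) < e),
      (forall y0, hdom Y y0 -> forall e : R, 0 < e ->
         \forall n \near \oo, forall s, 0 <= s < Tf ->
           `|cost Y U alpha (Gn n) s Tf (ghatn n s y0) (yhatn n s y0) -
             cost Y U alpha G s Tf (ghat s y0) (yhat s y0)| < e) &
      (forall z, hdom Y z ->
         [/\ continuous_in_time Y 0 Tf (fun t => P t z),
             forall n, (0 < n)%N -> continuous_in_time Y 0 Tf (fun t => Pn n t z) &
             forall e : R, 0 < e -> \forall n \near \oo,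
               forall t, 0 <= t <= Tf -> hnorm Y (Pn n t z - P t z) < e])].
Proof.
move=> field U Y A As S Ss hS hAs hSs Res hRes Gr hGr hwp alpha halpha G Gs hG hGs
  Gns Gn hGns ghat yhat hopt ghatn yhatn hoptn P Pn.
have [oOm _ _ _] := hOm; have [_ _ bsigma] := hsigma.
have hY : pre_hilbert Y by exact: Y_space_pre_hilbert.
have hU : pre_hilbert U by case: hipU => -[? ? ? ? _] _ _ _; split.
have dAs : hdense Y (gdom As).
  move=> x dx e e0; have [y Ay xy] := hAs.1 x dx e e0; exists y => //.
  exact: maxwell_dom_sub Ay.
have [bGr _] := hGr.
have [C C0 [Phi hPhi]] := state_family hU hTf hwp.
have [M M0 hM] := bop_bound hG.
split.
- move=> y0 dy0 e e0.
  exact: (control_L2_cvg hY hU hS hAs hSs bGr dAs hTf C0 hPhi halpha hG hGs hRes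
    hGns dy0 (fun s sT => hopt s y0 sT dy0) (fun n s n0 sT => hoptn n s y0 n0 sT dy0)
    M0 hM e0).
- move=> y0 dy0 e e0.
  exact: (state_cvg hY hU hS hAs hSs bGr dAs hTf C0 hPhi halpha hG hGs hRes
    hGns dy0 (fun s sT => hopt s y0 sT dy0) (fun n s n0 sT => hoptn n s y0 n0 sT dy0)
    M0 hM e0).
- move=> y0 dy0 e e0.
  exact: (cost_cvg hY hU hS hAs hSs bGr dAs hTf C0 hPhi halpha hG hGs hRes
    hGns dy0 (fun s sT => hopt s y0 sT dy0) (fun n s n0 sT => hoptn n s y0 n0 sT dy0)
    M0 hM e0).
(* Convergence in C([0, T], Y) includes that P and every P_n with n > 0 are continuous in time, so
   this is proved before the uniform estimate. *)
- move=> z dz; split.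
  + have ho s (sT : 0 <= s < Tf) := hopt s z sT dz.
    exact: (cost_operator_continuous hY hU hS hAs hSs bGr dAs hTf C0 hPhi halpha dz
      M0 hG hM hGs (extended_optimal hY hU hS hAs hSs bGr dAs hTf hPhi halpha
        hG dz ho)).
  + move=> n n0; have ho s (sT : 0 <= s < Tf) := hoptn n s z n0 sT dz.
    have bGn := observation_bop hY hS hRes hG n0.
    exact: (cost_operator_continuous hY hU hS hAs hSs bGr dAs hTf C0 hPhi halpha dz
      M0 bGn (fun v => @observation_le _ _ _ hY _ _ _ hS hRes _ _ hM M0 n v n0)
      (hGns n n0) (extended_optimal hY hU hS hAs hSs bGr dAs hTf hPhi halpha
        bGn dz ho)).
  + move=> e e0.
    exact: (cost_operator_cvg hY hU hS hAs hSs bGr dAs hTf C0 hPhi halpha hG hGs hRes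
      hGns dz (fun s sT => hopt s z sT dz) (fun n s n0 sT => hoptn n s z n0 sT dz)
      M0 hM e0).
Qed.
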